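(* Let $0\le k\le n$ and let $r$ be an integer. The pointwise-defined map $(\Phi^* )^{-1}\circ(u_N*_{S^n})\circ\Phi^*$, which sends a $k$-form $a$ on $T^n$ to the $(n-k)$-form $b$ on $T^n$ with $\Phi^*b=u_N\,( *_{S^n}\Phi^*a)$, is an isomorphism between the following spaces: \begin{align*} \mathcal P_r\Lambda^k(T^n)&\xrightarrow{\ \simeq\ }\mathring{\mathcal P}_{r+k+1}^-\Lambda^{n-k}(T^n),\\ \mathcal P_r^-\Lambda^k(T^n)&\xrightarrow{\ \simeq\ }\mathring{\mathcal P}_{r+k}\Lambda^{n-k}(T^n). \end{align*} Moreover, the two spaces $\mathcal P_r\Lambda^k(T^n)$ and $\mathring{\mathcal P}_{r+k+1}^-\Lambda^{n-k}(T^n)$ are isomorphic via pointwise-defined maps to $\mathcal P_{2r+k}\Lambda^k_e(S^n)$, and the two spaces $\mathcal P_r^-\Lambda^k(T^n)$ and $\mathring{\mathcal P}_{r+k}\Lambda^{n-k}(T^n)$ are isomorphic via pointwise-defined maps to $\mathcal P_{2r+k-1}\Lambda^{n-k}_o(S^n)$.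
   Context: Let $n\ge1$. $T^n=\{x\in\mathbb R^{n+1}: x_i\ge0 \text{ for all } i,\ x_1+\dotsb+x_{n+1}=1\}$ and $S^n=\{u\in\mathbb R^{n+1}: u_1^2+\dotsb+u_{n+1}^2=1\}$; $T^n_{>0}$ and $S^n_{>0}$ are the subsets where all coordinates are strictly positive. $\Lambda^k(M)$ denotes the space of differential $k$-forms on $M$, for $M=T^n$, $S^n$, or $\mathbb R^{n+1}$; $a_x$ denotes the value of $a$ at $x$, an antisymmetric $k$-linear tensor on the tangent space at $x$. The restriction of a form on $\mathbb R^{n+1}$ to $T^n$ or $S^n$ is its pullback under inclusion. $\Phi\colon\mathbb R^{n+1}\to\mathbb R^{n+1}$ is $\Phi(u)=(u_1^2,\dotsc,u_{n+1}^2)$; it maps $S^n$ to $T^n$ and restricts to a diffeomorphism $S^n_{>0}\to T^n_{>0}$. The pullback $\Phi^*\colon\Lambda^k(T^n)\to\Lambda^k(S^n)$ is injective; $(\Phi^* )^{-1}$ is its inverse on its image. A map between spaces of differential forms is called pointwise-defined if the value of the output form at a point depends only on the value of the input form at that point (for maps between forms on $T^n$ and forms on $S^n$, at the point corresponding to it under $x=\Phi(u)$). $\mathcal P_r\Lambda^k(\mathbb R^{n+1})$ is the space of $k$-forms on $\mathbb R^{n+1}$ whose coefficients are polynomials of degree at most $r$ (it is $\{0\}$ if $r<0$). With the radial vector field $X=\sum_{i=1}^{n+1}x_i\frac{\partial}{\partial x_i}$ and interior product $i_X$, $\mathcal P_r^-\Lambda^k(\mathbb R^{n+1}):=i_X\mathcal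 P_{r-1}\Lambda^{k+1}(\mathbb R^{n+1})$. For $M=T^n$ or $S^n$, $\mathcal P_r\Lambda^k(M)$ and $\mathcal P_r^-\Lambda^k(M)$ are the spaces of restrictions to $M$ of elements of $\mathcal P_r\Lambda^k(\mathbb R^{n+1})$ and $\mathcal P_r^-\Lambda^k(\mathbb R^{n+1})$. $\mathring{\mathcal P}_r\Lambda^k(T^n)$ and $\mathring{\mathcal P}_r^-\Lambda^k(T^n)$ are the subspaces of those forms in $\mathcal P_r\Lambda^k(T^n)$ and $\mathcal P_r^-\Lambda^k(T^n)$ whose restriction to $\partial T^n$ vanishes, i.e. $a_x(V_1,\dotsc,V_k)=0$ for any $x\in\partial T^n$ and any $V_1,\dotsc,V_k$ tangent to $\partial T^n$. Let $R_i\colon\mathbb R^{n+1}\to\mathbb R^{n+1}$ be the reflection changing the sign of $u_i$. A form $\alpha$ on $S^n$ is even if $R_i^*\alpha=\alpha$ for every $i$, and odd if $R_i^*\alpha=-\alpha$ for every $i$. $\mathcal P_s\Lambda^k_e(S^n)$ and $\mathcal P_s\Lambda^k_o(S^n)$ denote the subspaces of even, respectively odd, forms in $\mathcal P_s\Lambda^k(S^n)$. $*_{S^n}\colon\Lambda^k(S^n)\to\Lambda^{n-k}(S^n)$ is the Hodge star of the standard metric on $S^n$, with $S^n$ oriented by the outward normal. $u_N:=u_1u_2\dotsm u_{n+1}$, and $u_N*_{S^n}$ is the Hodge star followed by multiplication by $u_N$.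
   Formalization: The case k = r = 0 is excluded from the isomorphisms of the ring space P_{r+k}Λ^{n-k}(T^n) with P_r^-Λ^k(T^n) and with the odd forms: there the latter two are zero but the former is 1-dimensional. The sphere maps for ring spaces are taken from S^n to T^n. *)

(* Defs.v *)
From mathcomp Require Import all_boot all_order all_algebra perm.
From mathcomp Require Import all_classical all_reals all_analysis.
(* Not imported: its notations clash with those of mathcomp-analysis. *)
From mathcomp Require mpoly.

Set Implicit Arguments.
Unset Strict Implicit.
Unset Printing Implicit Defensive.

Import Order.TTheory GRing.Theory Num.Theory.
Import numFieldNormedType.Exports.

Local Open Scope classical_set_scope.
Local Open Scope ring_scope.

Section Forms.
Variables (R : realType) (n : nat).

(* Coordinates are numbered from 0 to n. *)
Notation E := 'rV[R]_n.+1.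

(* [a x v] is the value a_x(v_0, ..., v_{k-1}).  A form on a subset M of R^{n+1}
   has the same type; it is set to 0 off M and on non-tangent vectors, so that
   Leibniz equality is equality of forms on M.  The codomain is R^o so that the
   pointwise vector space structure of function types is inferred. *)
Definition dform (k : nat) : Type := E -> ('I_k -> E) -> R^o.

Record submfd := Submfd {
  points : set E ;
  tangent : E -> set E
}.

(* At a boundary point the tangent space of the manifold with corners T^n is
   still the whole hyperplane. *)
Definition simplex : submfd := Submfd
  [set x : E | (forall i, 0 <= x ord0 i) /\ \sum_i x ord0 i = 1]
  (fun _ => [set v : E | \sum_i v ord0 i = 0]).

Definition dotp (u v : E) : R := \sum_i u ord0 i * v ord0 i.

Definition sphere : submfd := Submfd
  [set u : E | dotp u u = 1]
  (fun u => [set v : E | dotp u v = 0]).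

Definition alternating k (w : ('I_k -> E) -> R) : Prop :=
  (forall (v : 'I_k -> E) (j : 'I_k) (c : R) (y z : E),
     w [eta v with j |-> c *: y + z] =
     c * w [eta v with j |-> y] + w [eta v with j |-> z]) /\
  (forall (v : 'I_k -> E) (i j : 'I_k), i != j ->
     w (v \o tperm i j) = - w v).

Definition restr_form (M : submfd) k (a : dform k) : dform k := fun x v =>
  if `[< points M x /\ forall j, tangent M x (v j) >] then a x v else 0.

(* Pullback to M under (the restriction to M of) a differentiable map f. *)
Definition pullback (M : submfd) (f : E -> E) k (a : dform k) : dform k :=
  restr_form M (fun x v => a (f x) (fun j => 'd f x (v j))).

Definition basis_vec (i : 'I_n.+1) : E := delta_mx ord0 i.

Fixpoint Cdiff (m : nat) (g : E -> R^o) : Prop :=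
  continuous g /\
  if m is m'.+1 then
    forall i, (forall x, derivable g x (basis_vec i)) /\
              Cdiff m' ('D_(basis_vec i) g)
  else True.

Definition smooth (g : E -> R^o) : Prop := forall m, Cdiff m g.

(* The coefficients of a form are its values on tuples of basis vectors. *)
Definition coef k (a : dform k) (f : 'I_k -> 'I_n.+1) : E -> R^o :=
  fun x => a x (fun j => basis_vec (f j)).

Definition Lambda_amb k : set (dform k) :=
  [set a | (forall x, alternating (a x)) /\ forall f, smooth (coef a f)].

Definition Lambda (M : submfd) k : set (dform k) :=
  @restr_form M k @` Lambda_amb (k := k).

(* For r < 0 only the zero polynomial qualifies. *)
Definition is_poly (r : int) (g : E -> R) : Prop :=
  exists p : mpoly.mpoly n.+1 R,
    (forall m, mpoly.mcoeff m p != 0 -> (mpoly.mdeg m)%:Z <= r) /\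
    (forall x, g x = mpoly.meval (x ord0) p).

Definition P_amb (r : int) k : set (dform k) :=
  [set a | (forall x, alternating (a x)) /\ forall f, is_poly r (coef a f)].

(* Interior product with the radial vector field X_x = x. *)
Definition iX k (c : dform k.+1) : dform k := fun x v =>
  c x (fun i => if unlift ord0 i is Some j then v j else x).

Definition Pminus_amb (r : int) k : set (dform k) :=
  @iX k @` P_amb (r - 1) (k := k.+1).

Definition P_ (r : int) k (M : submfd) : set (dform k) :=
  @restr_form M k @` P_amb r (k := k).

Definition Pminus (r : int) k (M : submfd) : set (dform k) :=
  @restr_form M k @` Pminus_amb r (k := k).

(* The restriction to each facet {x_i = 0} of T^n vanishes: the vectors
   v_0, ..., v_{k-1} are all tangent to the same facet. *)
Definition zero_on_boundary k (a : dform k) : Prop :=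
  forall (i : 'I_n.+1) (x : E) (v : 'I_k -> E),
    points simplex x -> x ord0 i = 0 ->
    (forall j, tangent simplex x (v j) /\ v j ord0 i = 0) ->
    a x v = 0.

(* [P0], [P0minus] are the spaces with a ring accent. *)
Definition P0 (r : int) k : set (dform k) :=
  P_ r (k := k) simplex `&` [set a | zero_on_boundary a].

Definition P0minus (r : int) k : set (dform k) :=
  Pminus r (k := k) simplex `&` [set a | zero_on_boundary a].

Definition reflection (i : 'I_n.+1) (u : E) : E :=
  \row_j (if j == i then - u ord0 j else u ord0 j).

Definition even_form k (a : dform k) : Prop :=
  forall i, pullback sphere (reflection i) a = a.

Definition odd_form k (a : dform k) : Prop :=
  forall i, pullback sphere (reflection i) a = - a.

Definition P_even (s : int) k : set (dform k) :=
  P_ s (k := k) sphere `&` [set a | even_form a].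

Definition P_odd (s : int) k : set (dform k) :=
  P_ s (k := k) sphere `&` [set a | odd_form a].

(* [e 0, ..., e n.-1] is an orthonormal basis of T_u S^n, positive for the
   orientation by the outward normal u; the other values of e are ignored. *)
Definition oriented_frame (u : E) (e : nat -> E) : Prop :=
  [/\ forall i, (i < n)%N -> tangent sphere u (e i),
      forall i j, (i < n)%N -> (j < n)%N -> dotp (e i) (e j) = (i == j)%:R
    & 0 < \det (\matrix_(i < n.+1, j < n.+1)
                  (if (i : nat) is i'.+1 then e i' else u) ord0 j)].

(* ( *a )(e_{k+1}, ..., e_n) = a(e_1, ..., e_k) for each positive orthonormal
   basis (e_1, ..., e_n) of the tangent space. *)
Definition is_hodge k (a : dform k) (b : dform (n - k)) : Prop :=
  (exists2 c : dform (n - k), (forall x, alternating (c x)) &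
                             b = restr_form sphere c) /\
  (forall u e, points sphere u -> oriented_frame u e ->
     b u (fun j => e (k + j)%N) = a u (fun j => e j)).

Definition hodge k (a : dform k) : dform (n - k) := xget 0 [set b | is_hodge a b].

Definition Phi (u : E) : E := \row_i (u ord0 i ^+ 2).

Definition uN (u : E) : R := \prod_i u ord0 i.

Definition Phi_pull k (a : dform k) : dform k := pullback sphere Phi a.

(* On its image, Phi^* has a unique preimage among the (smooth) forms on T^n. *)
Definition Phi_pull_inv k (b : dform k) : dform k :=
  xget 0 [set a | Lambda simplex a /\ Phi_pull a = b].

Definition uN_hodge k (a : dform k) : dform (n - k) := fun u => uN u *: hodge a u.

Definition dual_map k (a : dform k) : dform (n - k) :=
  Phi_pull_inv (uN_hodge (Phi_pull a)).

Definition linear_iso k l (V : set (dform k)) (W : set (dform l))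
    (F : dform k -> dform l) : Prop :=
  (forall (c : R) a b, V a -> V b -> F (c *: a + b) = c *: F a + F b) /\
  set_bij V W F.

(* [C x y]: the point x of the source corresponds to the point y of the
   target. *)
Definition pointwise_defined (C : E -> E -> Prop) k l (V : set (dform k))
    (F : dform k -> dform l) : Prop :=
  forall a a' x y, V a -> V a' -> C x y -> a x = a' x -> F a y = F a' y.

Definition same_pt (x y : E) : Prop := points simplex x /\ y = x.
Definition simplex_to_sphere (x u : E) : Prop := points sphere u /\ x = Phi u.
Definition sphere_to_simplex (u x : E) : Prop := points sphere u /\ x = Phi u.

Definition pointwise_isomorphic (C : E -> E -> Prop) k l
    (V : set (dform k)) (W : set (dform l)) : Prop :=
  exists F : dform k -> dform l, linear_iso V W F /\ pointwise_defined C V F.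

End Forms.

Arguments Lambda {R n} M k.
Arguments P_ {R n} r k M.
Arguments Pminus {R n} r k M.
Arguments P0 {R n} r k.
Arguments P0minus {R n} r k.
Arguments P_even {R n} s k.
Arguments P_odd {R n} s k.
Arguments dual_map {R n} k a.
Arguments same_pt {R n} x y.
Arguments simplex_to_sphere {R n} x u.
Arguments sphere_to_simplex {R n} u x.

(* Main.v *)
(** Put x = Phi u, N = n + 1, m = k + 1, l = n - k.  For a k-form a on R^N,

      *(Phi^* a)_u (w)  =  2^k / k! * sum_J u_J a_x(eps_(J_1 .. J_k)) det(eps_J, w)

    where J = (J_0, ..., J_k) ranges over all (k+1)-tuples of indices and
    u_J = prod_j u_(J_j): every form is a [star], a sum over J of a coefficient
    times det(eps_J, w).  Multiplying by u_N and rescaling rows and columns of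
    the determinant by 2u turns this into the pull-back of the smooth form

      b_x(w)  =  2^(k-l) / k! * sum_J x_J a_x(eps_(J_1 .. J_k)) det(eps_J, w),

    which visibly vanishes on the boundary.  The J_0-slot only contributes the
    vector x, so b is i_X of a form of degree r + k; and if a = i_X d, Cramer's
    rule (modulo sum_i w_i = 0, resp. u.w = 0) turns the coefficient
    x_(J_0) (x_(J_1 .. J_k) a) into x_J d_J, resp. u_J d_J, which lowers the
    degree by one.

    Surjectivity is division of monomials.  On T^n every polynomial may be
    homogenized.  If b = i_X c vanishes on the boundary, its dual coefficients
    b_J are divisible by x_J, and a_(J_1 .. J_k) = b_(0 J_1 .. J_k) / (x_0 x_(J_1 .. J_k))
    is a preimage because i_X b = 0.  If b has arbitrary coefficients, write
    b = sum_alpha x^alpha b_alpha; each b_alpha vanishes on tangent vectors v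
    with v_i = 0 for an i outside supp alpha, hence can be extended from the
    tangent space {sum v = 0} to R^N so that its dual coefficients b_(alpha, J)
    are supported on J contained in supp alpha, and x^alpha is divisible by x_J.
    On the sphere one averages over the sign changes, after which the
    coefficients are u_J times polynomials in x. *)
Require Import Defs.
From mathcomp Require Import all_boot all_order all_algebra.
From mathcomp Require Import all_classical all_reals all_analysis.
From mathcomp Require Import perm.
From mathcomp Require Import -(notations) mpoly.
From mathcomp Require Import ring lra zify.

Import Order.TTheory GRing.Theory Num.Theory.
Import numFieldNormedType.Exports.
Local Open Scope ring_scope.

Set Implicit Arguments.
Unset Strict Implicit.
Unset Printing Implicit Defensive.

(** * Tuples and sums over tuples *)

Section Tuples.
Variable T : Type.

(** The differential of Phi at u is v -> (2 u_i v_i)_i, which degenerates as soon as a coordinate of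
    u vanishes. Injectivity is therefore proved over the open simplex, where u_N and dPhi can be
    cancelled, and extended to the boundary by continuity. Pointwise dependence has no such escape:
    it must hold at each boundary point separately, so it rests on the explicit formula for b and
    not on the equation that b satisfies.

    The Hodge star is specified only by its values on positive orthonormal frames. To turn such
    values into an equality of forms, an alternating form on the tangent space must be determined by
    them. This is where n >= 1 enters: a frame is oriented by flipping one of its vectors.

    The star of a pulled-back form is odd although the pulled-back form is even, because a
    reflection reverses the orientation. *)

Definition upd (I : eqType) (v : I -> T) (j : I) (y : T) : I -> T :=
  fun i => if i == j then y else v i.

Definition consv l (y : T) (v : 'I_l -> T) : 'I_l.+1 -> T :=
  fun i => if unlift ord0 i is Some j then v j else y.

Lemma upd_same (I : eqType) (v : I -> T) j y : upd v j y j = y.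
Proof. by rewrite /upd eqxx. Qed.

Lemma upd_diff (I : eqType) (v : I -> T) j y i : i != j -> upd v j y i = v i.
Proof. by rewrite /upd => /negbTE ->. Qed.

Lemma upd_id (I : eqType) (v : I -> T) j : upd v j (v j) = v.
Proof. by apply/funext => i; rewrite /upd; case: eqP => // ->. Qed.

Lemma upd_upd (I : eqType) (v : I -> T) j y z : upd (upd v j y) j z = upd v j z.
Proof. by apply/funext => i; rewrite /upd; case: eqP. Qed.

Lemma upd_tperm (I : finType) (v : I -> T) (i j : I) (y : T) :
  upd v i y \o tperm i j = upd (v \o tperm i j) j y.
Proof.
apply/funext => a; rewrite /upd /=.
by rewrite (can2_eq (tpermK i j) (tpermK i j)) tpermL.
Qed.

Lemma consv0 l y (v : 'I_l -> T) : consv y v ord0 = y.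
Proof. by rewrite /consv unlift_none. Qed.

Lemma consvS l y (v : 'I_l -> T) j : consv y v (lift ord0 j) = v j.
Proof. by rewrite /consv liftK. Qed.

Lemma consv_lift l y (v : 'I_l -> T) : consv y v \o lift ord0 = v.
Proof. by apply/funext => j /=; rewrite consvS. Qed.

Lemma consv_upd0 l y z (v : 'I_l -> T) : upd (consv y v) ord0 z = consv z v.
Proof.
by apply/funext => i; rewrite /upd /consv; case: unliftP => [j|] ->.
Qed.

Lemma consv_updS l y z (v : 'I_l -> T) j :
  upd (consv y v) (lift ord0 j) z = consv y (upd v j z).
Proof.
apply/funext => i; rewrite /upd /consv; case: unliftP => [k|] -> //.
Qed.

Lemma consv_eta l (v : 'I_l.+1 -> T) : consv (v ord0) (v \o lift ord0) = v.
Proof. by apply/funext => i; rewrite /consv; case: unliftP => [j|] ->. Qed.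

Lemma upd0E l (v : 'I_l.+1 -> T) y : upd v ord0 y = consv y (v \o lift ord0).
Proof. by rewrite -[v in LHS]consv_eta consv_upd0. Qed.

End Tuples.

Lemma comp_upd (I : eqType) T U (h : T -> U) (v : I -> T) j y :
  h \o upd v j y = upd (h \o v) j (h y).
Proof. by apply/funext => i; rewrite /= /upd; case: ifP. Qed.

Lemma comp_consv T U l (h : T -> U) y (v : 'I_l -> T) :
  h \o consv y v = consv (h y) (h \o v).
Proof. by apply/funext => i; rewrite /= /consv; case: unlift. Qed.

Section FfunSums.
Variables (R : numFieldType) (p : nat).

Definition updf l (J : {ffun 'I_l -> 'I_p}) j c : {ffun 'I_l -> 'I_p} :=
  finfun (upd J j c).

Lemma updfE l (J : {ffun 'I_l -> 'I_p}) j c : updf J j c = upd J j c :> ('I_l -> 'I_p).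
Proof. by apply/funext => i; rewrite ffunE. Qed.

Lemma sum_ffun0 (F : ('I_0 -> 'I_p) -> R) v : \sum_(g : {ffun 'I_0 -> 'I_p}) F g = F v.
Proof.
rewrite (big_pred1 (finfun v)) => [|g].
  by congr F; apply/funext => -[].
by rewrite /=; apply/esym/eqP/ffunP => -[].
Qed.

Lemma sum_ffun_cons l (F : ('I_l.+1 -> 'I_p) -> R) :
  \sum_(g : {ffun 'I_l.+1 -> 'I_p}) F g =
  \sum_i \sum_(g : {ffun 'I_l -> 'I_p}) F (consv i g).
Proof.
rewrite pair_big /=.
pose h (q : 'I_p * {ffun 'I_l -> 'I_p}) : {ffun 'I_l.+1 -> 'I_p} :=
  finfun (consv q.1 q.2).
rewrite (reindex h) /=.
  apply: eq_bigr => -[i g] _ /=; congr F.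
  by apply/funext => j; rewrite ffunE.
exists (fun g : {ffun 'I_l.+1 -> 'I_p} => (g ord0, finfun (g \o lift ord0))).
  move=> [i g] _; rewrite /h /= ffunE consv0; congr pair.
  by apply/ffunP => j; rewrite !ffunE /= ffunE consvS.
move=> g _; apply/ffunP => i; rewrite /h ffunE /=.
by rewrite -[RHS](congr1 (@^~ i) (consv_eta g)) /consv; case: unlift => // j; rewrite ffunE.
Qed.

(** The pairs [(J, c)] carry the involution that exchanges the entry [J j] with [c]. *)
Lemma sum_ffun_swap l (j : 'I_l) (G : ('I_l -> 'I_p) -> ('I_l -> 'I_p) -> R) :
  \sum_(J : {ffun 'I_l -> 'I_p}) \sum_c G J (upd J j c) =
  \sum_(J : {ffun 'I_l -> 'I_p}) \sum_c G (upd J j c) J.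
Proof.
rewrite !pair_big /=.
pose h (q : {ffun 'I_l -> 'I_p} * 'I_p) := (updf q.1 j q.2, q.1 j).
have hK : involutive h.
  move=> [J c]; rewrite /h /= !ffunE upd_same; congr pair.
  by apply/ffunP => i; rewrite ffunE updfE upd_upd upd_id.
rewrite (reindex_inj (inv_inj hK)) /=.
by apply: eq_bigr => -[J c] _ /=; rewrite updfE upd_upd upd_id.
Qed.

Lemma sum_ffun_avg l (j : 'I_l) (F : ('I_l -> 'I_p) -> R) :
  \sum_(J : {ffun 'I_l -> 'I_p}) \sum_c F (upd J j c) =
  p%:R * \sum_(J : {ffun 'I_l -> 'I_p}) F J.
Proof.
rewrite (sum_ffun_swap j (fun _ J' => F J')) mulr_sumr.
by apply: eq_bigr => J _; rewrite sumr_const card_ord mulr_natl.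
Qed.

Lemma sum_ffun_perm l (s : 'S_l) (F : ('I_l -> 'I_p) -> R) :
  \sum_(J : {ffun 'I_l -> 'I_p}) F (J \o s) = \sum_(J : {ffun 'I_l -> 'I_p}) F J.
Proof.
pose h (J : {ffun 'I_l -> 'I_p}) : {ffun 'I_l -> 'I_p} := finfun (J \o s).
have hI : injective h.
  move=> J J' /ffunP e; apply/ffunP => i; move: (e ((s^-1)%g i)).
  by rewrite !ffunE /= permKV.
rewrite [RHS](reindex_inj hI); apply: eq_bigr => J _; congr F.
by apply/funext => i; rewrite ffunE.
Qed.

End FfunSums.

Lemma sum_ffun_eq0 (R : numFieldType) p l (j : 'I_l) (F : ('I_l -> 'I_p) -> R) :
  (forall J, \sum_c F (upd J j c) = 0) -> \sum_(J : {ffun 'I_l -> 'I_p}) F J = 0.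
Proof.
move=> F0; have := sum_ffun_avg j F; rewrite big1 // => /esym/eqP.
(* For [p = 0] the average carries no information, but then [J j] would lie in ['I_0]. *)
rewrite mulf_eq0 => /orP[|/eqP //]; rewrite pnatr_eq0 => /eqP p0; subst p.
by rewrite big1 // => J; case: (J j).
Qed.

(** * Concatenated tuples and block determinants *)

Section Joins.
Variables (m l : nat).

(** The length equation is a parameter because [k.+1 + (n - k)] and [n.+1] are not convertible. [il]
    and [ir] are the positions of the left and of the right block. *)
Definition il N (e : (m + l)%N = N) (a : 'I_m) : 'I_N := cast_ord e (lshift l a).
Definition ir N (e : (m + l)%N = N) (c : 'I_l) : 'I_N := cast_ord e (rshift m c).

Definition join T N (e : (m + l)%N = N) (z : 'I_m -> T) (w : 'I_l -> T) : 'I_N -> T :=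
  fun i => match fintype.split (cast_ord (esym e) i) with inl a => z a | inr c => w c end.

Variables (N : nat) (e : (m + l)%N = N).

Lemma joinP (i : 'I_N) : (exists a, i = il e a) \/ (exists c, i = ir e c).
Proof.
have -> : i = cast_ord e (cast_ord (esym e) i) by rewrite cast_ordKV.
by case: (fintype.split_ordP (cast_ord (esym e) i)) => [a|c] ->; [left; exists a | right; exists c].
Qed.

Lemma il_inj : injective (il e).
Proof. by move=> a b /cast_ord_inj/lshift_inj. Qed.

Lemma ir_inj : injective (ir e).
Proof. by move=> a b /cast_ord_inj/rshift_inj. Qed.

Lemma il_neq_ir a c : (il e a == ir e c) = false.
Proof. by rewrite /il /ir (inj_eq (@cast_ord_inj _ _ _)) eq_lrshift. Qed.

Lemma ir_neq_il a c : (ir e c == il e a) = false.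
Proof. by rewrite eq_sym il_neq_ir. Qed.

Section JoinT.
Variable T : Type.
Implicit Types (z : 'I_m -> T) (w : 'I_l -> T).

Lemma join_il z w a : join e z w (il e a) = z a.
Proof. by rewrite /join /il cast_ordK (unsplitK (inl a)). Qed.

Lemma join_ir z w c : join e z w (ir e c) = w c.
Proof. by rewrite /join /ir cast_ordK (unsplitK (inr c)). Qed.

Lemma join_ext (v v' : 'I_N -> T) :
  (forall a, v (il e a) = v' (il e a)) -> (forall c, v (ir e c) = v' (ir e c)) -> v = v'.
Proof. by move=> h1 h2; apply/funext => i; case: (joinP i) => -[a ->]. Qed.

Lemma join_updl z w a y : join e (upd z a y) w = upd (join e z w) (il e a) y.
Proof.
by apply: join_ext => b; rewrite /upd ?join_il ?join_ir ?ir_neq_il // (inj_eq il_inj).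
Qed.

Lemma join_updr z w c y : join e z (upd w c y) = upd (join e z w) (ir e c) y.
Proof.
by apply: join_ext => b; rewrite /upd ?join_il ?join_ir ?il_neq_ir // (inj_eq ir_inj).
Qed.

Lemma join_tperml z w a b :
  join e (z \o tperm a b) w = join e z w \o tperm (il e a) (il e b).
Proof.
apply: join_ext => c; rewrite /= ?join_il ?join_ir /=.
  by rewrite -(inj_tperm _ _ _ il_inj) join_il.
by rewrite tpermD ?il_neq_ir // join_ir.
Qed.

Lemma join_tpermr z w a b :
  join e z (w \o tperm a b) = join e z w \o tperm (ir e a) (ir e b).
Proof.
apply: join_ext => c; rewrite /= ?join_il ?join_ir /=.
  by rewrite tpermD ?ir_neq_il // join_il.
by rewrite -(inj_tperm _ _ _ ir_inj) join_ir.
Qed.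

End JoinT.

Lemma comp_join T U (h : T -> U) (z : 'I_m -> T) w :
  h \o join e z w = join e (h \o z) (h \o w).
Proof. by apply: (@join_ext U) => a; rewrite /= ?join_il ?join_ir. Qed.

Lemma det_join_ublock (R : comPzRingType) (M : 'M[R]_N) :
  (forall c a, M (ir e c) (il e a) = 0) ->
  \det M = \det (\matrix_(i, j) M (il e i) (il e j)) *
           \det (\matrix_(i, j) M (ir e i) (ir e j)).
Proof.
move: M; rewrite /il /ir; case: N / e => M M0.
rewrite -[M in LHS]submxK.
have -> : dlsubmx M = 0.
  by apply/matrixP => c a; rewrite !mxE; have := M0 c a; rewrite !cast_ord_id.
rewrite det_ublock; congr (_ * _); congr determinant;
  by apply/matrixP => i j; rewrite !mxE !cast_ord_id.
Qed.

End Joins.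

(** * Alternating forms and determinants *)

Section Multilinear.
Variables (R : realType) (n : nat).
Notation E := 'rV[R]_n.+1.

Definition multilinear l (b : ('I_l -> E) -> R) : Prop :=
  forall (v : 'I_l -> E) (j : 'I_l) (c : R) (y z : E),
    b (upd v j (c *: y + z)) = c * b (upd v j y) + b (upd v j z).

Notation eps := (@basis_vec R n).
Notation alt := (@Defs.alternating R n _).

Lemma alt_ml l (b : ('I_l -> E) -> R) : alt b -> multilinear b.
Proof. by case. Qed.

Section Ml.
Variables (l : nat) (b : ('I_l -> E) -> R).
Hypothesis bml : multilinear b.

Lemma ml0 v j : b (upd v j 0) = 0.
Proof.
have := bml v j 1 0 0; rewrite scaler0 addr0 mul1r => /eqP.
by rewrite -subr_eq subrr eq_sym => /eqP.
Qed.

Lemma mlZ v j c y : b (upd v j (c *: y)) = c * b (upd v j y).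
Proof. by have := bml v j c y 0; rewrite addr0 ml0 addr0. Qed.

Lemma mlD v j y z : b (upd v j (y + z)) = b (upd v j y) + b (upd v j z).
Proof. by have := bml v j 1 y z; rewrite scale1r mul1r. Qed.

Lemma mlN v j y : b (upd v j (- y)) = - b (upd v j y).
Proof. by rewrite -scaleN1r mlZ mulN1r. Qed.

Lemma ml_sum (I : finType) v j (c : I -> R) (y : I -> E) :
  b (upd v j (\sum_i c i *: y i)) = \sum_i c i * b (upd v j (y i)).
Proof.
elim/big_rec2: _ => [|i a x _ <-]; first exact: ml0.
exact: bml.
Qed.

End Ml.

Lemma ml_consv l (b : ('I_l.+1 -> E) -> R) y : multilinear b -> multilinear (fun v => b (consv y v)).
Proof. by move=> bml v j c x z; rewrite -!consv_updS bml. Qed.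

Lemma ml_expand l p (b : ('I_l -> E) -> R) (A : 'I_l -> 'I_p -> R) (B : 'I_p -> E) :
  multilinear b ->
  b (fun j => \sum_i A j i *: B i) =
  \sum_(g : {ffun 'I_l -> 'I_p}) (\prod_j A j (g j)) * b (B \o g).
Proof.
elim: l b A => [|l IH] b A bml.
  rewrite (sum_ffun0 (fun g : 'I_0 -> 'I_p => (\prod_j A j (g j)) * b (B \o g))
                     (fun i => False_rect _ (notF (ltn_ord i)))).
  by rewrite big_ord0 mul1r; congr b; apply/funext => -[].
rewrite (sum_ffun_cons (fun g : 'I_l.+1 -> 'I_p => (\prod_j A j (g j)) * b (B \o g))).
rewrite -(consv_eta (fun j => _)) -[in LHS](consv_upd0 0) ml_sum //.
apply: eq_bigr => i _; rewrite consv_upd0.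
rewrite (IH (fun v => b (consv (B i) v)) (A \o lift ord0)); last exact: ml_consv.
rewrite mulr_sumr; apply: eq_bigr => g _.
rewrite big_ord_recl consv0 comp_consv mulrA; congr (_ * _ * _).
by apply: eq_bigr => j _; rewrite consvS.
Qed.

Lemma row_basis (v : E) : v = \sum_i v ord0 i *: eps i.
Proof. exact: row_sum_delta. Qed.

Lemma ml_basis l (b : ('I_l -> E) -> R) v : multilinear b ->
  b v = \sum_(g : {ffun 'I_l -> 'I_n.+1}) (\prod_j v j ord0 (g j)) * b (eps \o g).
Proof.
move=> bml; rewrite -(ml_expand (fun j i => v j ord0 i)) //; congr b.
by apply/funext => j; apply: row_basis.
Qed.

Lemma alt_perm l (b : ('I_l -> E) -> R) (s : 'S_l) v : alt b ->
  b (v \o s) = (-1) ^+ s * b v.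
Proof.
move=> [_ bt]; have [ts -> /allP] := prod_tpermP s.
elim: ts v => [|t ts IH] v Hts.
  by rewrite big_nil odd_perm1 mul1r; congr b; apply/funext => i; rewrite /= perm1.
have t12 : t.1 != t.2 := Hts t (mem_head _ _).
rewrite big_cons odd_permM odd_tperm t12.
have -> : v \o (tperm t.1 t.2 * \prod_(i <- ts) tperm i.1 i.2)%g =
          (v \o (\prod_(i <- ts) tperm i.1 i.2)%g) \o tperm t.1 t.2.
  by apply/funext => i; rewrite /= permM.
rewrite bt // IH; last by move=> x Hx; apply: Hts; rewrite inE Hx orbT.
by rewrite signr_addb expr1 mulN1r mulNr.
Qed.

Lemma alt_eq0 l (b : ('I_l -> E) -> R) v i j : alt b -> i != j -> v i = v j -> b v = 0.
Proof.
move=> [_ bt] ij vij; have /eqP := bt v i j ij.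
suff -> : v \o tperm i j = v by rewrite -addr_eq0 -mulr2n mulrn_eq0 => /eqP.
by apply/funext => a /=; case: tpermP => [->|->|].
Qed.

Lemma alt_noninj l (b : ('I_l -> E) -> R) T (B : T -> E) (g : 'I_l -> T) : alt b ->
  ~ injective g -> b (B \o g) = 0.
Proof.
move=> ba ng; apply: contrapT => b0; apply: ng => i j gij.
apply: contrapT => /eqP ij; apply: b0; apply: (alt_eq0 ba ij).
by rewrite /= gij.
Qed.

(** Each permutation of the Leibniz formula contributes exactly [b w]: reindexing [g] by it produces
    its sign a second time, and the two signs cancel. *)
Lemma alt_det l (b : ('I_l -> E) -> R) (w : 'I_l -> E) : alt b ->
  \sum_(g : {ffun 'I_l -> 'I_n.+1})
     b (eps \o g) * \det (\matrix_(i, j) w i ord0 (g j)) = l`!%:R * b w.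
Proof.
move=> ba; rewrite /determinant.
under eq_bigr => g _ do rewrite mulr_sumr.
rewrite exchange_big /=.
rewrite (eq_bigr (fun=> b w)) => [|s _]; first by rewrite sumr_const card_Sn mulr_natl.
pose F (g : 'I_l -> 'I_n.+1) :=
  b (eps \o g \o (s^-1)%g) * ((-1) ^+ s * \prod_i w i ord0 (g i)).
transitivity (\sum_(g : {ffun 'I_l -> 'I_n.+1}) F (g \o s)).
  apply: eq_bigr => g _; rewrite /F; congr (b _ * (_ * _)).
    by apply/funext => i /=; rewrite permKV.
  by apply: eq_bigr => i _; rewrite mxE.
rewrite sum_ffun_perm (ml_basis w (alt_ml ba)); apply: eq_bigr => g _.
rewrite /F alt_perm // odd_permV mulrACA -expr2 sqrr_sign mul1r mulrC //.
Qed.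

Lemma alt_det_sym l (b : ('I_l -> E) -> R) (w : 'I_l -> E) : alt b ->
  \sum_(g : {ffun 'I_l -> 'I_n.+1})
     b (eps \o g) * \det (\matrix_(i, j) w j ord0 (g i)) = l`!%:R * b w.
Proof.
move=> ba; rewrite -alt_det //; apply: eq_bigr => g _; rewrite -det_tr.
by congr (_ * \det _); apply/matrixP => i j; rewrite !mxE.
Qed.

Definition rowsmx (v : 'I_n.+1 -> E) : 'M[R]_n.+1 := \matrix_(i, j) v i ord0 j.

Lemma row_rowsmx v i : row i (rowsmx v) = v i.
Proof. by apply/rowP => j; rewrite !mxE. Qed.

Definition vol (v : 'I_n.+1 -> E) : R := \det (rowsmx v).

Lemma vol_alt : alt vol.
Proof.
split=> [v j c y z|v i j ij]; last first.
  rewrite /vol.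
  have -> : rowsmx (v \o tperm i j) = row_perm (tperm i j) (rowsmx v).
    by apply/matrixP => a c; rewrite !mxE.
  by rewrite row_permE det_mulmx det_perm odd_tperm ij expr1 mulN1r.
rewrite -[vol [eta v with j |-> z]]mul1r.
apply: (@determinant_multilinear _ _ _ _ _ j).
- by apply/rowP => a; rewrite !mxE /= eqxx !mxE; ring.
- by apply/matrixP => a d; rewrite !mxE /= eq_sym (negbTE (neq_lift _ _)).
- by apply/matrixP => a d; rewrite !mxE /= eq_sym (negbTE (neq_lift _ _)).
Qed.

Lemma vol_ml : multilinear vol.
Proof. exact: alt_ml vol_alt. Qed.

Lemma vol_mul (M : 'M[R]_n.+1) v : vol (fun i => v i *m M) = vol v * \det M.
Proof.
rewrite /vol -det_mulmx; congr (\det _); apply/row_matrixP => i.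
by rewrite row_mul !row_rowsmx.
Qed.

Lemma vol_col0 (v : 'I_n.+1 -> E) c : (forall i, v i ord0 c = 0) -> vol v = 0.
Proof.
move=> v0; rewrite /vol (expand_det_col _ c) big1 // => i _.
by rewrite mxE v0 mul0r.
Qed.

(** This is the adjugate identity, sum_i vol(v with q in slot i) v_i = vol(v) q, paired with [phi],
    so that every slot whose vector is killed by [phi] drops out. It also covers dependent
    vectors. *)
Lemma cramer (v : 'I_n.+1 -> E) (phi q : E) :
  \sum_i dotp phi (v i) * vol (upd v i q) = dotp phi q * vol v.
Proof.
have volE i : vol (upd v i q) = (q *m \adj (rowsmx v)) ord0 i.
  rewrite /vol (expand_det_row _ i) mxE; apply: eq_bigr => j _.
  rewrite !mxE upd_same; congr (_ * (_ * \det _)).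
  by apply/matrixP => a c; rewrite !mxE upd_diff // eq_sym neq_lift.
have dE x : dotp phi x = (x *m phi^T) ord0 ord0.
  by rewrite /dotp mxE; apply: eq_bigr => i _; rewrite mxE mulrC.
transitivity ((q *m \adj (rowsmx v) *m (rowsmx v) *m phi^T) ord0 ord0).
  rewrite -mulmxA [RHS]mxE; apply: eq_bigr => i _.
  rewrite volE dE mulrC; congr (_ * _).
  by rewrite !mxE; apply: eq_bigr => j _; rewrite !mxE.
by rewrite -(mulmxA q) mul_adj_mx mul_mx_scalar -scalemxAl dE mxE mulrC.
Qed.

End Multilinear.

(** * The Hodge star of R^{n+1} as a sum over index tuples *)

Section Alternating.
Variables (R : realType) (n : nat).
Notation E := 'rV[R]_n.+1.
Notation eps := (@basis_vec R n).
Notation alt := (@Defs.alternating R n _).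

Lemma alt_sum l (I : finType) (c : I -> R) (b : I -> ('I_l -> E) -> R) :
  (forall i, alt (b i)) -> alt (fun v => \sum_i c i * b i v).
Proof.
move=> ba; split=> [v j a y z|v i j ij].
  rewrite mulr_sumr -big_split; apply: eq_bigr => i _ /=.
  by rewrite (alt_ml (ba i)) mulrDr mulrCA.
rewrite -sumrN; apply: eq_bigr => a _.
by rewrite (ba a).2 // mulrN.
Qed.

Lemma alt_scale l c (b : ('I_l -> E) -> R) : alt b -> alt (fun v => c * b v).
Proof.
move=> ba; split=> [v j a y z|v i j ij].
  by rewrite (alt_ml ba) mulrDr mulrCA.
by rewrite ba.2 // mulrN.
Qed.

Lemma alt_lin l (b : ('I_l -> E) -> R) (h : E -> E) : alt b ->
  (forall c y z, h (c *: y + z) = c *: h y + h z) -> alt (fun v => b (h \o v)).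
Proof.
move=> ba hl; split=> [v j a y z|v i j ij]; last by rewrite -(ba.2 _ _ _ ij).
have E1 t : h \o [eta v with j |-> t] = upd (h \o v) j (h t) by apply: comp_upd.
by rewrite !E1 hl (alt_ml ba).
Qed.

Lemma alt_consv l (b : ('I_l.+1 -> E) -> R) y : alt b -> alt (fun v => b (consv y v)).
Proof.
move=> ba; split=> [v j a x z|v i j ij].
  by have := ml_consv y (alt_ml ba) v j a x z.
rewrite -(ba.2 _ (lift ord0 i) (lift ord0 j)); last by rewrite (inj_eq lift_inj).
congr b; apply/funext => a; case: (unliftP ord0 a) => [c|] ->; rewrite /=.
  by rewrite consvS -(inj_tperm _ _ _ lift_inj) consvS.
by rewrite tpermD ?consv0.
Qed.

Lemma ml_scale l (b : ('I_l -> E) -> R) (c : 'I_l -> R) v : multilinear b ->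
  b (fun j => c j *: v j) = \prod_j c j * b v.
Proof.
elim: l b c v => [|l IH] b c v bml.
  by rewrite big_ord0 mul1r; congr b; apply/funext => -[].
rewrite -(consv_eta (fun j => c j *: v j)) -(consv_upd0 0) mlZ // consv_upd0.
rewrite (IH (fun z => b (consv (v ord0) z)) (c \o lift ord0)); last exact: ml_consv.
by rewrite big_ord_recl mulrA; congr (_ * b _); rewrite consv_eta.
Qed.

Section Join.
Variables (m l : nat) (e : (m + l)%N = n.+1).

Lemma volr_alt z : alt (fun w : 'I_l -> E => vol (join e z w)).
Proof.
split=> [w j c y x|w i j ij].
  have := vol_ml (join e z w) (ir e j) c y x.
  by rewrite -!join_updr.
by rewrite join_tpermr (vol_alt R n).2 // (inj_eq (@ir_inj _ _ _ e)).
Qed.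

Lemma voll_alt w : alt (fun z : 'I_m -> E => vol (join e z w)).
Proof.
split=> [z j c y x|z i j ij].
  have := vol_ml (join e z w) (il e j) c y x.
  by rewrite -!join_updl.
by rewrite join_tperml (vol_alt R n).2 // (inj_eq (@il_inj _ _ _ e)).
Qed.

(* [y] need not be antisymmetric: summing over all tuples, rather than the
   increasing ones, avoids every choice of signs. *)
Definition star (y : ('I_m -> 'I_n.+1) -> R) (w : 'I_l -> E) : R :=
  \sum_(J : {ffun 'I_m -> 'I_n.+1}) y J * vol (join e (eps \o J) w).

Lemma star_alt y : alt (star y).
Proof. by apply: alt_sum => J; apply: volr_alt. Qed.

Lemma star_scale c y w : star (fun J => c * y J) w = c * star y w.
Proof. by rewrite /star mulr_sumr; apply: eq_bigr => J _; rewrite mulrA. Qed.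

(** These are the dual coefficients b_J of the overview: up to a constant, the Hodge star of R^{n+1}
    in the direction opposite to [star]. Divisibility by monomials is a property of these
    numbers. *)
Definition costar (b : ('I_l -> E) -> R) (z : 'I_m -> E) : R :=
  \sum_(g : {ffun 'I_l -> 'I_n.+1}) b (eps \o g) * vol (join e z (eps \o g)).

Lemma costar_alt b : alt (costar b).
Proof. by apply: alt_sum => J; apply: voll_alt. Qed.

Lemma sum_join (F : 'I_n.+1 -> R) :
  \sum_i F i = \sum_a F (il e a) + \sum_c F (ir e c).
Proof.
move: F; rewrite /il /ir; move: (n.+1) e => N; case: N / => F.
rewrite big_split_ord /=; congr (_ + _); apply: eq_bigr => i _; congr F;
  by rewrite cast_ord_id.
Qed.

Lemma vol_join_basis0 (J : 'I_m -> 'I_n.+1) (g : 'I_l -> 'I_n.+1) :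
  ~ injective (join e J g) -> vol (join e (eps \o J) (eps \o g)) = 0.
Proof.
by move=> ni; rewrite -comp_join; apply: alt_noninj => //; apply: vol_alt.
Qed.

Lemma basis_vecE i j : eps i ord0 j = (i == j)%:R.
Proof. by rewrite /basis_vec mxE eqxx eq_sym. Qed.

Lemma dotp_basis (x : E) i : dotp x (eps i) = x ord0 i.
Proof.
rewrite /dotp (bigD1 i) //= basis_vecE eqxx mulr1 big1 ?addr0 // => j ji.
by rewrite basis_vecE eq_sym (negbTE ji) mulr0.
Qed.

Lemma vol_mul_vol (v w : 'I_n.+1 -> E) :
  vol v * vol w = \det (\matrix_(i, j) dotp (v i) (w j)).
Proof.
rewrite /vol -[X in _ * X]det_tr -det_mulmx; congr determinant.
by apply/matrixP => i j; rewrite !mxE; apply: eq_bigr => c _; rewrite !mxE.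
Qed.

(** The product of the two volumes is a Gram determinant. It is block triangular because [J] and [h]
    are disjoint, and its blocks are the identity and the minor to which [alt_det] applies. *)
Lemma costar_basis (b : ('I_l -> E) -> R) (J : 'I_m -> 'I_n.+1) (h : 'I_l -> 'I_n.+1) :
  alt b -> injective (join e J h) ->
  costar b (eps \o J) * vol (join e (eps \o J) (eps \o h)) = l`!%:R * b (eps \o h).
Proof.
move=> ba inj; rewrite -alt_det // mulr_suml; apply: eq_bigr => g _.
rewrite -mulrA [_ * vol _]mulrC vol_mul_vol; congr (_ * _).
rewrite (det_join_ublock (e := e)) => [|c a].
  rewrite [X in X * _](_ : _ = 1).
    rewrite mul1r; congr determinant; apply/matrixP => i j.
    by rewrite !mxE !join_ir /= dotp_basis !basis_vecE eq_sym.
  rewrite -(det1 R m); congr determinant; apply/matrixP => i j.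
  rewrite !mxE !join_il /= dotp_basis basis_vecE.
  by rewrite -(join_il e J h i) -(join_il e J h j) (inj_eq inj) (inj_eq (@il_inj _ _ _ e)).
rewrite !mxE join_il join_ir /= dotp_basis basis_vecE.
by rewrite -(join_il e J h a) -(join_ir e J h c) (inj_eq inj) ir_neq_il.
Qed.

Lemma join_injP (J : 'I_m -> 'I_n.+1) (h : 'I_l -> 'I_n.+1) : injective h ->
  (forall a c, J a != h c) -> injective J -> injective (join e J h).
Proof.
move=> hi Jh Ji a b; case: (joinP e a) => -[a' ->]; case: (joinP e b) => -[b' ->];
  rewrite ?join_il ?join_ir.
- by move/Ji ->.
- by move=> E1; have := Jh a' b'; rewrite E1 eqxx.
- by move=> E1; have := Jh b' a'; rewrite E1 eqxx.
- by move/hi ->.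
Qed.

(* The double Hodge star. *)
Lemma star_costar (b : ('I_l -> E) -> R) w : alt b ->
  star (fun J => costar b (eps \o J)) w = (m`! * l`!)%:R * b w.
Proof.
move=> ba; rewrite (ml_basis w (alt_ml (star_alt _))) (ml_basis w (alt_ml ba)) mulr_sumr.
apply: eq_bigr => h _; rewrite mulrCA; congr (_ * _).
have [hi|hn] := pselect (injective h); last first.
  by rewrite !alt_noninj ?mulr0 //; apply: star_alt.
(* A nonzero volume forces [J] to be injective with values off the image of [h]. That complement has
   m elements, so m! tuples remain, all with the same contribution. *)
pose D := [pred i | i \notin codom h].
pose Q : pred {ffun 'I_m -> 'I_n.+1} := [pred f | (f \in ffun_on D) && injectiveb f].
rewrite /star (bigID Q) /= [X in _ + X]big1 ?addr0 => [|J]; last first.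
  move=> nQ; rewrite vol_join_basis0 ?mulr0 // => inj; move/negP: nQ; apply.
  apply/andP; split.
    apply/ffun_onP => a; rewrite inE /=; apply/codomP => -[c E1].
    have := il_neq_ir e a c; rewrite -(inj_eq inj) join_il join_ir E1 eqxx //.
  apply/injectiveP => a c E1; apply: (@il_inj _ _ _ e); apply: inj.
  by rewrite !join_il.
rewrite (eq_bigr (fun=> l`!%:R * b (eps \o h))) => [|J /andP[/ffun_onP JD /injectiveP Ji]].
  have -> : (m`!)%N = #|Q|.
    have := card_inj_ffuns_on 'I_m D; rewrite cardsE card_ord.
    suff -> : #|D| = m by rewrite ffactnn.
    have := cardC (mem (codom h)); rewrite card_codom // !card_ord.
    have -> : #|[predC codom h]| = #|D| by apply: eq_card => i; rewrite !inE.
    by lia.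
  by rewrite sumr_const -mulr_natr natrM; ring.
apply: costar_basis => //; apply: join_injP => // a c.
have := JD a; rewrite inE /= => /negP H; apply/eqP => E1; apply: H.
by rewrite E1 codom_f.
Qed.

(** The vectors in the left slots are eigenvectors of [M], so [M] acts on them by scalars and its
    determinant splits off. The matrices in question are diag(2u), sign changes and [Lmx u]. *)
Lemma vol_join_mul (M : 'M[R]_n.+1) (J : 'I_m -> 'I_n.+1) (c : 'I_m -> R) w :
  (forall a, eps (J a) *m M = c a *: eps (J a)) ->
  (\prod_a c a) * vol (join e (eps \o J) (fun j => w j *m M)) =
  vol (join e (eps \o J) w) * \det M.
Proof.
move=> H; rewrite -vol_mul -(ml_scale c (eps \o J) (alt_ml (voll_alt (fun j => w j *m M)))).
congr vol; apply: (join_ext (e := e)) => a; rewrite ?join_il ?join_ir //.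
by rewrite /= H.
Qed.

End Join.

(** * Contraction by Cramer's rule, and values on orthonormal frames *)

Section Contract.
Variables (k l : nat) (e : (k.+1 + l)%N = n.+1).

Lemma vol_upd0 (J : 'I_k.+1 -> 'I_n.+1) q w :
  vol (join e (upd (eps \o J) ord0 q) w) =
  \sum_c q ord0 c * vol (join e (eps \o upd J ord0 c) w).
Proof.
rewrite {1}(row_basis q) (ml_sum (alt_ml (voll_alt e w))).
by apply: eq_bigr => c _; rewrite comp_upd.
Qed.

Lemma sum_slots (y : 'I_k.+1 -> ('I_k.+1 -> 'I_n.+1) -> R) :
  (forall j J, j != ord0 -> y j (J \o tperm ord0 j) = y ord0 J) ->
  \sum_(J : {ffun 'I_k.+1 -> 'I_n.+1}) \sum_j y j J =
  k.+1%:R * \sum_(J : {ffun 'I_k.+1 -> 'I_n.+1}) y ord0 J.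
Proof.
move=> H; rewrite exchange_big /= (eq_bigr (fun=> \sum_(J : {ffun 'I_k.+1 -> 'I_n.+1}) y ord0 J)).
  by rewrite sumr_const card_ord mulr_natl.
move=> j _; case: (eqVneq j ord0) => [->//|j0].
rewrite -(sum_ffun_perm (tperm ord0 j) (y j)).
by apply: eq_bigr => J _; apply: H.
Qed.

(** Cramer's rule is applied to each determinant. The slots of [w] drop out, and by antisymmetry
    each of the k + 1 slots of [J] contributes as much as slot 0, where [sum_ffun_swap] exchanges
    the old index with the component of [q]. *)
Lemma star_contract (y : ('I_k.+1 -> 'I_n.+1) -> R) (phi q : E) w :
  (forall J i j, i != j -> y (J \o tperm i j) = - y J) ->
  (forall j, dotp phi (w j) = 0) ->
  dotp phi q * star e y w =
  k.+1%:R * star e (fun J => q ord0 (J ord0) * \sum_i phi ord0 i * y (upd J ord0 i)) w.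
Proof.
move=> ya phiw.
pose Y j (J : 'I_k.+1 -> 'I_n.+1) :=
  y J * phi ord0 (J j) * vol (join e (upd (eps \o J) j q) w).
transitivity (\sum_(J : {ffun 'I_k.+1 -> 'I_n.+1}) \sum_j Y j J).
  rewrite /star mulr_sumr; apply: eq_bigr => J _.
  rewrite mulrCA -cramer (sum_join e) [X in _ + X]big1 ?addr0 => [|c _]; last first.
    by rewrite join_ir phiw mul0r.
  rewrite mulr_sumr; apply: eq_bigr => a _.
  by rewrite join_il /= dotp_basis -join_updl /Y mulrA.
rewrite sum_slots => [|j J j0]; last first.
  rewrite /Y ya 1?eq_sym //= tpermR.
  rewrite -[eps \o (J \o _)]/((eps \o J) \o _) -upd_tperm.
  by rewrite (voll_alt e w).2 1?eq_sym // mulrN !mulNr opprK.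
congr (_ * _); rewrite /Y /star.
pose G (J J' : 'I_k.+1 -> 'I_n.+1) :=
  y J * phi ord0 (J ord0) * (q ord0 (J' ord0) * vol (join e (eps \o J') w)).
transitivity (\sum_(J : {ffun 'I_k.+1 -> 'I_n.+1}) \sum_c G J (upd J ord0 c)).
  apply: eq_bigr => J _; rewrite vol_upd0 mulr_sumr; apply: eq_bigr => c _.
  by rewrite /G upd_same.
rewrite sum_ffun_swap; apply: eq_bigr => J _.
rewrite mulr_sumr mulr_suml; apply: eq_bigr => c _.
by rewrite /G upd_same; ring.
Qed.

(** Here Cramer's rule acts inside [costar]. The right slots cancel because summation over the index
    in such a slot inserts [x] into [b], which vanishes there. With [q] a basis vector eps_0, the
    form is recovered from the dual coefficients with first index 0, at the price of a factor
    x_0. *)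
Lemma costar_contract (b : ('I_l -> E) -> R) (x q : E) w :
  (forall v j, b (upd v j x) = 0) -> multilinear b ->
  dotp x q * star e (fun J => costar e b (eps \o J)) w =
  k.+1%:R * star e (fun J => x ord0 (J ord0) * costar e b (upd (eps \o J) ord0 q)) w.
Proof.
move=> bx bml.
pose Y j (J : 'I_k.+1 -> 'I_n.+1) :=
  x ord0 (J j) * costar e b (upd (eps \o J) j q) * vol (join e (eps \o J) w).
transitivity (\sum_(J : {ffun 'I_k.+1 -> 'I_n.+1}) \sum_j Y j J).
  rewrite /star mulr_sumr; apply: eq_bigr => J _.
  rewrite /Y -mulr_suml mulrA; congr (_ * _).
  rewrite /costar mulr_sumr.
  under eq_bigr => g _ do rewrite mulrCA -cramer (sum_join e) mulrDr.
  rewrite big_split /= [X in _ + X](_ : _ = 0) ?addr0; last first.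
    under eq_bigr => g _ do rewrite mulr_sumr.
    rewrite exchange_big big1 //= => c _.
    apply: (sum_ffun_eq0 (j := c) (F := fun g => b (eps \o g) *
      (dotp x (join e (eps \o J) (eps \o g) (ir e c)) *
       vol (upd (join e (eps \o J) (eps \o g)) (ir e c) q)))) => g.
    transitivity (b (upd (eps \o g) c x) * vol (join e (eps \o J) (upd (eps \o g) c q))).
      rewrite {2}(row_basis x) (ml_sum bml) mulr_suml; apply: eq_bigr => i _.
      rewrite join_ir /= upd_same dotp_basis comp_upd join_updr upd_upd -join_updr.
      by rewrite mulrCA mulrA.
    by rewrite bx mul0r.
  under eq_bigr => g _ do rewrite mulr_sumr.
  rewrite exchange_big /=; apply: eq_bigr => a _.
  rewrite mulr_sumr; apply: eq_bigr => g _.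
  by rewrite join_il /= dotp_basis -join_updl mulrCA.
rewrite sum_slots => [|j J j0]; last first.
  rewrite /Y /= tpermR.
  rewrite -[eps \o (J \o _)]/((eps \o J) \o _) -upd_tperm.
  rewrite (costar_alt e b).2 1?eq_sym // (voll_alt e w).2 1?eq_sym //.
  by rewrite !mulrN mulNr opprK.
by congr (_ * _); apply: eq_bigr => J _.
Qed.

(** Multiplication by vol(V) = 1 turns each determinant into a minor of the coordinates of the
    frame. In its expansion along row 0, the sum over [J ord0] yields the inner products of vector 0
    with the left frame vectors, so only the first cofactor survives. *)
Lemma star_frame (a : ('I_k -> E) -> R) (V : 'I_n.+1 -> E) : alt a ->
  (forall i j, dotp (V i) (V j) = (i == j)%:R) -> 0 < vol V ->
  star e (fun J => V (il e ord0) ord0 (J ord0) * a (eps \o (J \o lift ord0))) (V \o ir e) =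
  k`!%:R * a (V \o il e \o lift ord0).
Proof.
move=> aa VV V0.
have volV : vol V = 1.
  have : vol V * vol V = 1.
    rewrite vol_mul_vol -[RHS](det1 R n.+1); congr determinant.
    by apply/matrixP => i j; rewrite !mxE VV.
  by move/eqP; rewrite -expr2 sqrf_eq1 => /orP[/eqP//|/eqP E1]; move: V0; rewrite E1; lra.
pose M (f : 'I_k.+1 -> 'I_n.+1) : 'M[R]_k.+1 := \matrix_(a, c) V (il e c) ord0 (f a).
have volM (J : 'I_k.+1 -> 'I_n.+1) : vol (join e (eps \o J) (V \o ir e)) = \det (M J).
  rewrite -[LHS]mulr1 -volV vol_mul_vol (det_join_ublock (e := e)) => [|c d]; last first.
    by rewrite mxE join_ir /= VV ir_neq_il.
  rewrite [X in _ * X](_ : _ = 1) ?mulr1.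
    congr determinant; apply/matrixP => i j; rewrite !mxE join_il /=.
    rewrite /dotp (bigD1 (J i)) //= basis_vecE eqxx mul1r big1 ?addr0 // => c cJ.
    by rewrite basis_vecE eq_sym (negbTE cJ) mul0r.
  rewrite -(det1 R l); congr determinant; apply/matrixP => i j.
  by rewrite !mxE join_ir /= VV (inj_eq (@ir_inj _ _ _ e)).
pose C (c : 'I_k.+1) (f : 'I_k -> 'I_n.+1) : R :=
  (-1) ^+ c * \det (\matrix_(i, j) V (il e (lift c j)) ord0 (f i)).
rewrite /star.
transitivity (\sum_(J : {ffun 'I_k.+1 -> 'I_n.+1}) \sum_c
   V (il e ord0) ord0 (J ord0) * V (il e c) ord0 (J ord0) *
     (a (eps \o (J \o lift ord0)) * C c (J \o lift ord0))).
  apply: eq_bigr => J _; rewrite volM (expand_det_row _ ord0) mulr_sumr.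
  apply: eq_bigr => c _; rewrite mxE /cofactor /C add0n.
  have -> : row' ord0 (col' c (M J)) =
            \matrix_(i, j) V (il e (lift c j)) ord0 ((J \o lift ord0) i).
    by apply/matrixP => i j; rewrite !mxE.
  by ring.
rewrite exchange_big /= (bigD1 ord0) //= [X in _ + X]big1 ?addr0 => [|c c0].
  rewrite (sum_ffun_cons (fun J : 'I_k.+1 -> 'I_n.+1 =>
    V (il e ord0) ord0 (J ord0) * V (il e ord0) ord0 (J ord0) *
     (a (eps \o (J \o lift ord0)) * C ord0 (J \o lift ord0)))).
  under eq_bigr => i _.
    under eq_bigr => f _ do rewrite consv0 consv_lift.
    rewrite -mulr_sumr; over.
  rewrite -mulr_suml.
  have := VV (il e ord0) (il e ord0); rewrite eqxx /dotp => ->; rewrite mul1r.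
  rewrite -alt_det_sym //; apply: eq_bigr => f _.
  by rewrite /C expr0 mul1r.
rewrite (sum_ffun_cons (fun J : 'I_k.+1 -> 'I_n.+1 =>
    V (il e ord0) ord0 (J ord0) * V (il e c) ord0 (J ord0) *
     (a (eps \o (J \o lift ord0)) * C c (J \o lift ord0)))).
under eq_bigr => i _.
  under eq_bigr => f _ do rewrite consv0 consv_lift.
  rewrite -mulr_sumr; over.
rewrite -mulr_suml.
have := VV (il e ord0) (il e c).
by rewrite (inj_eq (@il_inj _ _ _ e)) eq_sym (negbTE c0) /dotp => ->; rewrite mul0r.
Qed.

End Contract.
End Alternating.

(** * Orthonormal frames *)

Section Frames.
Variables (R : realType) (n : nat).
Notation E := 'rV[R]_n.+1.
Notation eps := (@basis_vec R n).
Notation alt := (@Defs.alternating R n _).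

Lemma dotpC (x y : E) : dotp x y = dotp y x.
Proof. by apply: eq_bigr => i _; rewrite mulrC. Qed.

Lemma dotpDr (x y z : E) : dotp x (y + z) = dotp x y + dotp x z.
Proof. by rewrite /dotp -big_split; apply: eq_bigr => i _ /=; rewrite mxE mulrDr. Qed.

Lemma dotpZr (x y : E) c : dotp x (c *: y) = c * dotp x y.
Proof. by rewrite /dotp mulr_sumr; apply: eq_bigr => i _ /=; rewrite mxE mulrCA. Qed.

Lemma dotpDl (x y z : E) : dotp (y + z) x = dotp y x + dotp z x.
Proof. by rewrite dotpC dotpDr !(dotpC x). Qed.

Lemma dotpZl (x y : E) c : dotp (c *: y) x = c * dotp y x.
Proof. by rewrite dotpC dotpZr dotpC. Qed.

Lemma dotpNr (x y : E) : dotp x (- y) = - dotp x y.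
Proof. by rewrite -scaleN1r dotpZr mulN1r. Qed.

Lemma dotpNl (x y : E) : dotp (- y) x = - dotp y x.
Proof. by rewrite dotpC dotpNr dotpC. Qed.

Lemma dotp_eq0 (x : E) : dotp x x = 0 -> x = 0.
Proof.
move=> /eqP; rewrite psumr_eq0 => [/allP H|i _]; last by rewrite -expr2 sqr_ge0.
apply/rowP => i; rewrite !mxE; apply/eqP.
by have := H i; rewrite mem_index_enum mulf_eq0 orbb => /(_ isT).
Qed.

Definition framefun (u : E) (e : nat -> E) (i : 'I_n.+1) : E :=
  if (i : nat) is i'.+1 then e i' else u.

Lemma frame_volE (u : E) (e : nat -> E) : \det (\matrix_(i < n.+1, j < n.+1)
  (if (i : nat) is i'.+1 then e i' else u) ord0 j) = vol (framefun u e).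
Proof. by rewrite /vol; congr determinant; apply/matrixP => i j; rewrite !mxE. Qed.

Definition orthonormal_frame (u : E) (e : nat -> E) :=
  forall i j, dotp (framefun u e i) (framefun u e j) = (i == j)%:R.

Lemma oriented_frameP u e : dotp u u = 1 -> oriented_frame u e ->
  orthonormal_frame u e /\ 0 < vol (framefun u e).
Proof.
move=> uu [t o]; rewrite frame_volE => d; split=> // -[[|i] hi] -[[|j] hj]; rewrite /framefun /=.
- by rewrite uu.
- exact: t.
- by rewrite dotpC; apply: t.
- by rewrite o.
Qed.

Lemma orthonormal_frame_oriented u e :
  orthonormal_frame u e -> 0 < vol (framefun u e) -> oriented_frame u e.
Proof.
move=> o d; split=> [i hi|i j hi hj|]; last by rewrite frame_volE.
  have hi' : (i.+1 < n.+1)%N by [].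
  by have := o ord0 (Ordinal hi'); rewrite /framefun /=.
have hi' : (i.+1 < n.+1)%N by [].
have hj' : (j.+1 < n.+1)%N by [].
by have := o (Ordinal hi') (Ordinal hj'); rewrite /framefun /=.
Qed.

(** Multiplying one vector by the sign of the volume orients the frame; for n = 0 there would be no
    vector to flip. *)
Lemma frame_sign (hn : (1 <= n)%N) u e : orthonormal_frame u e ->
  exists2 s : R, s != 0 & oriented_frame u (upd e 0%N (s *: e 0%N)).
Proof.
move=> o.
have vv : vol (framefun u e) * vol (framefun u e) = 1.
  rewrite vol_mul_vol -[RHS](det1 R n.+1); congr determinant.
  by apply/matrixP => i j; rewrite !mxE o.
set s := Num.sg (vol (framefun u e)).
have v0 : vol (framefun u e) != 0.
  by apply/eqP => v0; move: vv; rewrite v0 mul0r => /esym/eqP; rewrite oner_eq0.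
have ss : s * s = 1 by rewrite -expr2 sqr_sg v0.
exists s; first by rewrite sgr_eq0.
have h1 : (1 < n.+1)%N by [].
have fE : framefun u (upd e 0%N (s *: e 0%N)) =
          upd (framefun u e) (Ordinal h1) (s *: framefun u e (Ordinal h1)).
  by apply/funext => -[[|[|i]] hi].
apply: orthonormal_frame_oriented.
  move=> i j; rewrite fE /upd.
  case: (altP (i =P Ordinal h1)) => [->|i1]; case: (altP (j =P Ordinal h1)) => [->|j1].
  - by rewrite dotpZl dotpZr o eqxx mulr1 ss.
  - by rewrite dotpZl o eq_sym (negbTE j1) mulr0.
  - by rewrite dotpZr o (negbTE i1) mulr0.
  - exact: o.
rewrite fE (mlZ (@vol_ml R n)) upd_id /s -normrEsg.
by rewrite normr_gt0.
Qed.

(** The reflection in the hyperplane orthogonal to u - eps_0. For a unit vector u it carries eps_0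
    to u, so the images of the other basis vectors complete u to an orthonormal basis. For u = eps_0
    the formula gives the identity. *)
Definition householder (u v : E) : E :=
  v - (2 * dotp (u - eps ord0) v / dotp (u - eps ord0) (u - eps ord0)) *: (u - eps ord0).

Lemma householder_isometry u x y :
  dotp (householder u x) (householder u y) = dotp x y.
Proof.
rewrite /householder; move: (u - eps ord0) => w.
have [w0|w0] := eqVneq (dotp w w) 0.
  by rewrite (dotp_eq0 w0) !scaler0 !subr0.
rewrite !dotpDl !dotpDr !dotpNl !dotpNr !dotpZl !dotpZr (dotpC x w).
by field.
Qed.

Lemma householder_basis0 u : dotp u u = 1 -> householder u (eps ord0) = u.
Proof.
move=> uu; rewrite /householder; set w := u - eps ord0.
have [w0|w0] := eqVneq (dotp w w) 0.
  rewrite (dotp_eq0 w0) scaler0 subr0.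
  by have /eqP := dotp_eq0 w0; rewrite subr_eq0 => /eqP ->.
suff -> : 2 * dotp w (eps ord0) / dotp w w = -1 by rewrite scaleN1r opprK addrC subrK.
have e0 : dotp (eps ord0) (eps ord0) = 1 by rewrite dotp_basis basis_vecE eqxx.
have ww : dotp w w = - 2 * dotp w (eps ord0).
  rewrite /w !dotpDl !dotpDr !dotpNl !dotpNr e0 uu (dotpC (eps ord0)); ring.
move: w0; rewrite ww => w0; field.
by move: w0; rewrite mulf_eq0 => /norP[].
Qed.

Lemma exists_orthonormal_frame (u : E) : dotp u u = 1 -> exists e, orthonormal_frame u e.
Proof.
move=> uu; exists (fun i => householder u (eps (inord i.+1))).
suff H i : framefun u (fun i => householder u (eps (inord i.+1))) i = householder u (eps i).
  by move=> i j; rewrite !H householder_isometry dotp_basis basis_vecE.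
case: i => -[|i] hi; rewrite /framefun /=.
  by rewrite -[LHS]householder_basis0 //; congr (householder _ (eps _)); apply: val_inj.
by congr (householder _ (eps _)); apply: val_inj; rewrite /= inordK.
Qed.

Lemma frame_expand u e v : orthonormal_frame u e -> dotp u v = 0 ->
  v = \sum_(i < n) dotp (e i) v *: e i.
Proof.
move=> o uv; set O := rowsmx (framefun u e).
have OO : O *m O^T = 1%:M.
  apply/matrixP => i j; rewrite !mxE -o; apply: eq_bigr => c _.
  by rewrite !mxE.
have : v *m (O^T *m O) = v by rewrite (mulmx1C OO) mulmx1.
rewrite mulmxA mulmx_sum_row big_ord_recl => {1}<-.
have rE i : (v *m O^T) ord0 i = dotp (framefun u e i) v.
  by rewrite mxE; apply: eq_bigr => j _; rewrite !mxE mulrC.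
rewrite rE {1}/framefun /= uv scale0r add0r.
by apply: eq_bigr => i _; rewrite rE row_rowsmx.
Qed.

(** Reorders a frame so that chosen vectors occupy the positions at which [is_hodge] evaluates: the
    chosen indices are inserted after the first [off] of the remaining ones. *)
Lemma extend_inj q off (g : 'I_q -> 'I_n) : (off + q <= n)%N -> injective g ->
  exists s : nat -> nat, (forall i, (i < n)%N -> (s i < n)%N) /\
    (forall i j, (i < n)%N -> (j < n)%N -> (s i == s j) = (i == j)) /\
    forall j : 'I_q, s (off + j)%N = g j.
Proof.
move=> hq gi.
pose gs : seq nat := [seq (g j : nat) | j <- enum 'I_q].
pose rest := [seq i <- iota 0 n | i \notin gs].
have gsu : uniq gs by rewrite map_inj_uniq ?enum_uniq // => i j /val_inj/gi.
have sgs : size gs = q by rewrite size_map size_enum_ord.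
have gsn : {subset gs <= iota 0 n}.
  by move=> x /mapP[j _ ->]; rewrite mem_iota add0n ltn_ord.
have pe : perm_eq (gs ++ rest) (iota 0 n).
  apply: uniq_perm; rewrite ?iota_uniq //.
    rewrite cat_uniq gsu filter_uniq ?iota_uniq // andbT.
    by apply/hasPn => x; rewrite mem_filter => /andP[].
  move=> x; rewrite mem_cat mem_filter; case xg : (x \in gs) => //=.
  by rewrite gsn.
have srest : size rest = (n - q)%N.
  by have := perm_size pe; rewrite size_cat sgs size_iota => <-; rewrite addKn.
pose sq := take off rest ++ gs ++ drop off rest.
have pq : perm_eq sq (iota 0 n).
  apply: perm_trans pe; rewrite /sq perm_catCA perm_cat2l cat_take_drop.
  exact: perm_refl.
have ssq : size sq = n by rewrite (perm_size pq) size_iota.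
have usq : uniq sq by rewrite (perm_uniq pq) iota_uniq.
have stk : size (take off rest) = off.
  by rewrite size_take srest; case: ltnP; lia.
exists (nth 0%N sq); split=> [i hi|].
  have : nth 0%N sq i \in iota 0 n by rewrite -(perm_mem pq) mem_nth ?ssq.
  by rewrite mem_iota.
split=> [i j hi hj|j]; first by rewrite nth_uniq ?ssq.
rewrite /sq nth_cat stk ltnNge leq_addr /= addKn nth_cat sgs ltn_ord.
by rewrite (nth_map j) ?size_enum_ord // nth_ord_enum.
Qed.

(** Expanded in an orthonormal frame, [c v] is a combination of values on injective tuples of frame
    vectors. Each tuple is a block of a reordered frame, and orienting that frame only multiplies
    the value by a nonzero scalar. The offset is k for the values of the star and 0 for those of the
    form itself. *)
Lemma alt_frame_eq0 (hn : (1 <= n)%N) q off (c : ('I_q -> E) -> R) u v :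
  (off + q <= n)%N -> alt c -> dotp u u = 1 ->
  (forall e, oriented_frame u e -> c (fun j => e (off + j)%N) = 0) ->
  (forall j, dotp u (v j) = 0) -> c v = 0.
Proof.
move=> hq ca uu H uv; have [e oe] := exists_orthonormal_frame uu.
have -> : v = fun j => \sum_(i < n) dotp (e i) (v j) *: e i.
  by apply/funext => j; apply: frame_expand.
rewrite (ml_expand (fun j (i : 'I_n) => dotp (e i) (v j))); last exact: alt_ml.
rewrite big1 // => g _.
have [gi|gn] := pselect (injective g); last first.
  by rewrite (alt_noninj (fun i : 'I_n => e i) ca gn) mulr0.
have [s [sn [si sg]]] := extend_inj hq gi.
have os : orthonormal_frame u (e \o s).
  have E1 i (hi : (i < n)%N) : framefun u (e \o s) (Ordinal (hi : (i.+1 < n.+1)%N)) =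
            framefun u e (Ordinal (sn i hi : ((s i).+1 < n.+1)%N)) by [].
  move=> [[|i] hi] [[|j] hj]; rewrite ?E1.
  - exact: (oe ord0 ord0).
  - exact: (oe ord0 (Ordinal (sn j hj : ((s j).+1 < n.+1)%N))).
  - exact: (oe (Ordinal (sn i hi : ((s i).+1 < n.+1)%N)) ord0).
  - have := oe (Ordinal (sn i hi : ((s i).+1 < n.+1)%N)) (Ordinal (sn j hj : ((s j).+1 < n.+1)%N)).
    by rewrite /framefun /= => ->; congr (_%:R); rewrite -!val_eqE /= !eqSS si.
have [t t0 /H] := frame_sign hn os.
have -> : (fun j : 'I_q => upd (e \o s) 0%N (t *: (e \o s) 0%N) (off + j)%N) =
          fun j : 'I_q => (if (off + j == 0)%N then t else 1) *: e (g j).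
  apply/funext => j; rewrite /upd; case: eqP => [j0|]; last by rewrite /= sg scale1r.
  by rewrite -sg /= j0.
rewrite (ml_scale _ (fun j => e (g j)) (alt_ml ca)) => /eqP.
rewrite mulf_eq0 => /orP[|/eqP ->]; last by rewrite mulr0.
rewrite prodf_seq_eq0 => /hasP[j _]; case: ifP => _; first by rewrite (negbTE t0).
by rewrite oner_eq0.
Qed.

End Frames.

(** * Polynomial functions *)

Section Polynomials.
Variables (R : realType) (n : nat).
Notation E := 'rV[R]_n.+1.
Notation mi := {ffun 'I_n.+1 -> nat}.

Definition mon (x : E) (m : mi) : R := \prod_i x ord0 i ^+ m i.
Definition mdg (m : mi) : nat := \sum_i m i.
Definition addm (m m' : mi) : mi := [ffun i => (m i + m' i)%N].

Lemma mon_add x m m' : mon x (addm m m') = mon x m * mon x m'.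
Proof. by rewrite -big_split; apply: eq_bigr => i _; rewrite ffunE exprD. Qed.

Lemma mdg_add m m' : mdg (addm m m') = (mdg m + mdg m')%N.
Proof. by rewrite -big_split; apply: eq_bigr => i _; rewrite ffunE. Qed.

Definition mexp (m : multinom n.+1) : mi := [ffun i => m i].

(** A predicate on exponents serves both for the bound on the degree and for homogeneity of an exact
    degree. *)
Definition polyin (D : mi -> Prop) (f : E -> R) : Prop :=
  exists p : mpoly.mpoly n.+1 R,
    (forall m, mpoly.mcoeff m p != 0 -> D (mexp m)) /\
    (forall x, f x = mpoly.meval (x ord0) p).

Lemma mdg_mexp m : mdg (mexp m) = mdeg m.
Proof. by rewrite mdegE; apply: eq_bigr => i _; rewrite ffunE. Qed.

Lemma is_polyE r f : is_poly r f <-> polyin (fun m => (mdg m)%:Z <= r) f.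
Proof.
by split=> -[p [pr pE]]; exists p; split=> // m /pr; rewrite mdg_mexp.
Qed.

Lemma polyin_eq D (f g : E -> R) : (forall x, f x = g x) -> polyin D f -> polyin D g.
Proof. by move=> /funext ->. Qed.

Lemma polyin0 D : polyin D (fun=> 0).
Proof.
exists 0; split=> [m|x]; first by rewrite mcoeff0 eqxx.
by rewrite meval0.
Qed.

Lemma polyinD D (f g : E -> R) : polyin D f -> polyin D g ->
  polyin D (fun x => f x + g x).
Proof.
move=> [p [pr pE]] [q [qr qE]]; exists (p + q); split=> [m|x]; last by rewrite mevalD pE qE.
rewrite mcoeffD => pq; have [p0|] := eqVneq (mcoeff m p) 0; last exact: pr.
by apply: qr; move: pq; rewrite p0 add0r.
Qed.

Lemma polyin_term (D : mi -> Prop) c m : D m -> polyin D (fun x => c * mon x m).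
Proof.
move=> mr; pose mm := Multinom [tuple m i | i < n.+1].
have mmE i : mm i = m i by rewrite mnmE.
exists (c *: mpolyX _ mm); split=> [m'|x].
  rewrite mcoeffZ mcoeffX; case: (mm =P m') => [<- _|_]; last by rewrite mulr0 eqxx.
  suff -> : mexp mm = m by [].
  by apply/ffunP => i; rewrite ffunE mmE.
by rewrite mevalZ mevalX; congr (_ * _); apply: eq_bigr => i _; rewrite mmE.
Qed.

Lemma polyin_sum D (I : Type) (s : seq I) (P : pred I) (f : I -> E -> R) :
  (forall i, P i -> polyin D (f i)) -> polyin D (fun x => \sum_(i <- s | P i) f i x).
Proof.
move=> H; elim: s => [|i s IH].
  by apply: polyin_eq _ (polyin0 D) => x; rewrite big_nil.
have := polyinD (f := fun x => if P i then f i x else 0) _ IH.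
move=> HD; apply: polyin_eq _ (HD _) => [x|]; first by rewrite big_cons; case: (P i); rewrite ?add0r.
by case Pi: (P i); [apply: H | apply: polyin0].
Qed.

Lemma polyinP D (f : E -> R) : polyin D f ->
  exists (s : seq mi) (c : mi -> R), [/\ uniq s, forall m, m \in s -> D m &
    forall x, f x = \sum_(m <- s) c m * mon x m].
Proof.
move=> [p [pr pE]].
pose h' (m : mi) : multinom n.+1 := Multinom [tuple m i | i < n.+1].
have hK : cancel mexp h' by move=> m; apply/mnmP => i; rewrite mnmE ffunE.
exists (map mexp (msupp p)), (fun m => mcoeff (h' m) p); split.
- by rewrite map_inj_uniq ?msupp_uniq //; apply: can_inj hK.
- by move=> _ /mapP[m mp ->]; have := pr m; rewrite -mcoeff_msupp => /(_ mp).
move=> x; rewrite pE mevalE [RHS]big_map; apply: eq_bigr => m _.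
by rewrite hK; congr (_ * _); apply: eq_bigr => i _; rewrite ffunE.
Qed.

Lemma polyin_seq (D : mi -> Prop) (I : eqType) (s : seq I) (c : I -> R) (mu : I -> mi) :
  (forall i, i \in s -> D (mu i)) ->
  polyin D (fun x => \sum_(i <- s) c i * mon x (mu i)).
Proof.
move=> H; apply: (@polyin_eq _ (fun x => \sum_(i <- s | i \in s) c i * mon x (mu i))).
  by move=> x; rewrite -big_seq.
by apply: polyin_sum => i /H; apply: polyin_term.
Qed.

Lemma polyinM (D1 D2 D : mi -> Prop) (f g : E -> R) :
  (forall a b, D1 a -> D2 b -> D (addm a b)) ->
  polyin D1 f -> polyin D2 g -> polyin D (fun x => f x * g x).
Proof.
move=> H /polyinP[sf [c [_ fd fE]]] /polyinP[sg [d [_ gd gE]]].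
apply: (@polyin_eq _ (fun x =>
  \sum_(q <- [seq (a, b) | a <- sf, b <- sg]) (c q.1 * d q.2) * mon x (addm q.1 q.2))).
  move=> x; rewrite fE gE big_allpairs_dep /= mulr_suml; apply: eq_bigr => a _.
  by rewrite mulr_sumr; apply: eq_bigr => b _; rewrite mon_add mulrACA.
by apply: polyin_seq => _ /allpairsP[[a b] [/fd ha /gd hb ->]] /=; apply: H.
Qed.

Lemma is_poly0 r : @is_poly R n r (fun=> 0).
Proof. by apply/is_polyE/polyin0. Qed.

Lemma is_polyD r (f g : E -> R) : is_poly r f -> is_poly r g ->
  is_poly r (fun x => f x + g x).
Proof. by move=> /is_polyE hf /is_polyE hg; apply/is_polyE/polyinD. Qed.

Lemma is_poly_term (r : int) c m : (mdg m)%:Z <= r -> @is_poly R n r (fun x => c * mon x m).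
Proof. by move=> mr; apply/is_polyE/polyin_term. Qed.

Lemma is_poly_sum r (I : Type) (s : seq I) (P : pred I) (f : I -> E -> R) :
  (forall i, P i -> is_poly r (f i)) -> is_poly r (fun x => \sum_(i <- s | P i) f i x).
Proof. by move=> H; apply/is_polyE/polyin_sum => i /H/is_polyE. Qed.

Lemma is_polyP r (f : E -> R) : is_poly r f ->
  exists (s : seq mi) (c : mi -> R), [/\ uniq s, forall m, m \in s -> (mdg m)%:Z <= r &
    forall x, f x = \sum_(m <- s) c m * mon x m].
Proof. by move=> /is_polyE/polyinP. Qed.

Lemma is_poly_seq r (I : eqType) (s : seq I) (c : I -> R) (mu : I -> mi) :
  (forall i, i \in s -> (mdg (mu i))%:Z <= r) ->
  is_poly r (fun x => \sum_(i <- s) c i * mon x (mu i)).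
Proof. by move=> H; apply/is_polyE/polyin_seq. Qed.

Lemma is_polyM (r s : int) (f g : E -> R) : is_poly r f -> is_poly s g ->
  is_poly (r + s) (fun x => f x * g x).
Proof.
move=> /is_polyE hf /is_polyE hg; apply/is_polyE; apply: polyinM hf hg => a b ha hb.
by rewrite mdg_add PoszD lerD.
Qed.

Lemma is_poly_eq r (f g : E -> R) : (forall x, f x = g x) -> is_poly r f -> is_poly r g.
Proof. by move=> /funext ->. Qed.

Lemma is_poly_cst c : @is_poly R n 0 (fun=> c).
Proof.
apply: (@is_poly_eq _ (fun x => c * mon x [ffun=> 0%N])) => [x|].
  by rewrite /mon big1 ?mulr1 // => i _; rewrite ffunE.
by apply: is_poly_term; rewrite /mdg big1 // => i _; rewrite ffunE.
Qed.

Lemma is_polyZ r c (f : E -> R) : is_poly r f -> is_poly r (fun x => c * f x).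
Proof. by move=> /(is_polyM (is_poly_cst c)); rewrite add0r. Qed.

Lemma is_polyZr r c (f : E -> R) : is_poly r f -> is_poly r (fun x => f x * c).
Proof. by move=> /(is_polyZ c); apply: is_poly_eq => x; rewrite mulrC. Qed.

Lemma is_poly_coord i : @is_poly R n 1 (fun x => x ord0 i).
Proof.
pose m : mi := [ffun j => (j == i : nat)].
apply: (@is_poly_eq _ (fun x => 1 * mon x m)) => [x|].
  rewrite mul1r /mon (bigD1 i) //= ffunE eqxx big1 ?mulr1 // => j ji.
  by rewrite ffunE (negbTE ji).
apply: is_poly_term; rewrite /mdg (bigD1 i) //= ffunE eqxx big1 ?addn0 // => j ji.
by rewrite ffunE (negbTE ji).
Qed.

Lemma is_poly_prod k (J : 'I_k -> 'I_n.+1) :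
  is_poly k%:Z (fun x : E => \prod_a x ord0 (J a)).
Proof.
elim: k J => [|k IH] J.
  by apply: is_poly_eq _ (is_poly_cst 1) => x; rewrite big_ord0.
have := is_polyM (is_poly_coord (J ord0)) (IH (J \o lift ord0)).
by rewrite -PoszD; apply: is_poly_eq => x; rewrite big_ord_recl.
Qed.

Lemma is_poly_Phi r (f : E -> R) : is_poly r f -> is_poly (2 * r) (fun u => f (Phi u)).
Proof.
move=> /is_polyP[s [c [_ d fE]]].
apply: (@is_poly_eq _ (fun x => \sum_(m <- s) c m * mon x (addm m m))) => [x|].
  rewrite fE; apply: eq_bigr => m _; rewrite mon_add; congr (_ * _).
  rewrite -big_split; apply: eq_bigr => i _ /=.
  by rewrite mxE -exprD -exprM addnn -mul2n.
by apply: is_poly_seq => m /d; rewrite mdg_add; lia.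
Qed.

Lemma digits_inj N B (f g : 'I_N -> nat) :
  (forall i, f i < B)%N -> (forall i, g i < B)%N ->
  (\sum_i f i * B ^ i = \sum_i g i * B ^ i)%N -> f =1 g.
Proof.
elim: N f g => [|N IH] f g fB gB; first by move=> _ [].
have shift (h : 'I_N.+1 -> nat) :
    (\sum_i h i * B ^ i = (\sum_(i < N) h (lift ord0 i) * B ^ i) * B + h ord0)%N.
  rewrite big_ord_recl expn0 muln1 addnC; congr (_ + _)%N.
  by rewrite big_distrl /=; apply: eq_bigr => i _; rewrite /bump add1n expnSr mulnA.
have B0 : (0 < B)%N by apply: leq_ltn_trans (fB ord0).
rewrite !shift => E1.
have f0 : f ord0 = g ord0.
  by have := congr1 (modn^~ B) E1; rewrite /= !modnMDl !modn_small.
have := congr1 (divn^~ B) E1; rewrite /= !divnMDl // !divn_small // !addn0 => E2.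
have fg := IH (f \o lift ord0) (g \o lift ord0) (fun i => fB _) (fun i => gB _) E2.
by move=> i; case: (unliftP ord0 i) => [j|] -> //; apply: fg.
Qed.

(* Kronecker substitution: [x_i = t ^ (B ^ i)] sends distinct monomials with
   exponents below [B] to distinct powers of [t]. *)
Lemma mono_indep (s : seq mi) (c : mi -> R) : uniq s ->
  (forall x : E, (forall i, 0 < x ord0 i) -> \sum_(m <- s) c m * mon x m = 0) ->
  forall m, m \in s -> c m = 0.
Proof.
move=> us H m0 m0s.
pose B := (\sum_(m <- s) mdg m).+1.
have mB m i : m \in s -> (m i < B)%N.
  move=> ms; rewrite ltnS /B (big_rem m) //= /mdg (bigD1 i) //= -addnA; exact: leq_addr.
pose kap (m : mi) := (\sum_i m i * B ^ i)%N.
have kI : {in s &, injective kap}.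
  by move=> a b sa sb /digits_inj ab; apply/ffunP; apply: ab => i; apply: mB.
pose P : {poly R} := \sum_(m <- s) c m *: 'X^(kap m).
have P0 t : 0 < t -> P.[t] = 0.
  move=> t0; rewrite /P horner_sum -[RHS](H (\row_i t ^+ (B ^ i))) => [|i]; last first.
    by rewrite mxE exprn_gt0.
  apply: eq_bigr => m _; rewrite hornerZ hornerXn; congr (_ * _).
  rewrite /kap expr_sum; apply: eq_bigr => i _.
  by rewrite mxE -exprM mulnC.
have PE : P = 0.
  apply: contrapT => /eqP Pn0.
  have := max_poly_roots Pn0 (rs := [seq (i.+1)%:R | i <- iota 0 (size P)]).
  rewrite size_map size_iota ltnn => H1; apply: notF; apply: H1.
    by apply/allP => _ /mapP[i _ ->]; apply/eqP/P0; rewrite ltr0n.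
  by rewrite map_inj_uniq ?iota_uniq // => i j /eqP; rewrite eqr_nat => /eqP[].
have : P`_(kap m0) = 0 by rewrite PE coef0.
rewrite /P coef_sum (bigD1_seq m0) //= coefZ coefXn eqxx mulr1 big_seq_cond big1 ?addr0 // => m.
move=> /andP[ms mm0]; rewrite coefZ coefXn; case: eqP => [/kI|_]; last by rewrite mulr0.
by move=> /(_ m0s ms) E1; rewrite E1 eqxx in mm0.
Qed.

Definition homog (d : int) (s : seq mi) := forall m, m \in s -> (mdg m)%:Z = d.

Lemma mon_scale t (x : E) m : mon (t *: x) m = t ^+ mdg m * mon x m.
Proof.
rewrite /mon /mdg expr_sum -big_split; apply: eq_bigr => i _ /=.
by rewrite mxE exprMn.
Qed.

Lemma homog_simplex d (s : seq mi) (c : mi -> R) (x : E) : homog d s -> (forall i, 0 <= x ord0 i) ->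
  0 < \sum_i x ord0 i ->
  \sum_(m <- s) c m * mon ((\sum_i x ord0 i)^-1 *: x) m = 0 ->
  \sum_(m <- s) c m * mon x m = 0.
Proof.
move=> hs x0 sx H; set t := \sum_i _ in sx H *.
have [->|[m0 m0s]] : s = [::] \/ exists m, m \in s.
  by case: s {hs H} => [|m s]; [left | right; exists m; rewrite mem_head].
  by rewrite big_nil.
transitivity (t ^+ mdg m0 * \sum_(m <- s) c m * mon (t^-1 *: x) m); last by rewrite H mulr0.
rewrite mulr_sumr [LHS]big_seq [RHS]big_seq; apply: eq_bigr => m ms.
have -> : mdg m0 = mdg m by have := hs _ ms; rewrite -(hs _ m0s) => -[].
rewrite -{1}[x](_ : t *: (t^-1 *: x) = x).
  by rewrite mon_scale mulrCA.
by rewrite scalerA divff ?scale1r // gt_eqF.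
Qed.

Lemma simplex_normalize (x : E) : (forall i, 0 <= x ord0 i) -> 0 < \sum_i x ord0 i ->
  points (simplex R n) ((\sum_i x ord0 i)^-1 *: x).
Proof.
move=> x0 sx; split=> [i|]; first by rewrite mxE mulr_ge0 ?invr_ge0 ?(ltW sx).
under eq_bigr do rewrite mxE.
by rewrite -mulr_sumr mulVf // gt_eqF.
Qed.

(** By homogeneity the vanishing extends from the face to the cone over it. Setting x_i = 0 keeps
    exactly the monomials free of x_i, and these are linearly independent. Since n >= 1, another
    coordinate stays positive, so that the point can be normalized. *)
Lemma homog_face_eq0 (hn : (1 <= n)%N) d (s : seq mi) (c : mi -> R) i : uniq s -> homog d s ->
  (forall x, points (simplex R n) x -> x ord0 i = 0 -> \sum_(m <- s) c m * mon x m = 0) ->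
  forall m, m \in s -> m i = 0%N -> c m = 0.
Proof.
move=> us hs H m ms mi0.
suff : forall m', m' \in [seq m : mi <- s | m i == 0%N] -> c m' = 0.
  by apply; rewrite mem_filter mi0.
apply: mono_indep; first exact: filter_uniq.
move=> x x0; pose y : E := \row_j (if j == i then 0 else x ord0 j).
have y0 j : 0 <= y ord0 j by rewrite mxE; case: ifP => // _; apply: ltW.
have yi : y ord0 i = 0 by rewrite mxE eqxx.
have [j ji] : exists j : 'I_n.+1, j != i.
  have h1 : (1 < n.+1)%N by [].
  by case: (altP (i =P ord0)) => [->|i0]; [exists (Ordinal h1) | exists ord0; rewrite eq_sym].
have sy : 0 < \sum_j y ord0 j.
  rewrite (bigD1 j) //= ltr_pwDl ?sumr_ge0 // .
  by rewrite mxE (negbTE ji).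
transitivity (\sum_(m <- s) c m * mon y m).
  rewrite big_filter [RHS](bigID (fun m : mi => m i == 0%N)) /= [X in _ + X]big1 ?addr0.
    apply: eq_bigr => a /eqP ai; congr (_ * _); apply: eq_bigr => b _.
    by rewrite mxE; case: eqP => // ->; rewrite ai.
  by move=> a ai; rewrite /mon (bigD1 i) //= yi expr0n (negbTE ai) mul0r mulr0.
apply: (homog_simplex hs) => //; apply: H; first exact: simplex_normalize.
by rewrite mxE yi mulr0.
Qed.

Lemma homogenize r (f : E -> R) : is_poly r f ->
  exists (s : seq mi) (c : mi -> R), [/\ uniq s, homog r s &
    forall x, points (simplex R n) x -> f x = \sum_(m <- s) c m * mon x m].
Proof.
move=> /is_polyP[s [c [_ sd fE]]].
have pw k : polyin (fun m => mdg m = k) (fun x => (\sum_i x ord0 i) ^+ k).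
  elim: k => [|k IH].
    apply: (@polyin_eq _ (fun x => 1 * mon x [ffun=> 0%N])) => [x|].
      by rewrite mul1r expr0 /mon big1 // => i _; rewrite ffunE.
    by apply: polyin_term; rewrite /mdg big1 // => i _; rewrite ffunE.
  apply: (@polyin_eq _ (fun x => (\sum_i x ord0 i) * (\sum_i x ord0 i) ^+ k)).
    by move=> x; rewrite exprS.
  apply: polyinM IH; last first.
    apply: polyin_sum => i _; pose m : mi := [ffun j => (j == i : nat)].
    apply: (@polyin_eq _ (fun x => 1 * mon x m)) => [x|].
      rewrite mul1r /mon (bigD1 i) //= ffunE eqxx big1 ?mulr1 // => j ji.
      by rewrite ffunE (negbTE ji).
    apply: (@polyin_term (fun m => mdg m = 1%N)).
    rewrite /mdg (bigD1 i) //= ffunE eqxx big1 ?addn0 // => j ji.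
    by rewrite ffunE (negbTE ji).
  by move=> a b ha hb; rewrite mdg_add ha hb.
(* The factor is a power of x_0 + ... + x_n, which is 1 on the simplex. The condition [m \in s]
   gives mdg m <= r, so that the absolute value is the missing degree. *)
have : polyin (fun m => (mdg m)%:Z = r)
    (fun x => \sum_(m <- s | m \in s) c m * mon x m * (\sum_i x ord0 i) ^+ `|r - (mdg m)%:Z|%N).
  apply: polyin_sum => m /sd md.
  apply: polyinM (polyin_term (D := fun a => mdg a = mdg m) (c m) erefl) (pw _).
  by move=> a b ha hb; rewrite mdg_add ha hb; lia.
move=> /polyinP[s' [c' [us' hs' fE']]]; exists s', c'; split=> // x [_ x1].
rewrite -fE' fE big_seq; apply: eq_bigr => m _.
by rewrite x1 expr1n mulr1.
Qed.

End Polynomials.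

(** * Division of monomials and averaging over sign changes *)

Section Monomials.
Variables (R : realType) (n : nat).
Notation E := 'rV[R]_n.+1.
Notation mi := {ffun 'I_n.+1 -> nat}.

Section Tuple.
Variables (k : nat) (J : 'I_k -> 'I_n.+1).

(** The exponent vector of x_J. [subm] divides by x_J when every x_(J_a) occurs, and [halfm] undoes
    the substitution x = Phi u on even exponents. *)
Definition cntm : mi := [ffun i => (\sum_a (J a == i))%N].
Definition subm (m : mi) : mi := [ffun i => (m i - cntm i)%N].
Definition halfm (m : mi) : mi := [ffun i => (m i)./2].

Lemma mon_cntm (x : E) : mon x cntm = \prod_a x ord0 (J a).
Proof.
rewrite /mon; under eq_bigr => i _ do rewrite ffunE expr_sum.
rewrite exchange_big; apply: eq_bigr => a _.
rewrite (bigD1 (J a)) //= eqxx big1 ?mulr1 // => i ij.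
by rewrite eq_sym (negbTE ij).
Qed.

Lemma mdg_cntm : mdg cntm = k.
Proof.
rewrite /mdg; under eq_bigr => i _ do rewrite ffunE.
rewrite exchange_big /= (eq_bigr (fun=> 1%N)) => [|a _].
  by rewrite sum_nat_const card_ord muln1.
rewrite (bigD1 (J a)) //= eqxx big1 ?addn0 // => i ij.
by rewrite eq_sym (negbTE ij).
Qed.

Hypothesis Jinj : injective J.

Lemma cntm_mem a : cntm (J a) = 1%N.
Proof.
rewrite ffunE (bigD1 a) //= eqxx big1 ?addn0 // => b ba.
by rewrite (inj_eq Jinj) (negbTE ba).
Qed.

Lemma cntm_notmem i : (forall a, J a != i) -> cntm i = 0%N.
Proof. by move=> H; rewrite ffunE big1 // => a _; rewrite (negbTE (H a)). Qed.

Lemma subm_add (m : mi) : (forall a, 0 < m (J a))%N -> m = addm cntm (subm m).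
Proof.
move=> m0; apply/ffunP => i; rewrite [RHS]ffunE [subm m i]ffunE.
have [[a <-]|H] := pselect (exists a, J a = i).
  by rewrite cntm_mem add1n subn1 prednK.
rewrite cntm_notmem ?subn0 // => a; apply/eqP => E1; apply: H; by exists a.
Qed.

Lemma mon_subm (x : E) (m : mi) : (forall a, 0 < m (J a))%N ->
  mon x m = (\prod_a x ord0 (J a)) * mon x (subm m).
Proof. by move=> /subm_add {1}->; rewrite mon_add mon_cntm. Qed.

Lemma mdg_subm (m : mi) : (forall a, 0 < m (J a))%N -> mdg m = (k + mdg (subm m))%N.
Proof. by move=> /subm_add {1}->; rewrite mdg_add mdg_cntm. Qed.

Definition signv (s : {ffun 'I_n.+1 -> bool}) (u : E) : E :=
  \row_j ((-1) ^+ s j * u ord0 j).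

Lemma sum_signs (p : 'I_n.+1 -> nat) :
  \sum_(s : {ffun 'I_n.+1 -> bool}) \prod_i ((-1) ^+ s i : R) ^+ p i =
  if [forall i, ~~ odd (p i)] then 2 ^+ n.+1 else 0.
Proof.
rewrite -(bigA_distr_bigA (fun i (b : bool) => ((-1) ^+ b : R) ^+ p i)) /=.
case: ifPn => [/forallP H|].
  rewrite (eq_bigr (fun=> 2)) => [|i _]; first by rewrite prodr_const card_ord.
  by rewrite big_bool /= expr1 expr0 expr1n -signr_odd (negbTE (H i)) expr0; ring.
rewrite negb_forall => /existsP[i]; rewrite negbK => oi.
rewrite (bigD1 i) //= big_bool /= expr1 expr0 expr1n -signr_odd oi expr1.
by rewrite addNr mul0r.
Qed.

Lemma halfm_split (m : mi) : (forall i, ~~ odd (cntm i + m i)) ->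
  m = addm cntm (addm (halfm m) (halfm m)).
Proof.
have odd_split q : ~~ odd (1 + q) -> q = (1 + (q./2 + q./2))%N by lia.
have even_split q : ~~ odd (0 + q) -> q = (0 + (q./2 + q./2))%N by lia.
move=> H; apply/ffunP => i; rewrite [RHS]ffunE [addm (halfm m) _ _]ffunE [halfm m i]ffunE.
have [[a <-]|Hi] := pselect (exists a, J a = i).
  by have := H (J a); rewrite cntm_mem; apply: odd_split.
have c0 : cntm i = 0%N by apply: cntm_notmem => a; apply/eqP => E1; apply: Hi; exists a.
by have := H i; rewrite c0; apply: even_split.
Qed.

(** The weighted sum keeps exactly the monomials whose exponents have the parities of u_J, and these
    are u_J times a monomial in the squares. The latter has integral degree, so the [+ 1] in the
    bound is harmless. *)
Lemma is_poly_parity (s r : int) (g : E -> R) : is_poly s g -> s <= 2 * r + k%:Z + 1 ->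
  exists q : E -> R, is_poly r q /\ forall u,
    \sum_(e : {ffun 'I_n.+1 -> bool}) (\prod_a (-1) ^+ e (J a)) * g (signv e u) =
    2 ^+ n.+1 * ((\prod_a u ord0 (J a)) * q (Phi u)).
Proof.
move=> /is_polyP[t [c [_ td gE]]] sr.
pose ev (m : mi) := [forall i, ~~ odd (cntm i + m i)].
exists (fun x => \sum_(m <- [seq m <- t | ev m]) c m * mon x (halfm m)); split.
  apply: is_poly_seq => m; rewrite mem_filter => /andP[/forallP em /td].
  by rewrite {1}(halfm_split em) !mdg_add mdg_cntm; lia.
move=> u; under [LHS]eq_bigr => e _ do rewrite gE mulr_sumr.
rewrite exchange_big /= big_filter [RHS]mulrA mulr_sumr [RHS]big_mkcond /=.
apply: eq_bigr => m _.
transitivity (c m * mon u m *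
    \sum_(e : {ffun 'I_n.+1 -> bool}) \prod_i ((-1) ^+ e i : R) ^+ (cntm i + m i)).
  rewrite mulr_sumr; apply: eq_bigr => e _.
  have -> : mon (signv e u) m = (\prod_i ((-1) ^+ e i : R) ^+ m i) * mon u m.
    by rewrite /mon -big_split; apply: eq_bigr => i _ /=; rewrite mxE exprMn.
  have -> : \prod_a (-1) ^+ e (J a) = \prod_i ((-1) ^+ e i : R) ^+ cntm i.
    transitivity (mon (\row_i (-1) ^+ e i : E) cntm).
      by rewrite mon_cntm; apply: eq_bigr => a _; rewrite mxE.
    by apply: eq_bigr => i _; rewrite mxE.
  under [in RHS]eq_bigr => i _ do rewrite exprD.
  by rewrite big_split /=; ring.
rewrite sum_signs; case: ifP => em; rewrite /ev em; last by rewrite mulr0.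
have -> : mon u m = (\prod_a u ord0 (J a)) * (mon u (halfm m) * mon u (halfm m)).
  by rewrite {1}(halfm_split (forallP em)) mon_add mon_cntm mon_add.
have -> : mon (Phi u) (halfm m) = mon u (halfm m) * mon u (halfm m).
  by rewrite /mon -big_split; apply: eq_bigr => i _ /=; rewrite mxE expr2 exprMn.
by ring.
Qed.

End Tuple.
End Monomials.

(** * Derivatives and smoothness *)

Section Calculus.
Local Open Scope classical_set_scope.
Variables (R : realType) (n : nat).
Notation E := 'rV[R]_n.+1.
Notation eps := (@basis_vec R n).

Lemma is_diff_coord (u : E) i : is_diff u (fun v : E => v ord0 i : R) (fun v => v ord0 i).
Proof.
have @f : {linear E -> R}.
  by exists (fun v : E => v ord0 i); do 2![eexists]; do ?[constructor];
     rewrite ?mxE// => ? *; rewrite ?mxE//; move=> ?; rewrite !mxE.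
apply: DiffDef; first exact: differentiable_coord.
have fc : continuous f by exact: coord_continuous.
by have := diff_lin u fc.
Qed.

Lemma diff_row (k dk : 'I_n.+1 -> E -> R) (u : E) :
  (forall i, is_diff u (k i) (dk i)) ->
  'd (fun v : E => \row_i k i v : E) u = (fun v => \row_i dk i v) :> (E -> E).
Proof.
move=> kd.
suff H : is_diff u (fun v : E => \row_i k i v : E) (fun v : E => \row_i dk i v : E).
  exact: diff_val.
have rowE (g : 'I_n.+1 -> E -> R) :
    (fun v : E => \row_i g i v : E) = \sum_i (fun v => g i v *: eps i).
  apply/funext => v; rewrite fct_sumE [LHS]row_basis.
  by apply: eq_bigr => i _; rewrite mxE.
rewrite !rowE; elim/big_ind2: _ => [|f df g dg hf hg|i _].
- exact: is_diff_cst.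
- exact: is_diffD.
- apply: DiffDef; first by apply: differentiableZl; case: (kd i).
  by rewrite diffZl; [rewrite diff_val | case: (kd i)].
Qed.

Lemma diff_Phi (u v : E) : 'd (@Phi R n) u v = \row_i (2 * u ord0 i * v ord0 i).
Proof.
have H i : is_diff u (fun u : E => u ord0 i ^+ 2 : R) (fun v : E => 2 * u ord0 i * v ord0 i : R).
  have h := is_diffM (is_diff_coord u i) (is_diff_coord u i).
  rewrite (_ : (fun u : E => u ord0 i ^+ 2) =
               (fun u : E => u ord0 i : R) * (fun u : E => u ord0 i)) //.
  apply: (is_diff_eq h); apply/funext => w.
  by rewrite -[LHS]/(u ord0 i * w ord0 i + u ord0 i * w ord0 i); ring.
exact: (congr1 (@^~ v) (diff_row H)).
Qed.

Lemma reflection_signE i (u : E) :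
  reflection i u = \row_j ((-1) ^+ (j == i) * u ord0 j).
Proof. by apply/rowP => j; rewrite !mxE; case: eqP; rewrite ?mulN1r ?mul1r. Qed.

Lemma diff_reflection i (u v : E) : 'd (@reflection R n i) u v = reflection i v.
Proof.
rewrite (_ : reflection i = fun u : E => \row_j ((-1) ^+ (j == i) * u ord0 j)); last first.
  by apply/funext => w; rewrite reflection_signE.
have H j : is_diff u (fun u : E => (-1) ^+ (j == i) * u ord0 j : R)
                     (fun v : E => (-1) ^+ (j == i) * v ord0 j : R).
  exact: (is_diffZ ((-1) ^+ (j == i)) (is_diff_coord u j)).
exact: (congr1 (@^~ v) (diff_row H)).
Qed.

Lemma Cdiff_continuous m (g : E -> R^o) : Cdiff m g -> continuous g.
Proof. by case: m => [|m] []. Qed.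

Lemma CdiffW m (g : E -> R^o) : Cdiff m.+1 g -> Cdiff m g.
Proof.
elim: m g => [|m IH] g; first by case.
move=> [gc H]; split=> // i; have [gd /IH] := H i; by [].
Qed.

Lemma Cdiff_cst m c : @Cdiff R n m (fun=> c).
Proof.
elim: m c => [|m IH] c; split=> //; try exact: cst_continuous.
move=> i; split=> [x|]; first exact: derivable_cst.
rewrite (_ : 'D_(eps i) _ = fun=> 0); first exact: IH.
by apply/funext => x; apply: derive_cst.
Qed.

Lemma Cdiff_coord m j : @Cdiff R n m (fun x => x ord0 j).
Proof.
have cc : continuous (fun x : E => x ord0 j : R^o) by exact: coord_continuous.
case: m => [|m]; split=> // i.
have H x : is_derive x (eps i) (fun x : E => x ord0 j : R^o) (eps i ord0 j).
  have dc := is_diff_coord x j.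
  apply: DeriveDef; first by apply: diff_derivable; case: dc.
  by rewrite deriveE; [rewrite diff_val | case: dc].
split=> [x|]; first by case: (H x).
rewrite (_ : 'D_(eps i) _ = fun=> eps i ord0 j); first exact: Cdiff_cst.
by apply/funext => x; case: (H x).
Qed.

Lemma CdiffD m (f g : E -> R^o) : Cdiff m f -> Cdiff m g -> Cdiff m (fun x => f x + g x).
Proof.
elim: m f g => [|m IH] f g [fc fd] [gc gd]; split=> //.
- by move=> x; exact: (cvgD (fc x) (gc x)).
- by move=> x; exact: (cvgD (fc x) (gc x)).
move=> i; have [fi fm] := fd i; have [gi gm] := gd i; split=> [x|].
  exact: derivableD.
rewrite (_ : 'D_(eps i) _ = fun x => 'D_(eps i) f x + 'D_(eps i) g x); first exact: IH.
by apply/funext => x; apply: deriveD.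
Qed.

Lemma CdiffM m (f g : E -> R^o) : Cdiff m f -> Cdiff m g ->
  Cdiff m (fun x => (f x : R) * (g x : R) : R^o).
Proof.
elim: m f g => [|m IH] f g fC gC; have fc := Cdiff_continuous fC; have gc := Cdiff_continuous gC.
  by split=> // x; exact: (cvgM (fc x) (gc x)).
split=> [x|i]; first by exact: (cvgM (fc x) (gc x)).
have [fi fm] := fC.2 i; have [gi gm] := gC.2 i; split=> [x|].
  exact: derivableM.
rewrite (_ : 'D_(eps i) _ =
    fun x => ((f x : R) * ('D_(eps i) g x : R) : R^o) + ((g x : R) * ('D_(eps i) f x : R) : R^o)).
  by apply: CdiffD; apply: IH => //; apply: CdiffW.
by apply/funext => x; apply: deriveM.
Qed.

Lemma smooth_cst c : smooth (fun=> c : R^o) (R := R) (n := n).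
Proof. by move=> m; apply: Cdiff_cst. Qed.

Lemma smooth_coord j : smooth (fun x : E => x ord0 j).
Proof. by move=> m; apply: Cdiff_coord. Qed.

Lemma smoothD (f g : E -> R^o) : smooth f -> smooth g -> smooth (fun x => f x + g x).
Proof. by move=> hf hg m; apply: CdiffD. Qed.

Lemma smoothM (f g : E -> R) : smooth (f : E -> R^o) -> smooth (g : E -> R^o) ->
  smooth (fun x => f x * g x : R^o).
Proof. by move=> hf hg m; apply: CdiffM. Qed.

Lemma smoothZ c (f : E -> R) : smooth (f : E -> R^o) -> smooth (fun x => c * f x : R^o).
Proof. by apply: smoothM; apply: smooth_cst. Qed.

Lemma smooth_sum (I : Type) (s : seq I) (f : I -> E -> R) :
  (forall i, smooth (f i : E -> R^o)) -> smooth (fun x => \sum_(i <- s) f i x : R^o).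
Proof.
move=> H; elim: s => [|i s IH].
  by have := smooth_cst 0; congr smooth; apply/funext => x; rewrite big_nil.
have := smoothD (H i) IH; congr smooth; apply/funext => x; by rewrite big_cons.
Qed.

Lemma smooth_prod (I : Type) (s : seq I) (f : I -> E -> R) :
  (forall i, smooth (f i : E -> R^o)) -> smooth (fun x => \prod_(i <- s) f i x : R^o).
Proof.
move=> H; elim: s => [|i s IH].
  by have := smooth_cst 1; congr smooth; apply/funext => x; rewrite big_nil.
have := smoothM (H i) IH; congr smooth; apply/funext => x; by rewrite big_cons.
Qed.

Lemma smooth_mon (m : {ffun 'I_n.+1 -> nat}) : smooth (fun x : E => mon x m : R^o).
Proof.
rewrite /mon; apply: smooth_prod => i; elim: (m i) => [|k IH].
  exact: smooth_cst.
have := smoothM (smooth_coord i) IH; congr smooth; apply/funext => x; by rewrite exprS.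
Qed.

Lemma is_poly_smooth r (f : E -> R) : is_poly r f -> smooth (f : E -> R^o).
Proof.
move=> /is_polyP[s [c [_ _ fE]]].
have : smooth (fun x => \sum_(m <- s) c m * mon x m : R^o).
  by apply: smooth_sum => m; apply/smoothZ/smooth_mon.
by congr smooth; apply/funext => x; rewrite fE.
Qed.

Lemma continuous_segment_eq0 (f : E -> R^o) (x d : E) : continuous f ->
  (forall t, 0 < t <= 1 -> f (x + t *: d) = 0) -> f x = 0.
Proof.
move=> fc H.
have gc : (fun t : R => f (x + t *: d)) @ (0 : R)^'+ --> f x.
  apply: cvg_at_right_filter.
  have h : {for (0 : R), continuous (f \o (fun t : R => x + t *: d))}.
    apply: continuous_comp; last exact: fc.
    by apply: (@continuousD _ _ _ (fun=> x) (fun t : R => t *: d)); [apply: cst_continuous | apply: scalel_continuous].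
  have h0 : f (x + t *: d) @[t --> (0 : R)] --> f (x + 0 *: d) := h.
  by rewrite scale0r addr0 in h0.
have z0 : (fun t : R => f (x + t *: d)) @ (0 : R)^'+ --> (0 : R^o).
  apply: cvg_near_cst; near=> t; apply: H; apply/andP; split.
    by near: t; exact: nbhs_right_gt.
  by near: t; exact: nbhs_right_le.
exact: (cvg_unique (@norm_hausdorff _ R^o) gc z0).
Unshelve. all: by end_near. Qed.

End Calculus.

(** * The duality map *)

Section Forms.
Local Open Scope classical_set_scope.
Variables (R : realType) (n : nat).
Notation E := 'rV[R]_n.+1.
Notation eps := (@basis_vec R n).
Notation alt := (@Defs.alternating R n _).
Notation T := (simplex R n).
Notation S := (sphere R n).

Lemma restr_val (M : submfd R n) k (a : dform R n k) x v :
  points M x -> (forall j, tangent M x (v j)) -> restr_form M a x v = a x v.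
Proof. by move=> px tv; rewrite /restr_form; case: asboolP => // -[]. Qed.

Lemma restr_out (M : submfd R n) k (a : dform R n k) x v :
  ~ (points M x /\ forall j, tangent M x (v j)) -> restr_form M a x v = 0.
Proof. by move=> H; rewrite /restr_form; case: asboolP. Qed.

Lemma restr_eqP (M : submfd R n) k (a b : dform R n k) :
  restr_form M a = restr_form M b <->
  forall x v, points M x -> (forall j, tangent M x (v j)) -> a x v = b x v.
Proof.
split=> [ab x v px tv|H].
  by rewrite -(restr_val _ px tv) ab restr_val.
apply/funext => x; apply/funext => v; rewrite /restr_form; case: asboolP => // -[px tv].
exact: H.
Qed.

Lemma restr_lin (M : submfd R n) k (a b : dform R n k) c :
  restr_form M (c *: a + b) = c *: restr_form M a + restr_form M b.
Proof.
apply/funext => x; apply/funext => v.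
rewrite -[RHS]/(c * restr_form M a x v + restr_form M b x v) /restr_form.
by case: asboolP => // _; rewrite mulr0 addr0.
Qed.

(** The differential of [Phi] at [u], by [diff_Phi]. *)
Definition Du (u v : E) : E := \row_i (2 * u ord0 i * v ord0 i).

Lemma Du_lin u c (y z : E) : Du u (c *: y + z) = c *: Du u y + Du u z.
Proof. by apply/rowP => i; rewrite !mxE; ring. Qed.

Lemma Du_mx u v : Du u v = v *m diag_mx (2 *: u).
Proof. by apply/rowP => i; rewrite mul_mx_diag !mxE; ring. Qed.

Lemma Du_basis u i : Du u (eps i) = (2 * u ord0 i) *: eps i.
Proof.
apply/rowP => j; rewrite /Du mxE [RHS]mxE !basis_vecE.
by case: (altP (i =P j)) => [->|_]; rewrite /= ?mulr1 // !mulr0.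
Qed.

Lemma Phi_simplex u : points S u -> points T (Phi u).
Proof.
move=> uu; split=> [i|]; first by rewrite mxE sqr_ge0.
by rewrite -[RHS]uu; apply: eq_bigr => i _; rewrite mxE expr2.
Qed.

Lemma Du_tangent u v : tangent S u v -> tangent T (Phi u) (Du u v).
Proof.
move=> uv; rewrite /= (eq_bigr (fun i => 2 * (u ord0 i * v ord0 i))) => [|i _].
  by rewrite -mulr_sumr; move: uv; rewrite /= /dotp => ->; rewrite mulr0.
by rewrite mxE mulrA.
Qed.

Lemma Phi_pullE k (A : dform R n k) :
  Phi_pull (restr_form T A) = restr_form S (fun u v => A (Phi u) (Du u \o v)).
Proof.
rewrite /Phi_pull /pullback; apply/restr_eqP => u v uS uv.
rewrite restr_val; first last.
- by move=> j; rewrite diff_Phi; apply: Du_tangent.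
- exact: Phi_simplex.
by congr (A _ _); apply/funext => j; rewrite diff_Phi.
Qed.

Lemma Phi_pull_at k (A : dform R n k) u v : points S u -> (forall j, tangent S u (v j)) ->
  Phi_pull (restr_form T A) u v = A (Phi u) (Du u \o v).
Proof. by move=> uS uv; rewrite Phi_pullE restr_val. Qed.

Section HodgeUnique.
Variables (hn : (1 <= n)%N) (k : nat) (hk : (k <= n)%N).

(** The difference of the two stars at [u] vanishes on positive frames, hence everywhere. Stated at
    a single point, this yields both uniqueness of the star and its pointwise dependence on the
    form. *)
Lemma is_hodge_at (a a' : dform R n k) (b b' : dform R n (n - k)) u :
  is_hodge a b -> is_hodge a' b' -> a u = a' u -> b u = b' u.
Proof.
move=> [[c ca ->] H] [[c' ca' ->] H'] aa; apply/funext => v.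
have [[uS tv]|no] := pselect (points S u /\ forall j, tangent S u (v j)); last first.
  by rewrite !restr_out.
rewrite !restr_val //; apply/eqP; rewrite -subr_eq0; apply/eqP.
have al : alt (fun v => c u v - c' u v).
  split=> [w j r y z|w i j ij].
    by rewrite (alt_ml (ca u)) (alt_ml (ca' u)); ring.
  by rewrite (ca u).2 // (ca' u).2 //; ring.
apply: (alt_frame_eq0 hn (off := k) _ al uS _ tv); first by rewrite subnKC.
move=> e oe; have := H u e uS oe; have := H' u e uS oe; rewrite -aa => <-.
have tk (j : 'I_(n - k)) : tangent S u (e (k + j)%N).
  by case: oe => t _ _; apply: t; have := ltn_ord j; lia.
by rewrite !restr_val // => ->; rewrite subrr.
Qed.

Lemma is_hodge_unique (a : dform R n k) (b b' : dform R n (n - k)) :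
  is_hodge a b -> is_hodge a b' -> b = b'.
Proof. by move=> H H'; apply/funext => u; apply: (is_hodge_at H H'). Qed.

Lemma hodgeE (a : dform R n k) b : is_hodge a b -> hodge a = b.
Proof.
by move=> H; rewrite /hodge; apply: (@is_hodge_unique a) => //; apply: (xgetPex 0 (ex_intro _ b H)).
Qed.

Lemma is_hodge_inj_at (a a' : dform R n k) (b b' : dform R n (n - k)) u :
  (forall x, alt (a x)) -> (forall x, alt (a' x)) ->
  is_hodge (restr_form S a) b -> is_hodge (restr_form S a') b' ->
  b u = b' u -> restr_form S a u = restr_form S a' u.
Proof.
move=> aa aa' [_ H] [_ H'] bb; apply/funext => v.
have [[uS tv]|no] := pselect (points S u /\ forall j, tangent S u (v j)); last first.
  by rewrite !restr_out.
rewrite !restr_val //; apply/eqP; rewrite -subr_eq0; apply/eqP.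
have al : alt (fun v => a u v - a' u v).
  split=> [w j r y z|w i j ij].
    by rewrite (alt_ml (aa u)) (alt_ml (aa' u)); ring.
  by rewrite (aa u).2 // (aa' u).2 //; ring.
apply: (alt_frame_eq0 hn (off := 0%N) _ al uS _ tv); first by rewrite add0n.
move=> e oe; have := H u e uS oe; have := H' u e uS oe; rewrite bb => ->.
have tk (j : 'I_k) : tangent S u (e (0 + j)%N).
  by case: oe => t _ _; apply: t; have := ltn_ord j; lia.
by rewrite !restr_val // => ->; rewrite subrr.
Qed.

End HodgeUnique.

Section Formulas.
Variables (k l : nat) (e : (k.+1 + l)%N = n.+1).

(** The power 2^k comes from [Du] in the k arguments of the form, and k! from the k! orderings of
    J_1, ..., J_k. [dual_cst] is divided by a further 2^l, which the pull-back of an l-form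
    restores. *)
Definition hodge_cst : R := 2 ^+ k / k`!%:R.
Definition dual_cst : R := 2 ^+ k / (k`!%:R * 2 ^+ l).

Lemma hodge_cst_neq0 : hodge_cst != 0.
Proof. by rewrite mulf_neq0 ?invr_eq0 ?expf_neq0 ?pnatr_eq0 // -lt0n fact_gt0. Qed.

Lemma dual_cst_neq0 : dual_cst != 0.
Proof.
by rewrite !(mulf_neq0, invr_eq0, expf_neq0, pnatr_eq0) // ?pnatr_eq0 -?lt0n ?fact_gt0.
Qed.

(** The weights are taken at [u] and the form at [x]: the pair (u, Phi u) gives the star on the
    sphere, the pair (x, x) the dual form on the simplex. *)
Definition scaled_star (A : dform R n k) (u x : E) : ('I_l -> E) -> R :=
  star e (fun J => (\prod_a u ord0 (J a)) * A x (eps \o (J \o lift ord0))).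

Definition hodgeA (A : dform R n k) : dform R n l :=
  fun u w => hodge_cst * scaled_star A u (Phi u) w.

Definition dualA (A : dform R n k) : dform R n l :=
  fun x w => dual_cst * scaled_star A x x w.

Lemma scaled_star_alt A u x : alt (scaled_star A u x).
Proof. exact: star_alt. Qed.

Lemma hodgeA_alt A u : alt (hodgeA A u).
Proof. exact/alt_scale/scaled_star_alt. Qed.

Lemma dualA_alt A u : alt (dualA A u).
Proof. exact/alt_scale/scaled_star_alt. Qed.

Lemma prod_Du (u : E) m (J : 'I_m -> 'I_n.+1) :
  \prod_a (2 * u ord0 (J a)) = 2 ^+ m * \prod_a u ord0 (J a).
Proof. by rewrite big_split prodr_const card_ord. Qed.

Lemma Du_coef (A : dform R n k) u x (f : 'I_k -> 'I_n.+1) : alt (A x) ->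
  A x (Du u \o (eps \o f)) = 2 ^+ k * (\prod_a u ord0 (f a)) * A x (eps \o f).
Proof.
move=> Aa; rewrite -prod_Du -(ml_scale _ _ (alt_ml Aa)); congr (A x _).
by apply/funext => j; rewrite /= Du_basis.
Qed.

(** [star_frame] for the frame that starts with [u]: the weight u_(J_0) is a coordinate of its first
    vector, and the other weights come from [Du]. *)
Lemma hodgeA_frame (A : dform R n k) u (f : nat -> E) :
  (forall x, alt (A x)) -> points S u -> oriented_frame u f ->
  hodgeA A u (fun j => f (k + j)%N) = A (Phi u) (Du u \o (fun j : 'I_k => f j)).
Proof.
move=> Aa uS of_; have [orth v0] := oriented_frameP uS of_.
set V := framefun u f in orth v0.
have V0 : V (il e ord0) = u by [].
have Vr : V \o ir e = (fun j : 'I_l => f (k + j)%N).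
  by apply/funext => j; rewrite /V /framefun /=; congr f.
have Vl : V \o il e \o lift ord0 = (fun j : 'I_k => f j).
  by apply/funext => j; rewrite /V /framefun /=.
have al : alt (fun v => A (Phi u) (Du u \o v)) by apply: alt_lin => //; apply: Du_lin.
have := star_frame (V := V) e al orth v0; rewrite V0 Vr Vl => H.
have k0 : (k`!%:R : R) != 0 by rewrite pnatr_eq0 -lt0n fact_gt0.
apply: (mulfI k0); rewrite -H /hodgeA /scaled_star /hodge_cst mulrA /star !mulr_sumr.
apply: eq_bigr => J _; rewrite Du_coef // big_ord_recl.
rewrite [k`!%:R * _]mulrC divfK //=; ring.
Qed.

Lemma dualA_Phi (A : dform R n k) u v :
  dualA A (Phi u) (Du u \o v) = uN u * hodgeA A u v.
Proof.
rewrite /dualA /hodgeA /scaled_star /star !mulr_sumr; apply: eq_bigr => J _.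
have -> : \prod_a Phi u ord0 (J a) = (\prod_a u ord0 (J a)) * \prod_a u ord0 (J a).
  by rewrite -big_split; apply: eq_bigr => a _; rewrite mxE expr2.
have := @vol_join_mul R n _ _ e (diag_mx (2 *: u)) J (fun a => 2 * u ord0 (J a)) v.
rewrite prod_Du => H.
have {}H : 2 ^+ k.+1 * \prod_a u ord0 (J a) * vol (join e (eps \o J) (Du u \o v)) =
   vol (join e (eps \o J) v) * (2 ^+ n.+1 * uN u).
  rewrite (_ : Du u \o v = fun j => v j *m diag_mx (2 *: u)); last first.
    by apply/funext => j; rewrite /= Du_mx.
  rewrite H; last by move=> a; rewrite -Du_mx Du_basis.
  rewrite det_diag; congr (_ * _).
  under eq_bigr do rewrite mxE.
  by rewrite big_split prodr_const card_ord.
have E2 : (2 : R) ^+ n.+1 = 2 ^+ k.+1 * 2 ^+ l by rewrite -exprD e.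
move: H; rewrite E2.
have p2 m : (2 ^+ m : R) != 0 by rewrite expf_neq0 ?pnatr_eq0.
have k0 : (k`!%:R : R) != 0 by rewrite pnatr_eq0 -lt0n fact_gt0.
set P := \prod_a _; set W := vol _; set W' := vol _ => H.
rewrite /dual_cst /hodge_cst.
(* The product of the u_(J_a) may vanish and is never cancelled: it occurs squared in the
   coordinates of Phi u, and one copy is consumed by [H]. *)
apply: (mulfI (p2 k.+1)).
transitivity (2 ^+ k / (k`!%:R * 2 ^+ l) * P * A (Phi u) (eps \o (J \o lift ord0)) *
  (2 ^+ k.+1 * P * W)); first by ring.
rewrite H; field; rewrite k0 p2 //.
Qed.

End Formulas.

(** * Density of the open simplex and injectivity of the pull-back *)

Section Density.
Variables (k : nat).

Lemma smooth_form_continuous (A : dform R n k) v : Lambda_amb A ->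
  continuous (fun x => A x v).
Proof.
move=> [Aa As].
have -> : (fun x => A x v) = (fun x => \sum_(g : {ffun 'I_k -> 'I_n.+1})
    (\prod_j v j ord0 (g j)) * coef A g x : R^o).
  by apply/funext => x; rewrite (ml_basis v (alt_ml (Aa x))).
have H : smooth (fun x => \sum_(g : {ffun 'I_k -> 'I_n.+1})
    (\prod_j v j ord0 (g j)) * coef A g x : R^o).
  by apply: smooth_sum => g; apply: smoothZ; apply: As.
exact: Cdiff_continuous (H 0%N).
Qed.

(** The segment from x to the barycentre [c] lies in the open simplex except possibly at x. The
    tangent space is the same along it, so continuity of the values on fixed vectors suffices. *)
Lemma Lambda_density (A B : dform R n k) : Lambda_amb A -> Lambda_amb B ->
  (forall x v, points T x -> (forall i, 0 < x ord0 i) -> (forall j, tangent T x (v j)) ->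
     A x v = B x v) ->
  restr_form T A = restr_form T B.
Proof.
move=> LA LB H; apply/restr_eqP => x v xT tv.
apply/eqP; rewrite -subr_eq0; apply/eqP.
have n0 : (0 : R) < n.+1%:R by rewrite ltr0n.
pose c : E := const_mx (n.+1%:R^-1).
apply: (@continuous_segment_eq0 R n (fun x => A x v - B x v : R^o) x (c - x)).
  move=> y; exact: (cvgB (smooth_form_continuous LA (x := y)) (smooth_form_continuous LB (x := y))).
move=> t /andP[t0 t1].
have E1 i : (x + t *: (c - x)) ord0 i = (1 - t) * x ord0 i + t * n.+1%:R^-1.
  by rewrite !mxE; ring.
have pos i : 0 < (x + t *: (c - x)) ord0 i.
  rewrite E1 ltr_wpDl ?mulr_ge0 ?subr_ge0 ?mulr_gt0 ?invr_gt0 //.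
  by case: xT.
rewrite H ?subrr //; split=> [i|]; first exact: ltW.
under eq_bigr do rewrite E1.
rewrite big_split -mulr_sumr /=; case: xT => _ ->.
rewrite sumr_const card_ord -[X in _ + X]mulr_natr divfK ?gt_eqF //; ring.
Qed.

Lemma sqrt_point (x : E) : points T x -> points S (\row_i Num.sqrt (x ord0 i)) /\
  Phi (\row_i Num.sqrt (x ord0 i)) = x.
Proof.
move=> [x0 x1]; split.
  rewrite /= /dotp -[RHS]x1; apply: eq_bigr => i _.
  by rewrite !mxE -expr2 sqr_sqrtr.
by apply/rowP => i; rewrite !mxE sqr_sqrtr.
Qed.

Lemma Phi_pull_eq_at (A B : dform R n k) u x v : points S u -> x = Phi u ->
  (forall i, u ord0 i != 0) ->
  Phi_pull (restr_form T A) u = Phi_pull (restr_form T B) u ->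
  (forall j, tangent T x (v j)) -> A x v = B x v.
Proof.
move=> uS -> u0 H tv.
pose w j : E := \row_i (v j ord0 i / (2 * u ord0 i)).
have wv : Du u \o w = v.
  apply/funext => j; apply/rowP => i; rewrite /= !mxE mulrC divfK //.
  by rewrite mulf_neq0 ?pnatr_eq0.
have tw j : tangent S u (w j).
  rewrite /= /dotp (eq_bigr (fun i => 2^-1 * v j ord0 i)).
    by rewrite -mulr_sumr; have := tv j; rewrite /= => ->; rewrite mulr0.
  by move=> i _; rewrite mxE; field; apply: u0.
by have := congr1 (@^~ w) H; rewrite /= !Phi_pull_at // wv.
Qed.

Lemma Phi_pull_inj (A B : dform R n k) : Lambda_amb A -> Lambda_amb B ->
  (forall u, points S u -> (forall i, u ord0 i != 0) ->
     Phi_pull (restr_form T A) u = Phi_pull (restr_form T B) u) ->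
  restr_form T A = restr_form T B.
Proof.
move=> LA LB H; apply: Lambda_density => // x v xT x0 tv.
have [uS ux] := sqrt_point xT.
have u0 i : (\row_i Num.sqrt (x ord0 i) : E) ord0 i != 0.
  by rewrite mxE gt_eqF // sqrtr_gt0.
exact: (Phi_pull_eq_at uS (esym ux) u0 (H _ uS u0) tv).
Qed.

Lemma Phi_pull_injL (a b : dform R n k) : Lambda T k a -> Lambda T k b ->
  Phi_pull a = Phi_pull b -> a = b.
Proof.
by move=> [A LA <-] [B LB <-] H; apply: Phi_pull_inj => // u _ _; rewrite H.
Qed.

Lemma Phi_pull_invE (a b : dform R n k) : Lambda T k a -> Phi_pull a = b -> Phi_pull_inv b = a.
Proof.
move=> La ab; rewrite /Phi_pull_inv; set X := [set a | _].
have [Lb Eb] : X (xget 0 X) by apply: (xgetPex 0); exists a.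
by apply: Phi_pull_injL; rewrite ?Eb.
Qed.

End Density.
End Forms.

(** * Linearity, pointwise dependence and injectivity of the duality map *)

Section DualMap.
Local Open Scope classical_set_scope.
Variables (R : realType) (n : nat).
Notation E := 'rV[R]_n.+1.
Notation eps := (@basis_vec R n).
Notation alt := (@Defs.alternating R n _).
Notation T := (simplex R n).
Notation S := (sphere R n).

Lemma scaled_star_lin k l (e : (k.+1 + l)%N = n.+1) (A B : dform R n k) c u x w :
  scaled_star e (c *: A + B) u x w = c * scaled_star e A u x w + scaled_star e B u x w.
Proof.
rewrite /scaled_star /star mulr_sumr -big_split; apply: eq_bigr => J _ /=.
rewrite -[(c *: A + B) x _]/(c * A x _ + B x _); ring.
Qed.

Lemma dualA_lin k l (e : (k.+1 + l)%N = n.+1) (A B : dform R n k) c :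
  dualA e (c *: A + B) = c *: dualA e A + dualA e B.
Proof.
apply/funext => x; apply/funext => w.
rewrite -[RHS]/(c * dualA e A x w + dualA e B x w) /dualA scaled_star_lin; ring.
Qed.

Lemma hodgeA_lin k l (e : (k.+1 + l)%N = n.+1) (A B : dform R n k) c :
  hodgeA e (c *: A + B) = c *: hodgeA e A + hodgeA e B.
Proof.
apply/funext => x; apply/funext => w.
rewrite -[RHS]/(c * hodgeA e A x w + hodgeA e B x w) /hodgeA scaled_star_lin; ring.
Qed.

Lemma dualA_scale k l (e : (k.+1 + l)%N = n.+1) (A : dform R n k) c :
  dualA e (c *: A) = c *: dualA e A.
Proof.
have D0 : dualA e (0 : dform R n k) = 0.
  by have := dualA_lin e 0 0 1; rewrite scale1r addr0 scale1r => /eqP;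
     rewrite -subr_eq subrr eq_sym => /eqP.
by have := dualA_lin e A 0 c; rewrite addr0 D0 addr0.
Qed.

Lemma hodgeA_scale k l (e : (k.+1 + l)%N = n.+1) (A : dform R n k) c :
  hodgeA e (c *: A) = c *: hodgeA e A.
Proof.
have D0 : hodgeA e (0 : dform R n k) = 0.
  by have := hodgeA_lin e 0 0 1; rewrite scale1r addr0 scale1r => /eqP;
     rewrite -subr_eq subrr eq_sym => /eqP.
by have := hodgeA_lin e A 0 c; rewrite addr0 D0 addr0.
Qed.

Lemma alt_form_lin k (A B : dform R n k) c : (forall x, alt (A x)) -> (forall x, alt (B x)) ->
  forall x, alt ((c *: A + B) x).
Proof.
move=> Aa Ba x; split=> [v j r y z|v i j ij].
  rewrite -!/((c *: A + B) x _) -![(c *: A + B) x _]/(c * A x _ + B x _).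
  by rewrite (alt_ml (Aa x)) (alt_ml (Ba x)); ring.
rewrite -![(c *: A + B) x _]/(c * A x _ + B x _).
by rewrite (Aa x).2 // (Ba x).2 //; ring.
Qed.

Lemma Lambda_amb_lin k (A B : dform R n k) c : Lambda_amb A -> Lambda_amb B ->
  Lambda_amb (c *: A + B).
Proof.
move=> [Aa As] [Ba Bs]; split; first exact: alt_form_lin.
by move=> f; apply: (smoothD (f := fun x => c * coef A f x) (g := coef B f)) => //; apply: smoothZ.
Qed.

Lemma P_amb_lin r k (A B : dform R n k) c : P_amb r A -> P_amb r B -> P_amb r (c *: A + B).
Proof.
move=> [Aa As] [Ba Bs]; split; first exact: alt_form_lin.
by move=> f; apply: (is_polyD (f := fun x => c * coef A f x) (g := coef B f)) => //; apply: is_polyZ.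
Qed.

Lemma P_amb0 r k : P_amb r (0 : dform R n k).
Proof.
split=> [x|f]; last exact: is_poly0.
split=> [v j c y z|v i j ij]; rewrite -![(0 : dform R n k) x _]/(0 : R); by rewrite ?mulr0 ?addr0 ?oppr0.
Qed.

Lemma P_amb_scale r k (A : dform R n k) c : P_amb r A -> P_amb r (c *: A).
Proof. by move=> hA; have := P_amb_lin c hA (P_amb0 r k); rewrite addr0. Qed.

Lemma iX_lin k (A B : dform R n k.+1) c : iX (c *: A + B) = c *: iX A + iX B.
Proof. by []. Qed.

Lemma P_lin r k (M : submfd R n) (a b : dform R n k) c : P_ r k M a -> P_ r k M b ->
  P_ r k M (c *: a + b).
Proof.
by move=> [A hA <-] [B hB <-]; exists (c *: A + B); [apply: P_amb_lin | rewrite restr_lin].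
Qed.

Lemma Pminus_lin r k (M : submfd R n) (a b : dform R n k) c : Pminus r k M a -> Pminus r k M b ->
  Pminus r k M (c *: a + b).
Proof.
move=> [_ [A hA <-] <-] [_ [B hB <-] <-]; exists (c *: iX A + iX B); last by rewrite restr_lin.
by rewrite -iX_lin; exists (c *: A + B) => //; apply: P_amb_lin.
Qed.

Lemma P_amb_Lambda r k (A : dform R n k) : P_amb r A -> Lambda_amb A.
Proof. by move=> [Aa As]; split=> // f; apply: is_poly_smooth (As f). Qed.

Lemma iXE k (D : dform R n k.+1) x v : iX D x v = D x (consv x v).
Proof. by []. Qed.

Lemma iX_expand k (D : dform R n k.+1) x v : alt (D x) ->
  iX D x v = \sum_i x ord0 i * D x (consv (eps i) v).
Proof.
move=> Da; rewrite iXE -(consv_upd0 0) {2}(row_basis x) (ml_sum (alt_ml Da)).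
by apply: eq_bigr => i _; rewrite consv_upd0.
Qed.

Lemma Pminus_amb_P r k (A : dform R n k) : Pminus_amb r A -> P_amb r A.
Proof.
move=> [D [Da Ds] <-]; split=> [x|f]; first exact: (alt_consv x (Da x)).
have -> : coef (iX D) f = fun x => \sum_i x ord0 i * coef D (consv i f) x.
  apply/funext => x; rewrite /coef iX_expand //; apply: eq_bigr => i _.
  by congr (_ * D x _); rewrite -[RHS]/(eps \o consv i f) comp_consv.
apply: is_poly_sum => i _; have := is_polyM (is_poly_coord R i) (Ds (consv i f)).
by have -> : 1 + (r - 1) = r by ring.
Qed.

Lemma P_Lambda r k (a : dform R n k) : P_ r k T a -> Lambda T k a.
Proof. by move=> [A /P_amb_Lambda hA <-]; exists A. Qed.

Lemma Pminus_P r k M (a : dform R n k) : Pminus r k M a -> P_ r k M a.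
Proof. by move=> [A /Pminus_amb_P hA <-]; exists A. Qed.

Lemma Pminus_Lambda r k (a : dform R n k) : Pminus r k T a -> Lambda T k a.
Proof. by move=> /Pminus_P/P_Lambda. Qed.

Lemma dualA_Lambda k l (e : (k.+1 + l)%N = n.+1) (A : dform R n k) :
  Lambda_amb A -> Lambda_amb (dualA e A).
Proof.
move=> [Aa As]; split=> [x|f]; first exact: dualA_alt.
rewrite /coef /dualA; apply: smoothZ; apply: smooth_sum => J.
apply: smoothM; last exact: smooth_cst.
apply: smoothM; last exact: As.
by apply: smooth_prod => a; apply: smooth_coord.
Qed.

(* Up to a factor, [Lmx u] inverts [Du u] on the coordinates with [u_i <> 0]; it
   stays invertible when some [u_i] vanish, and so it recovers the dual form at
   [Phi u] from the Hodge star at [u] even over the boundary. *)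
Definition Lmx (u : E) : 'M[R]_n.+1 := \matrix_(i, j)
  (if u ord0 i == 0 then (i == j)%:R + u ord0 j else (i == j)%:R / u ord0 i).

Lemma Lmx_row (u v : E) j : (v *m Lmx u) ord0 j =
  (if u ord0 j == 0 then v ord0 j else v ord0 j / u ord0 j) +
  (\sum_(i | u ord0 i == 0) v ord0 i) * u ord0 j.
Proof.
rewrite mxE (bigID (fun i => u ord0 i == 0)) /=.
have E1 : \sum_(i | u ord0 i == 0) v ord0 i * Lmx u i j =
    (if u ord0 j == 0 then v ord0 j else 0) + (\sum_(i | u ord0 i == 0) v ord0 i) * u ord0 j.
  rewrite (eq_bigr (fun i => v ord0 i * (i == j)%:R + v ord0 i * u ord0 j)) => [|i ui]; last first.
    by rewrite mxE ui mulrDr.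
  rewrite big_split /= -mulr_suml; congr (_ + _).
  rewrite big_mkcond (bigD1 j) //= eqxx mulr1 big1 ?addr0 // => i ij.
  by rewrite (negbTE ij) mulr0 if_same.
have E2 : \sum_(i | u ord0 i != 0) v ord0 i * Lmx u i j =
    (if u ord0 j == 0 then 0 else v ord0 j / u ord0 j).
  rewrite (eq_bigr (fun i => v ord0 i * ((i == j)%:R / u ord0 i))) => [|i ui]; last first.
    by rewrite mxE (negbTE ui).
  rewrite big_mkcond (bigD1 j) //= eqxx mul1r big1 ?addr0 => [|i ij].
    by case: eqP.
  by rewrite (negbTE ij) mul0r mulr0 if_same.
by rewrite E1 E2; case: eqP => _; rewrite ?addr0 // add0r addrC.
Qed.

Lemma Lmx_det u : \det (Lmx u) != 0.
Proof.
apply/det0P => -[v vn0 /rowP vL].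
have H j : (if u ord0 j == 0 then v ord0 j else v ord0 j / u ord0 j) +
  (\sum_(i | u ord0 i == 0) v ord0 i) * u ord0 j = 0 by rewrite -Lmx_row vL mxE.
have v0 j : u ord0 j == 0 -> v ord0 j = 0.
  by move=> uj; have := H j; rewrite uj (eqP uj) mulr0 addr0.
case/eqP: vn0; apply/rowP => j; rewrite mxE.
have [/v0//|uj] := boolP (u ord0 j == 0).
have := H j; rewrite (negbTE uj) [X in _ + X * _]big1 // mul0r addr0 => /eqP.
by rewrite mulf_eq0 invr_eq0 (negbTE uj) orbF => /eqP.
Qed.

(** This dictates the rank-one term of [Lmx]. Pairing with u returns v_i for u_i <> 0 and loses the
    v_i with u_i = 0; adding their sum times u restores them, because u has norm 1. The total is
    sum_i v_i = 0. *)
Lemma Lmx_tangent u w x : points S u -> tangent T x w -> tangent S u (w *m Lmx u).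
Proof.
move=> uS /= tw; rewrite /dotp.
under eq_bigr do rewrite Lmx_row mulrDr.
rewrite big_split /=.
have -> : \sum_i u ord0 i * ((\sum_(i | u ord0 i == 0) w ord0 i) * u ord0 i) =
    \sum_(i | u ord0 i == 0) w ord0 i.
  rewrite (eq_bigr (fun i => (\sum_(i | u ord0 i == 0) w ord0 i) * (u ord0 i * u ord0 i))) => [|i _].
    by rewrite -mulr_sumr [X in _ * X]uS mulr1.
  by rewrite mulrCA.
rewrite (bigID (fun i => u ord0 i == 0)) /= big1 ?add0r => [|i ui]; last first.
  by rewrite (eqP ui) mul0r.
rewrite -[RHS]tw [RHS](bigID (fun i => u ord0 i == 0)) /= addrC; congr (_ + _).
by apply: eq_bigr => i ui; rewrite (negbTE ui) mulrC divfK.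
Qed.

(** Terms with some u_(J_a) = 0 vanish on both sides. In the others the eps_(J_a) are eigenvectors
    of [Lmx u] with eigenvalue 1 / u_(J_a), which cancels one of the two copies of the weight. *)
Lemma dualA_hodgeA k l (e : (k.+1 + l)%N = n.+1) (A : dform R n k) u w :
  dualA e A (Phi u) w =
  dual_cst R k l / (hodge_cst R k * \det (Lmx u)) * hodgeA e A u (fun j => w j *m Lmx u).
Proof.
have h0 := hodge_cst_neq0 R k; have d0 := Lmx_det u.
rewrite /hodgeA /dualA [RHS]mulrA.
have -> : dual_cst R k l / (hodge_cst R k * \det (Lmx u)) * hodge_cst R k =
          dual_cst R k l / \det (Lmx u) by field; rewrite d0 h0.
rewrite -mulrA; congr (_ * _); rewrite /scaled_star /star mulr_sumr.
apply: eq_bigr => J _.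
have -> : \prod_a Phi u ord0 (J a) = (\prod_a u ord0 (J a)) * \prod_a u ord0 (J a).
  by rewrite -big_split; apply: eq_bigr => a _; rewrite mxE expr2.
have [p0|p0] := eqVneq (\prod_a u ord0 (J a)) 0; first by rewrite p0 !mul0r mulr0.
have ua a : u ord0 (J a) != 0.
  by apply/negP => /eqP ua; case/eqP: p0; rewrite (bigD1 a) //= ua mul0r.
have := vol_join_mul e (M := Lmx u) (J := J) (c := fun a => (u ord0 (J a))^-1) w.
rewrite prodfV => H.
have {}H : (\prod_a u ord0 (J a))^-1 * vol (join e (eps \o J) (fun j => w j *m Lmx u)) =
   vol (join e (eps \o J) w) * \det (Lmx u).
  apply: H => a; apply/rowP => j; rewrite Lmx_row [RHS]mxE big1 => [|i ui].
    rewrite mul0r addr0 basis_vecE; case: (altP (J a =P j)) => [<-|_].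
      by rewrite (negbTE (ua a)) mulrC.
    by rewrite mul0r mulr0 if_same.
  by rewrite basis_vecE; case: eqP => // E1; rewrite -E1 (negbTE (ua a)) in ui.
have -> : vol (join e (eps \o J) w) = (\prod_a u ord0 (J a))^-1 *
    vol (join e (eps \o J) (fun j => w j *m Lmx u)) / \det (Lmx u).
  by rewrite H mulfK.
by field; rewrite d0 p0.
Qed.

Lemma addSn_subn k : (k <= n)%N -> (k.+1 + (n - k))%N = n.+1.
Proof. by move=> hk; rewrite addSn subnKC. Qed.

Section Star.
Variables (hn : (1 <= n)%N) (k : nat) (hk : (k <= n)%N).

Let ek := addSn_subn hk.

Lemma hodge_isE (A : dform R n k) : (forall x, alt (A x)) ->
  is_hodge (Phi_pull (restr_form T A)) (restr_form S (hodgeA ek A)).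
Proof.
move=> Aa; split; first by exists (hodgeA ek A) => // x; apply: hodgeA_alt.
move=> u f uS of_; have [t _ _] := of_.
rewrite restr_val // => [|j]; last by apply: t; have := ltn_ord j; lia.
rewrite hodgeA_frame // Phi_pull_at // => j.
by apply: t; have := ltn_ord j; lia.
Qed.

Lemma hodge_PhiE (A : dform R n k) : (forall x, alt (A x)) ->
  hodge (Phi_pull (restr_form T A)) = restr_form S (hodgeA ek A).
Proof. by move=> Aa; apply: (hodgeE hn hk); apply: hodge_isE. Qed.

Lemma Phi_pull_dualA (A : dform R n k) : (forall x, alt (A x)) ->
  Phi_pull (restr_form T (dualA ek A)) = uN_hodge (Phi_pull (restr_form T A)).
Proof.
move=> Aa; rewrite /uN_hodge hodge_PhiE // Phi_pullE.
apply/funext => u; apply/funext => v; rewrite -[RHS]/(uN u * restr_form S (hodgeA ek A) u v).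
have [[uS tv]|no] := pselect (points S u /\ forall j, tangent S u (v j)); last first.
  by rewrite !restr_out // mulr0.
by rewrite !restr_val // dualA_Phi.
Qed.

Lemma dual_mapE (A : dform R n k) : Lambda_amb A ->
  dual_map k (restr_form T A) = restr_form T (dualA ek A).
Proof.
move=> LA; apply: Phi_pull_invE; last by apply: Phi_pull_dualA; case: LA.
by exists (dualA ek A) => //; apply: dualA_Lambda.
Qed.

Lemma dual_map_Lambda (a : dform R n k) : Lambda T k a ->
  Lambda T (n - k) (dual_map k a) /\ Phi_pull (dual_map k a) = uN_hodge (Phi_pull a).
Proof.
move=> [A LA <-]; rewrite dual_mapE //; split; last by apply: Phi_pull_dualA; case: LA.
by exists (dualA ek A) => //; apply: dualA_Lambda.
Qed.

Lemma dual_map_lin c (a b : dform R n k) : Lambda T k a -> Lambda T k b ->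
  dual_map k (c *: a + b) = c *: dual_map k a + dual_map k b.
Proof.
move=> [A LA <-] [B LB <-]; rewrite -restr_lin !dual_mapE //; last exact: Lambda_amb_lin.
by rewrite dualA_lin restr_lin.
Qed.

Lemma hodge_Phi_lin c (a b : dform R n k) : Lambda T k a -> Lambda T k b ->
  hodge (Phi_pull (c *: a + b)) = c *: hodge (Phi_pull a) + hodge (Phi_pull b).
Proof.
move=> [A [Aa _] <-] [B [Ba _] <-]; rewrite -restr_lin !hodge_PhiE //; last exact: alt_form_lin.
by rewrite hodgeA_lin restr_lin.
Qed.

(** The hypothesis compares Hodge stars because these are all that the map from odd forms sees. Over
    the boundary u_N = 0, so the conclusion comes from [dualA_hodgeA]. *)
Lemma dual_map_at (a a' : dform R n k) u : Lambda T k a -> Lambda T k a' ->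
  points S u -> hodge (Phi_pull a) u = hodge (Phi_pull a') u ->
  dual_map k a (Phi u) = dual_map k a' (Phi u).
Proof.
move=> [A LA <-] [B LB <-] uS.
rewrite !dual_mapE // !hodge_PhiE; try by case: LA; case: LB.
move=> H; apply/funext => w.
have [[xT tw]|no] := pselect (points T (Phi u) /\ forall j, tangent T (Phi u) (w j)); last first.
  by rewrite !restr_out.
rewrite !restr_val // !dualA_hodgeA; congr (_ * _).
have tL j : tangent S u (w j *m Lmx u) by apply: Lmx_tangent (tw j).
by have := congr1 (@^~ (fun j => w j *m Lmx u)) H; rewrite /= !restr_val.
Qed.

Lemma hodge_Phi_at (a a' : dform R n k) u : Lambda T k a -> Lambda T k a' ->
  Phi_pull a u = Phi_pull a' u -> hodge (Phi_pull a) u = hodge (Phi_pull a') u.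
Proof.
move=> [A [Aa _] <-] [B [Ba _] <-] H.
have hA := hodge_isE Aa; have hB := hodge_isE Ba.
by rewrite (hodgeE hn hk hA) (hodgeE hn hk hB); apply: (is_hodge_at hn hk hA hB).
Qed.

Lemma Phi_pull_at_eq (a a' : dform R n k) u : a (Phi u) = a' (Phi u) ->
  Phi_pull a u = Phi_pull a' u.
Proof. by move=> H; apply/funext => v; rewrite /Phi_pull /pullback /restr_form H. Qed.

Lemma dual_map_pointwise : pointwise_defined same_pt (Lambda T k) (dual_map k).
Proof.
move=> a a' x y La La' [xT ->] H; have [uS ux] := sqrt_point xT.
rewrite -ux; apply: dual_map_at => //; apply: hodge_Phi_at => //.
by apply: Phi_pull_at_eq; rewrite ux.
Qed.

Lemma hodge_Phi_inj_at (a b : dform R n k) u : Lambda T k a -> Lambda T k b ->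
  hodge (Phi_pull a) u = hodge (Phi_pull b) u -> Phi_pull a u = Phi_pull b u.
Proof.
move=> [A [Aa _] <-] [B [Ba _] <-].
have hA := hodge_isE Aa; have hB := hodge_isE Ba.
rewrite (hodgeE hn hk hA) (hodgeE hn hk hB) => H.
rewrite !Phi_pullE in hA hB *; apply: (is_hodge_inj_at hn hk _ _ hA hB H) => x;
  by apply: alt_lin => // c y z; apply: Du_lin.
Qed.

Lemma hodge_Phi_inj (a b : dform R n k) : Lambda T k a -> Lambda T k b ->
  hodge (Phi_pull a) = hodge (Phi_pull b) -> a = b.
Proof.
move=> La Lb H; apply: Phi_pull_injL => //; apply/funext => u.
by apply: hodge_Phi_inj_at => //; rewrite H.
Qed.

Lemma dual_map_inj (a b : dform R n k) : Lambda T k a -> Lambda T k b ->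
  dual_map k a = dual_map k b -> a = b.
Proof.
move=> La Lb H; have [_ Ea] := dual_map_Lambda La; have [_ Eb] := dual_map_Lambda Lb.
have {Ea Eb}H : uN_hodge (Phi_pull a) = uN_hodge (Phi_pull b) by rewrite -Ea -Eb H.
(* u_N can be cancelled off the coordinate hyperplanes only; [Phi_pull_inj] asks for no more. *)
have key (u : E) : (forall i, u ord0 i != 0) -> Phi_pull a u = Phi_pull b u.
  move=> u0; apply: hodge_Phi_inj_at => //.
  have uN0 : uN u != 0 by apply/prodf_neq0 => i _; apply: u0.
  apply/funext => v; apply: (mulfI uN0).
  by have := congr1 (fun f => f u v) H.
case: La Lb key => [A LA <-] [B LB <-] key.
by apply: Phi_pull_inj => // u _ /key.
Qed.

End Star.

(** On the facet x_i = 0, a term whose [J] contains i has the factor x_i, and in any other term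
    column i of the determinant is zero. *)
Lemma dualA_boundary k l (e : (k.+1 + l)%N = n.+1) (A : dform R n k) :
  zero_on_boundary (restr_form T (dualA e A)).
Proof.
move=> i x w xT xi tw; rewrite restr_val //; last by move=> j; case: (tw j).
rewrite /dualA /scaled_star /star big1 ?mulr0 // => J _.
have [[a Ja]|no] := pselect (exists a, J a = i).
  by rewrite (bigD1 a) //= Ja xi !mul0r.
rewrite (@vol_col0 _ _ _ i) ?mulr0 // => b; case: (joinP e b) => -[c ->].
  rewrite join_il /= basis_vecE; case: eqP => // E1; case: no; by exists c.
by rewrite join_ir; case: (tw c).
Qed.

(** One statement for both geometries: [phi] = (1, ..., 1) and [u] = [x] on the simplex, [phi] = [u]
    and [x] = Phi u on the sphere. *)
Lemma scaled_star_iX k l (e : (k.+1 + l)%N = n.+1) (D : dform R n k.+1) (phi u x : E) w :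
  alt (D x) -> (forall i, x ord0 i = phi ord0 i * u ord0 i) -> dotp phi u = 1 ->
  (forall j, dotp phi (w j) = 0) ->
  k.+1%:R * scaled_star e (iX D) u x w =
  star e (fun J => (\prod_a u ord0 (J a)) * D x (eps \o J)) w.
Proof.
move=> Da xE pu pw; rewrite -[RHS]mul1r -[X in _ = X * _]pu.
rewrite (@star_contract R n k l e (fun J => (\prod_a u ord0 (J a)) * D x (eps \o J)) phi u w) //; last first.
  move=> J i j ij; rewrite -[eps \o (J \o _)]/((eps \o J) \o _) Da.2 // mulrN; congr (- (_ * _)).
  by rewrite [RHS](reindex_inj (@perm_inj _ (tperm i j))).
congr (_ * _); apply: eq_bigr => J _; congr (_ * _).
rewrite iX_expand // mulr_sumr mulr_sumr; apply: eq_bigr => i _.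
rewrite big_ord_recl [in RHS]big_ord_recl upd_same xE.
have -> : \prod_(i0 < k) u ord0 (upd J ord0 i (lift ord0 i0)) =
          \prod_(i0 < k) u ord0 (J (lift ord0 i0)).
  by apply: eq_bigr => a _; rewrite upd_diff // eq_sym neq_lift.
rewrite upd0E comp_consv; ring.
Qed.

End DualMap.

(** * Polynomial forms *)

Section PolynomialForms.
Local Open Scope classical_set_scope.
Variables (R : realType) (n : nat).
Notation E := 'rV[R]_n.+1.
Notation eps := (@basis_vec R n).
Notation alt := (@Defs.alternating R n _).
Notation T := (simplex R n).
Notation S := (sphere R n).

Lemma det_alt k (f : 'I_k -> 'I_n.+1) :
  alt (fun v : 'I_k -> E => \det (\matrix_(i, j) v i ord0 (f j))).
Proof.
split=> [v j c y z|v i j ij]; last first.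
  have -> : \matrix_(a, c) (v \o tperm i j) a ord0 (f c) =
            row_perm (tperm i j) (\matrix_(a, c) v a ord0 (f c)).
    by apply/matrixP => a c; rewrite !mxE.
  by rewrite row_permE det_mulmx det_perm odd_tperm ij expr1 mulN1r.
rewrite -[\det (\matrix_(a, b) [eta v with j |-> z] a ord0 (f b))]mul1r.
apply: (@determinant_multilinear _ _ _ _ _ j).
- by apply/rowP => a; rewrite !mxE /= eqxx !mxE; ring.
- by apply/matrixP => a d; rewrite !mxE /= eq_sym (negbTE (neq_lift _ _)).
- by apply/matrixP => a d; rewrite !mxE /= eq_sym (negbTE (neq_lift _ _)).
Qed.

(* Antisymmetrization by the determinant makes [altc q] alternating for every [q];
   by [alt_det] it is [k!] times the form with coefficients [q] if there is one. *)
Definition altc k (q : ('I_k -> 'I_n.+1) -> E -> R) : dform R n k :=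
  fun x v => \sum_(f : {ffun 'I_k -> 'I_n.+1}) q f x * \det (\matrix_(i, j) v i ord0 (f j)).

Lemma altc_P_amb r k (q : ('I_k -> 'I_n.+1) -> E -> R) :
  (forall f, is_poly r (q f)) -> P_amb r (altc q).
Proof.
move=> qr; split=> [x|f]; first by apply: alt_sum => g; apply: det_alt.
by apply: is_poly_sum => g _; apply: is_polyZr.
Qed.

Definition scl (u v : E) : E := \row_i (u ord0 i * v ord0 i).

Lemma scl_basis u i : scl u (eps i) = u ord0 i *: eps i.
Proof.
apply/rowP => j; rewrite /scl mxE [RHS]mxE !basis_vecE.
by case: (altP (i =P j)) => [->|_]; rewrite /= ?mulr1 // !mulr0.
Qed.

(** [q f] is tied to [b] only through its product with u_f. Scaling the arguments by [u] scales
    column j of the minor by u_(f j), which supplies this product without a division. *)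
Lemma altc_scaled k (q : ('I_k -> 'I_n.+1) -> E -> R) (x u : E) (b : ('I_k -> E) -> R) (v : 'I_k -> E) :
  alt b -> (forall f, (\prod_a u ord0 (f a)) * q f x = b (eps \o f)) ->
  altc q x (scl u \o v) = k`!%:R * b v.
Proof.
move=> ba H; rewrite -alt_det //; apply: eq_bigr => f _; rewrite -H.
have -> : \matrix_(i, j) (scl u \o v) i ord0 (f j) =
    (\matrix_(i, j) v i ord0 (f j)) *m diag_mx (\row_j u ord0 (f j)).
  by apply/matrixP => i j; rewrite mul_mx_diag !mxE mulrC.
rewrite det_mulmx det_diag.
have -> : \prod_i (\row_j u ord0 (f j)) ord0 i = \prod_a u ord0 (f a).
  by apply: eq_bigr => a _; rewrite mxE.
ring.
Qed.

Lemma altc_coef k (q : ('I_k -> 'I_n.+1) -> E -> R) (x u : E) (b : ('I_k -> E) -> R) (f : 'I_k -> 'I_n.+1) :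
  alt b -> (forall f, (\prod_a u ord0 (f a)) * q f x = b (eps \o f)) ->
  (\prod_a u ord0 (f a)) * altc q x (eps \o f) = k`!%:R * b (eps \o f).
Proof.
move=> ba H; rewrite -(altc_scaled _ ba H).
have qa : alt (altc q x) by apply: alt_sum => g; apply: det_alt.
rewrite -(ml_scale _ _ (alt_ml qa)); congr altc.
by apply/funext => a; rewrite /= scl_basis.
Qed.

Lemma star_P_amb k l (e : (k + l)%N = n.+1) r (y : ('I_k -> 'I_n.+1) -> E -> R) :
  (forall J, is_poly r (y J)) -> P_amb r (fun x w => star e (fun J => y J x) w : R^o).
Proof.
move=> yr; split=> [x|f]; first exact: star_alt.
by apply: is_poly_sum => J _; apply: is_polyZr.
Qed.

(** Serves to make the J_0-slot, which carries the vector x, the first argument of an (l+1)-form.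
    Moving a vector across the blocks permutes the rows, so [s] is a sign. *)
Lemma vol_shift k l (e : (k.+1 + l)%N = n.+1) (e' : (k + l.+1)%N = n.+1) :
  exists2 s : R, s != 0 & forall z w x,
    vol (join e (consv x z) w) = s * vol (join e' z (consv x w)).
Proof.
pose t := join e (consv (ir e' ord0) (il e')) (ir e' \o lift ord0).
have ti : injective t.
  apply: join_injP.
  - by apply: inj_comp; [apply: ir_inj | apply: lift_inj].
  - move=> a c; rewrite /consv; case: (unliftP ord0 a) => [b|] _ /=; first by rewrite il_neq_ir.
    by rewrite (inj_eq (@ir_inj _ _ _ e')) neq_lift.
  - move=> a b; rewrite /consv; case: (unliftP ord0 a) => [a'|] ->; case: (unliftP ord0 b) => [b'|] -> //.
    + by move/il_inj ->.
    + by move=> /eqP; rewrite il_neq_ir.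
    + by move=> /eqP; rewrite ir_neq_il.
exists ((-1) ^+ perm ti); first by rewrite signr_eq0.
move=> z w x; rewrite -(alt_perm (perm ti) _ (vol_alt R n)); congr vol.
have -> : join e' z (consv x w) \o perm ti = join e' z (consv x w) \o t.
  by apply/funext => i; rewrite /= permE.
rewrite /t comp_join comp_consv; congr (join e (consv _ _) _).
- by rewrite join_ir consv0.
- by apply/funext => a; rewrite /= join_il.
- by apply/funext => a; rewrite /= join_ir consvS.
Qed.

Lemma dualA_Pminus r k l (e : (k.+1 + l)%N = n.+1) (A : dform R n k) :
  P_amb r A -> Pminus_amb (r + k%:Z + 1) (dualA e A).
Proof.
move=> [Aa As]; have e' : (k + l.+1)%N = n.+1 by rewrite addnS.
have [s s0 H] := vol_shift e e'.
exists (fun (x : E) (V : 'I_l.+1 -> E) => star e' (fun f => dual_cst R k l * s * ((\prod_a x ord0 (f a)) * coef A f x)) V).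
  rewrite addrK; apply: star_P_amb => f; apply: is_polyZ.
  by have := is_polyM (is_poly_prod R f) (As f); rewrite addrC.
apply/funext => x; apply/funext => w; rewrite iXE /dualA /scaled_star /star mulr_sumr.
have vE (f : {ffun 'I_k -> 'I_n.+1}) : vol (join e (consv x (eps \o f)) w) =
    \sum_i x ord0 i * vol (join e (eps \o consv i f) w).
  rewrite -(consv_upd0 0) {1}(row_basis x) (ml_sum (alt_ml (voll_alt e w))).
  by apply: eq_bigr => i _; rewrite consv_upd0 comp_consv.
rewrite (sum_ffun_cons (fun J => dual_cst R k l * ((\prod_a x ord0 (J a)) *
   A x (eps \o (J \o lift ord0)) * vol (join e (eps \o J) w)))) exchange_big /=.
apply: eq_bigr => f _.
have -> : dual_cst R k l * s * ((\prod_a x ord0 (f a)) * coef A f x) *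
  vol (join e' (eps \o f) (consv x w)) =
  dual_cst R k l * ((\prod_a x ord0 (f a)) * coef A f x) * vol (join e (consv x (eps \o f)) w).
  by rewrite H; ring.
rewrite vE mulr_sumr; apply: eq_bigr => i _.
rewrite consv_lift big_ord_recl consv0.
have -> : \prod_(a < k) x ord0 (consv i f (lift ord0 a)) = \prod_a x ord0 (f a).
  by apply: eq_bigr => a _; rewrite consvS.
rewrite /coef; ring.
Qed.

Lemma natS_neq0 k : k.+1%:R != 0 :> R. Proof. by rewrite pnatr_eq0. Qed.

Lemma fact_neq0 k : k`!%:R != 0 :> R. Proof. by rewrite pnatr_eq0 -lt0n fact_gt0. Qed.

Lemma dualA_iX k l (e : (k.+1 + l)%N = n.+1) (D : dform R n k.+1) x w :
  alt (D x) -> points T x -> (forall j, tangent T x (w j)) ->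
  dualA e (iX D) x w = dual_cst R k l / k.+1%:R *
    star e (fun J => (\prod_a x ord0 (J a)) * D x (eps \o J)) w.
Proof.
move=> Da [_ x1] tw; have dot1 (y : E) : dotp (const_mx 1) y = \sum_i y ord0 i.
  by apply: eq_bigr => i _; rewrite mxE mul1r.
rewrite -(scaled_star_iX e (phi := const_mx 1)) //.
- by rewrite /dualA mulrA divfK ?natS_neq0.
- by move=> i; rewrite mxE mul1r.
- by rewrite dot1.
- by move=> j; rewrite dot1; apply: tw.
Qed.

Lemma hodgeA_iX k l (e : (k.+1 + l)%N = n.+1) (D : dform R n k.+1) u w :
  alt (D (Phi u)) -> points S u -> (forall j, tangent S u (w j)) ->
  hodgeA e (iX D) u w = hodge_cst R k / k.+1%:R *
    star e (fun J => (\prod_a u ord0 (J a)) * D (Phi u) (eps \o J)) w.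
Proof.
move=> Da uS tw; rewrite -(scaled_star_iX e (phi := u)) //.
- by rewrite /hodgeA mulrA divfK ?natS_neq0.
- by move=> i; rewrite mxE expr2.
Qed.

Lemma dualA_iX_P r k l (e : (k.+1 + l)%N = n.+1) (D : dform R n k.+1) :
  P_amb (r - 1) D -> P_ (r + k%:Z) l T (restr_form T (dualA e (iX D))).
Proof.
move=> [Da Ds].
exists (fun (x : E) (w : 'I_l -> E) => star e (fun J => dual_cst R k l / k.+1%:R * ((\prod_a x ord0 (J a)) * coef D J x)) w).
  apply: star_P_amb => J; apply: is_polyZ.
  have := is_polyM (is_poly_prod R J) (Ds J).
  by have -> : k.+1%:Z + (r - 1) = r + k%:Z by lia.
by apply/restr_eqP => x w xT tw; rewrite dualA_iX // star_scale.
Qed.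

Lemma Phi_pull_even r k (A : dform R n k) :
  P_amb r A -> P_even (2 * r + k%:Z) k (Phi_pull (restr_form T A)).
Proof.
move=> [Aa As]; rewrite Phi_pullE; split.
  exists (fun u v => A (Phi u) (Du u \o v)) => //; split=> [u|f].
    by apply: alt_lin => //; apply: Du_lin.
  apply: (@is_poly_eq _ _ _ (fun u => coef A f (Phi u) * (2 ^+ k * \prod_a u ord0 (f a)))).
    move=> u; rewrite /coef -[fun j => basis_vec R (f j)]/(eps \o f) Du_coef //; ring.
  by apply: is_polyM; [apply: is_poly_Phi; apply: As | apply: is_polyZ; apply: is_poly_prod].
move=> i; rewrite /pullback; apply/restr_eqP => u v uS tv.
have sg j : reflection i u ord0 j ^+ 2 = u ord0 j ^+ 2.
  by rewrite reflection_signE mxE exprMn sqrr_sign mul1r.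
have PhiR : Phi (reflection i u) = Phi u by apply/rowP => j; rewrite !mxE -sg mxE.
rewrite restr_val; first last.
- move=> j; rewrite diff_reflection /= -[RHS](tv j); apply: eq_bigr => a _.
  by rewrite !reflection_signE !mxE mulrACA -expr2 sqrr_sign mul1r.
- by rewrite /= -[RHS]uS; apply: eq_bigr => a _; rewrite -!expr2 sg.
rewrite PhiR; congr (A _ _); apply/funext => j; apply/rowP => a.
rewrite /= diff_reflection !reflection_signE !mxE.
have ss : (-1) ^+ (a == i) * (-1) ^+ (a == i) = 1 :> R by rewrite -expr2 sqrr_sign.
transitivity (2 * u ord0 a * v j ord0 a * ((-1) ^+ (a == i) * (-1) ^+ (a == i))).
  by ring.
by rewrite ss mulr1.
Qed.

End PolynomialForms.

(** * Even and odd polynomial forms on the sphere *)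

Section Parity.
Local Open Scope classical_set_scope.
Variables (R : realType) (n : nat).
Notation E := 'rV[R]_n.+1.
Notation eps := (@basis_vec R n).
Notation alt := (@Defs.alternating R n _).
Notation T := (simplex R n).
Notation S := (sphere R n).

Lemma reflection_mx i (u : E) : reflection i u = u *m diag_mx (\row_j (-1) ^+ (j == i)).
Proof. by apply/rowP => j; rewrite reflection_signE mul_mx_diag !mxE mulrC. Qed.

Lemma reflection_dotp i (u v : E) : dotp (reflection i u) (reflection i v) = dotp u v.
Proof.
apply: eq_bigr => a _; rewrite !reflection_signE !mxE.
by rewrite mulrACA -expr2 sqrr_sign mul1r.
Qed.

Lemma Phi_reflection i (u : E) : Phi (reflection i u) = Phi u.
Proof.
by apply/rowP => j; rewrite /Phi mxE [RHS]mxE reflection_signE mxE exprMn sqrr_sign mul1r.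
Qed.

Lemma pullback_reflection k (a : dform R n k) i u v :
  points S u -> (forall j, tangent S u (v j)) ->
  pullback S (reflection i) (restr_form S a) u v = a (reflection i u) (reflection i \o v).
Proof.
move=> uS tv; rewrite /pullback restr_val // restr_val; first last.
- by move=> j; rewrite diff_reflection /= reflection_dotp; apply: tv.
- by rewrite /= reflection_dotp.
by congr (a _ _); apply/funext => j; rewrite diff_reflection.
Qed.

(** The minus sign is the determinant of the reflection; the signs on the [J]-slots cancel against
    those of the weights. *)
Lemma hodgeA_reflection k l (e : (k.+1 + l)%N = n.+1) (A : dform R n k) i u w :
  hodgeA e A (reflection i u) (reflection i \o w) = - hodgeA e A u w.
Proof.
rewrite /hodgeA /scaled_star /star Phi_reflection -mulrN -sumrN; congr (_ * _).
apply: eq_bigr => J _.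
have := vol_join_mul e (M := diag_mx (\row_j (-1) ^+ (j == i))) (J := J)
  (c := fun a => (-1) ^+ (J a == i)) w.
rewrite det_diag => H.
have {}H : (\prod_a (-1) ^+ (J a == i)) * vol (join e (eps \o J) (reflection i \o w)) =
           - vol (join e (eps \o J) w).
  rewrite (_ : reflection i \o w =
    (fun j => w j *m diag_mx (\row_j (-1) ^+ (j == i)))); last first.
    by apply/funext => j; rewrite /= reflection_mx.
  rewrite H => [|a]; last first.
    apply/rowP => j; rewrite mul_mx_diag mxE [RHS]mxE basis_vecE !mxE.
    by case: (altP (J a =P j)) => [->|_]; rewrite ?mul1r ?mulr1 // mul0r mulr0.
  rewrite (bigD1 i) //= mxE eqxx big1 ?mulr1 ?expr1 ?mulrN1 // => j ji.
  by rewrite mxE (negbTE ji).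
have -> : \prod_a reflection i u ord0 (J a) =
    (\prod_a (-1) ^+ (J a == i)) * \prod_a u ord0 (J a).
  by rewrite -big_split; apply: eq_bigr => a _; rewrite reflection_signE mxE.
rewrite -mulrN -H; ring.
Qed.

Lemma hodgeA_iX_odd r k l (e : (k.+1 + l)%N = n.+1) (D : dform R n k.+1) :
  P_amb (r - 1) D -> P_odd (2 * r + k%:Z - 1) l (restr_form S (hodgeA e (iX D))).
Proof.
move=> [Da Ds]; split.
  exists (fun (u : E) (w : 'I_l -> E) =>
    star e (fun J => hodge_cst R k / k.+1%:R * ((\prod_a u ord0 (J a)) * coef D J (Phi u))) w).
    apply: star_P_amb => J; apply: is_polyZ.
    have := is_polyM (is_poly_prod R J) (is_poly_Phi (Ds J)).
    by have -> : k.+1%:Z + 2 * (r - 1) = 2 * r + k%:Z - 1 by lia.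
  by apply/restr_eqP => x w xT tw; rewrite hodgeA_iX // star_scale.
move=> i; apply/funext => u; apply/funext => v.
rewrite -[RHS]/(- (restr_form S (hodgeA e (iX D)) u v)).
have [[uS tv]|no] := pselect (points S u /\ forall j, tangent S u (v j)); last first.
  by rewrite /pullback !restr_out // oppr0.
by rewrite pullback_reflection // restr_val // hodgeA_reflection.
Qed.

Lemma signv_lin s c (y z : E) : signv s (c *: y + z) = c *: signv s y + signv s z.
Proof. by apply/rowP => i; rewrite !mxE; ring. Qed.

Lemma signv_basis s i : signv s (eps i) = (-1) ^+ s i *: eps i.
Proof.
apply/rowP => j; rewrite /signv mxE [RHS]mxE !basis_vecE.
by case: (altP (i =P j)) => [->|_]; rewrite /= ?mulr1 // !mulr0.
Qed.

(** [eta] is 1 for even and -1 for odd forms. The induction is on the number of sign changes in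
    [s]. *)
Lemma sign_equivariant k (B : dform R n k) (eta : R) :
  (forall i, pullback S (reflection i) (restr_form S B) = eta *: restr_form S B) ->
  forall s u v, points S u -> (forall j, tangent S u (v j)) ->
  B (signv s u) (signv s \o v) = (\prod_i eta ^+ s i) * B u v.
Proof.
move=> H s; move: {-1}#|[pred i | s i]| (erefl #|[pred i | s i]|) => N.
elim: N s => [|N IH] s cs u v uS tv.
  have s0 i : s i = false := card0_eq cs i.
  rewrite big1 ?mul1r => [|i _]; last by rewrite s0.
  have sid x : signv s x = x by apply/rowP => j; rewrite mxE s0 mul1r.
  by rewrite sid; congr (B _ _); apply/funext => j; rewrite /= sid.
have [i si] : exists i, s i.
  by have /card_gt0P[i si] : (0 < #|[pred i | s i]|)%N by [rewrite cs]; exists i.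
pose s' : {ffun 'I_n.+1 -> bool} := finfun (upd s i false).
have s'i : s' i = false by rewrite ffunE upd_same.
have s'j j : j != i -> s' j = s j by move=> ji; rewrite ffunE upd_diff.
have cs' : #|[pred i | s' i]| = N.
  have := cardD1 i [pred i | s i]; rewrite cs inE si add1n => -[->].
  apply: eq_card => j; rewrite !inE; case: (altP (j =P i)) => [->|ji]; first by rewrite s'i.
  by rewrite s'j.
have sE x : signv s x = signv s' (reflection i x).
  apply/rowP => j; rewrite mxE [RHS]mxE reflection_signE mxE.
  case: (altP (j =P i)) => [->|ji]; first by rewrite s'i si expr0 mul1r expr1.
  by rewrite s'j // expr0 mul1r.
have -> : signv s \o v = signv s' \o (reflection i \o v) by apply/funext => j; rewrite /= sE.
rewrite sE IH //; first last.
- by move=> j; rewrite /= reflection_dotp; apply: tv.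
- by rewrite /= reflection_dotp.
rewrite -(pullback_reflection B i uS tv) H -[(_ *: _) u v]/(eta * restr_form S B u v) restr_val //.
rewrite mulrA; congr (_ * _); rewrite [RHS](bigD1 i) //= si expr1 mulrC.
rewrite (bigD1 i) //= s'i mul1r; congr (_ * _).
by apply: eq_bigr => j ji; rewrite s'j.
Qed.

(** Only the restriction of [B] to the sphere is known to be even or odd. The average has this
    parity on all of R^{n+1}, so that its coefficients can be treated monomial by monomial. *)
Definition sign_avg k (eta : R) (B : dform R n k) : dform R n k := fun u v =>
  \sum_(s : {ffun 'I_n.+1 -> bool}) (\prod_i eta ^+ s i) * B (signv s u) (signv s \o v).

Lemma sign_avg_alt k eta (B : dform R n k) u : (forall x, alt (B x)) -> alt (sign_avg eta B u).
Proof. by move=> Ba; apply: alt_sum => s; apply: alt_lin => //; apply: signv_lin. Qed.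

Lemma sign_avgE k eta (B : dform R n k) u v : eta * eta = 1 ->
  (forall i, pullback S (reflection i) (restr_form S B) = eta *: restr_form S B) ->
  points S u -> (forall j, tangent S u (v j)) ->
  sign_avg eta B u v = 2 ^+ n.+1 * B u v.
Proof.
move=> ee H uS tv; rewrite /sign_avg (eq_bigr (fun=> B u v)) => [|s _].
  by rewrite sumr_const card_ffun card_bool card_ord -natrX mulr_natl.
rewrite (sign_equivariant H) // mulrA -big_split big1 ?mul1r // => i _ /=.
by rewrite -exprMn ee expr1n.
Qed.

Lemma signv_coef k (B : dform R n k) s u (f : 'I_k -> 'I_n.+1) : alt (B u) ->
  B u (signv s \o (eps \o f)) = (\prod_a (-1) ^+ s (f a)) * coef B f u.
Proof.
move=> Ba; rewrite -[coef B f u]/(B u (eps \o f)) -(ml_scale _ _ (alt_ml Ba)).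
by congr (B u _); apply/funext => a; rewrite /= signv_basis.
Qed.

Lemma even_surj r k (b : dform R n k) : P_even (2 * r + k%:Z) k b ->
  exists2 a, P_ r k T a & Phi_pull a = b.
Proof.
move=> [[B [Ba Bs] <-] ev].
have H i : pullback S (reflection i) (restr_form S B) = 1 *: restr_form S B.
  by rewrite scale1r; apply: ev.
have p2 m : (2 ^+ m : R) != 0 by rewrite expf_neq0 ?pnatr_eq0.
have Aa u := @sign_avg_alt k 1 B u Ba.
have ex (f : 'I_k -> 'I_n.+1) : exists q : E -> R, is_poly r q /\
    forall u, sign_avg 1 B u (eps \o f) = 2 ^+ n.+1 * ((\prod_a u ord0 (f a)) * q (Phi u)).
  have [fi|fn] := pselect (injective f); last first.
    by exists (fun=> 0); split=> [|u]; [apply: is_poly0 | rewrite !mulr0 alt_noninj].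
  have [|q [qr qE]] := is_poly_parity fi (Bs f) (r := r); first by lia.
  exists q; split=> // u; rewrite -qE; apply: eq_bigr => s _.
  by rewrite signv_coef // big1 ?mul1r // => i _; rewrite expr1n.
have [q qP] := choice ex.
have qr f : is_poly r (q f) by case: (qP f).
(* 2^k is the ratio between [Du] and [scl] on k arguments, and k! comes from [altc]. *)
pose c : R := 2 ^+ k * k`!%:R.
have c0 : c != 0 by rewrite mulf_neq0 ?fact_neq0.
exists (restr_form T (c^-1 *: altc q)).
  by exists (c^-1 *: altc q) => //; apply/P_amb_scale/altc_P_amb.
rewrite Phi_pullE; apply/restr_eqP => u v uS tv.
rewrite -[(c^-1 *: altc q) _ _]/(c^-1 * altc q (Phi u) (Du u \o v)).
have qa : alt (altc q (Phi u)) by case: (altc_P_amb qr).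
have -> : altc q (Phi u) (Du u \o v) = 2 ^+ k * altc q (Phi u) (scl u \o v).
  have := ml_scale (fun=> 2) (scl u \o v) (alt_ml qa).
  rewrite prodr_const card_ord => <-; congr altc.
  by apply/funext => j; apply/rowP => i; rewrite !mxE; ring.
rewrite (altc_scaled (b := fun v => (2 ^+ n.+1)^-1 * sign_avg 1 B u v)); first last.
- by move=> f; rewrite (qP f).2 mulKf.
- exact: alt_scale.
rewrite (sign_avgE _ H) ?mulr1 // mulKf // /c.
by field; rewrite fact_neq0 p2.
Qed.

(** For [eta] = -1 the weight of [s] is the determinant of the sign change. It trades the signs on
    the [g]-slots for those on the [J]-slots, which gives the dual coefficient the parity of u_J. *)
Lemma costar_sign_avg k l (e : (k.+1 + l)%N = n.+1) (B : dform R n l) u (J : 'I_k.+1 -> 'I_n.+1) :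
  (forall x, alt (B x)) ->
  costar e (sign_avg (-1) B u) (eps \o J) =
  \sum_(s : {ffun 'I_n.+1 -> bool}) (\prod_a (-1) ^+ s (J a)) *
    costar e (B (signv s u)) (eps \o J).
Proof.
move=> Ba; rewrite /costar.
under [RHS]eq_bigr => s _ do rewrite mulr_sumr.
rewrite [RHS]exchange_big /=; apply: eq_bigr => g _.
rewrite /sign_avg mulr_suml; apply: eq_bigr => s _.
rewrite signv_coef //.
have := vol_join_mul e (M := diag_mx (\row_j (-1) ^+ s j)) (J := J)
  (c := fun a => (-1) ^+ s (J a)) (eps \o g).
have epsM i : eps i *m diag_mx (\row_j (-1) ^+ s j) = (-1) ^+ s i *: eps i.
  apply/rowP => j; rewrite mul_mx_diag mxE [RHS]mxE basis_vecE !mxE.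
  by case: (altP (i =P j)) => [->|_]; rewrite ?mul1r ?mulr1 // mul0r mulr0.
move=> /(_ (fun a => epsM (J a))); rewrite det_diag.
have -> : (fun j => (eps \o g) j *m diag_mx (\row_j (-1) ^+ s j)) =
          (fun j => (-1) ^+ s (g j) *: (eps \o g) j).
  by apply/funext => j; rewrite /= epsM.
rewrite (ml_scale _ _ (alt_ml (volr_alt e _))).
have -> : \prod_i (\row_j (-1) ^+ s j : E) ord0 i = \prod_i (-1) ^+ s i.
  by apply: eq_bigr => i _; rewrite mxE.
have ss : (\prod_a ((-1) ^+ s (J a) : R)) * \prod_a (-1) ^+ s (J a) = 1.
  by rewrite -big_split big1 // => a _ /=; rewrite -expr2 sqrr_sign.
have gg : (\prod_a ((-1) ^+ s (g a) : R)) * \prod_a (-1) ^+ s (g a) = 1.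
  by rewrite -big_split big1 // => a _ /=; rewrite -expr2 sqrr_sign.
rewrite -[B (signv s u) (eps \o g)]/(coef B g (signv s u)).
set P := \prod_i (-1) ^+ s i; set PJ := \prod_(a < k.+1) _; set Pg := \prod_(a < l) _ => H.
transitivity (Pg * coef B g (signv s u) * (vol (join e (eps \o J) (eps \o g)) * P)).
  by ring.
rewrite -H; transitivity (PJ * (coef B g (signv s u) * vol (join e (eps \o J) (eps \o g))) * (Pg * Pg)).
  by ring.
by rewrite gg mulr1.
Qed.

Lemma odd_surj r k l (e : (k.+1 + l)%N = n.+1) (b : dform R n l) :
  P_odd (2 * r + k%:Z - 1) l b ->
  exists2 D, P_amb (r - 1) D & restr_form S (hodgeA e (iX D)) = b.
Proof.
move=> [[B [Ba Bs] <-] od].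
have H i : pullback S (reflection i) (restr_form S B) = (-1) *: restr_form S B.
  by rewrite scaleN1r; apply: od.
have p2 m : (2 ^+ m : R) != 0 by rewrite expf_neq0 ?pnatr_eq0.
have Aa u := @sign_avg_alt l (-1) B u Ba.
have ex (J : 'I_k.+1 -> 'I_n.+1) : exists q : E -> R, is_poly (r - 1) q /\
    forall u, costar e (sign_avg (-1) B u) (eps \o J) =
              2 ^+ n.+1 * ((\prod_a u ord0 (J a)) * q (Phi u)).
  have [Ji|Jn] := pselect (injective J); last first.
    exists (fun=> 0); split=> [|u]; first exact: is_poly0.
    by rewrite !mulr0 alt_noninj //; apply: costar_alt.
  have gs : is_poly (2 * r + k%:Z - 1) (fun x => costar e (B x) (eps \o J)).
    by apply: is_poly_sum => g _; apply: is_polyZr; apply: Bs.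
  have [|q [qr qE]] := is_poly_parity Ji gs (r := r - 1); first by lia.
  by exists q; split=> // u; rewrite -qE costar_sign_avg.
have [q qP] := choice ex.
have qr f : is_poly (r - 1) (q f) by case: (qP f).
(* The factors come from [hodgeA_iX], from [altc] and from the double star. *)
pose c : R := hodge_cst R k / k.+1%:R * (k.+1`!%:R * (k.+1`! * l`!)%:R).
have c0 : c != 0.
  by rewrite /c natrM !mulf_neq0 ?invr_eq0 ?fact_neq0 ?natS_neq0 ?hodge_cst_neq0.
have PD := altc_P_amb qr.
exists (c^-1 *: altc q); first exact: P_amb_scale.
have -> : iX (c^-1 *: altc q) = c^-1 *: iX (altc q) by [].
rewrite hodgeA_scale; apply/restr_eqP => u v uS tv.
rewrite -[(c^-1 *: hodgeA _ _) _ _]/(c^-1 * hodgeA e (iX (altc q)) u v).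
rewrite hodgeA_iX //; last by case: PD.
have -> : star e (fun J => (\prod_a u ord0 (J a)) * altc q (Phi u) (eps \o J)) v =
   k.+1`!%:R * (2 ^+ n.+1)^-1 * star e (fun J => costar e (sign_avg (-1) B u) (eps \o J)) v.
  rewrite -star_scale; congr (star e _ v); apply/funext => J.
  rewrite (altc_coef (b := fun v => (2 ^+ n.+1)^-1 * costar e (sign_avg (-1) B u) v)).
  - by rewrite mulrA.
  - by apply: alt_scale; apply: costar_alt.
  - by move=> f; rewrite (qP f).2 mulKf.
rewrite star_costar // (sign_avgE _ H) ?mulrNN ?mulr1 //.
transitivity (c^-1 * (c * ((2 ^+ n.+1)^-1 * (2 ^+ n.+1 * B u v)))); last by rewrite !mulKf.
by rewrite /c; ring.
Qed.

End Parity.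

(** * Surjectivity by division of monomials *)

Section Surjectivity.
Local Open Scope classical_set_scope.
Variables (R : realType) (n : nat).
Hypothesis hn : (1 <= n)%N.
Notation E := 'rV[R]_n.+1.
Notation eps := (@basis_vec R n).
Notation alt := (@Defs.alternating R n _).
Notation T := (simplex R n).
Notation mi := {ffun 'I_n.+1 -> nat}.
Variables (k l : nat) (e : (k.+1 + l)%N = n.+1).

Lemma contract_sub m (b : ('I_m -> E) -> R) (x : E) (t : 'I_m -> R) v : multilinear b ->
  (forall v j, b (upd v j x) = 0) -> b (fun j => v j - t j *: x) = b v.
Proof.
elim: m b t v => [|m IH] b t v bml bx; first by congr b; apply/funext => -[].
rewrite -(consv_eta (fun j => v j - t j *: x)) -(consv_upd0 0) mlD // mlN // mlZ // bx mulr0 subr0.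
rewrite consv_upd0 (IH (fun z => b (consv (v ord0) z)) (t \o lift ord0) (v \o lift ord0)).
- by rewrite consv_eta.
- exact: ml_consv.
- by move=> z j; rewrite -consv_updS.
Qed.

(** If [g] takes the value [J a], the determinant has a repeated row. *)
Lemma costar_eq0 (b : ('I_l -> E) -> R) (J : 'I_k.+1 -> 'I_n.+1) a :
  (forall g : 'I_l -> 'I_n.+1, (forall c, g c != J a) -> b (eps \o g) = 0) ->
  costar e b (eps \o J) = 0.
Proof.
move=> H; rewrite /costar big1 // => g _.
have [[c gc]|no] := pselect (exists c, g c = J a).
  rewrite vol_join_basis0 ?mulr0 // => inj.
  by have := il_neq_ir e a c; rewrite -(inj_eq inj) join_il join_ir gc eqxx.
by rewrite H ?mul0r // => c; apply/eqP => E1; apply: no; exists c.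
Qed.

Lemma iX_contract (C : dform R n l.+1) x v j : alt (C x) -> iX C x (upd v j x) = 0.
Proof.
move=> Ca; rewrite iXE; apply: (alt_eq0 (i := ord0) (j := lift ord0 j) Ca (neq_lift _ _)).
by rewrite consv0 consvS upd_same.
Qed.

(** The basis vectors are not tangent to the simplex, but subtracting x from each changes nothing,
    as the form is killed by x. Since sum x = 1 and x_i = 0, the vectors eps_(g c) - x are tangent
    to the facet. *)
Lemma iX_boundary (C : dform R n l.+1) x i (g : 'I_l -> 'I_n.+1) : alt (C x) ->
  zero_on_boundary (restr_form T (iX C)) -> points T x -> x ord0 i = 0 ->
  (forall c, g c != i) -> iX C x (eps \o g) = 0.
Proof.
move=> Ca zb xT xi gi.
have cm : multilinear (iX C x) by apply: ml_consv (alt_ml Ca).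
rewrite -(contract_sub (fun=> 1) _ cm (fun v j => iX_contract v j Ca)).
have tw j : tangent T x ((eps \o g) j - 1 *: x) /\ ((eps \o g) j - 1 *: x) ord0 i = 0.
  split; last by rewrite !mxE xi mulr0 subr0 eq_sym (negbTE (gi j)) andbF.
  rewrite /=; under eq_bigr do rewrite mxE [X in _ + X]mxE scale1r.
  rewrite big_split /= sumrN; case: xT => _ ->.
  rewrite (bigD1 (g j)) //= basis_vecE eqxx big1 ?addr0 ?subrr // => a ag.
  by rewrite basis_vecE eq_sym (negbTE ag).
by have := zb i x _ xT xi tw; rewrite restr_val // => j; case: (tw j).
Qed.

Lemma dual_surj_minus (r : int) (C : dform R n l.+1) :
  P_amb (r + k%:Z) C -> zero_on_boundary (restr_form T (iX C)) ->
  exists2 A, P_amb r A & restr_form T (dualA e A) = restr_form T (iX C).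
Proof.
move=> PC zb; have [Ca _] := PC.
have PB : P_amb (r + k%:Z + 1) (iX C).
  by apply: Pminus_amb_P; exists C => //; rewrite addrK.
have [Ba Bs] := PB.
have ex (f : 'I_k -> 'I_n.+1) : exists q : E -> R, is_poly r q /\
    forall x, points T x -> costar e (iX C x) (eps \o consv ord0 f) =
      x ord0 ord0 * ((\prod_a x ord0 (f a)) * q x).
  set J := consv ord0 f.
  have [Ji|Jn] := pselect (injective J); last first.
    exists (fun=> 0); split=> [|x _]; first exact: is_poly0.
    by rewrite !mulr0 alt_noninj //; apply: costar_alt.
  have Ys : is_poly (r + k%:Z + 1) (fun x => costar e (iX C x) (eps \o J)).
    by apply: is_poly_sum => g _; apply: is_polyZr; apply: Bs.
  have [s [c [us hs cE]]] := homogenize Ys.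
  (* The dual coefficient vanishes where x_(J_a) = 0, so each of its monomials contains x_(J_a). *)
  have c0 a m : m \in s -> m (J a) = 0%N -> c m = 0.
    apply: (homog_face_eq0 hn us hs) => x xT xJ; rewrite -cE //.
    by apply: (costar_eq0 (a := a)) => g; apply: iX_boundary.
  pose pos (m : mi) := [forall a, (0 < m (J a))%N].
  exists (fun x => \sum_(m <- [seq m <- s | pos m]) c m * mon x (subm J m)); split.
    apply: is_poly_seq => m; rewrite mem_filter => /andP[/forallP mp /hs].
    by rewrite (mdg_subm Ji mp); lia.
  move=> x xT; rewrite cE //.
  have JE : \prod_a x ord0 (J a) = x ord0 ord0 * \prod_a x ord0 (f a).
    rewrite big_ord_recl /J consv0 /=; congr (_ * _).
    by apply: eq_bigr => a _; rewrite consvS.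
  rewrite mulrA -JE mulr_sumr big_filter (bigID pos) /= [X in _ + X]big_seq_cond [X in _ + X]big1 ?addr0.
    by apply: eq_bigr => m /forallP mp; rewrite (mon_subm Ji x mp) mulrCA.
  move=> m /andP[ms]; rewrite negb_forall => /existsP[a]; rewrite -eqn0Ngt => /eqP ma.
  by rewrite (c0 a m ms ma) mul0r.
have [q qP] := choice ex.
have qr f : is_poly r (q f) by case: (qP f).
(* k! comes from [altc], the inverse of k + 1 from [costar_contract], the last factor from the
   double star. *)
pose K : R := dual_cst R k l * (k`!%:R * (k.+1%:R^-1 * (k.+1`! * l`!)%:R)).
have K0 : K != 0.
  by rewrite /K natrM !mulf_neq0 ?invr_eq0 ?fact_neq0 ?natS_neq0 ?dual_cst_neq0.
have PA := altc_P_amb qr.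
exists (K^-1 *: altc q); first exact: P_amb_scale.
(* The comparison divides by x_0, hence is made on the open simplex. *)
apply: Lambda_density.
- by apply: dualA_Lambda; apply: P_amb_Lambda (P_amb_scale _ PA).
- exact: P_amb_Lambda PB.
move=> x w xT x0 _; rewrite dualA_scale -[(K^-1 *: _) x w]/(K^-1 * dualA e (altc q) x w).
pose b v := (x ord0 ord0)^-1 * costar e (iX C x) (consv (eps ord0) v).
have x00 : x ord0 ord0 != 0 by rewrite gt_eqF.
have ba : alt b by apply: alt_scale; apply: alt_consv; apply: costar_alt.
have bq (f : 'I_k -> 'I_n.+1) : (\prod_a x ord0 (f a)) * q f x = b (eps \o f).
  by rewrite /b -comp_consv (qP f).2 // mulKf.
suff H : dualA e (altc q) x w = K * iX C x w by rewrite H mulKf.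
have dE : dualA e (altc q) x w = dual_cst R k l * (k`!%:R * ((x ord0 ord0)^-1 *
    star e (fun J => x ord0 (J ord0) * costar e (iX C x) (upd (eps \o J) ord0 (eps ord0))) w)).
  rewrite /dualA /scaled_star; congr (_ * _).
  rewrite -!star_scale; congr (star e _ w); apply/funext => J.
  rewrite big_ord_recl -mulrA (altc_coef (J \o lift ord0) ba bq) /b upd0E; ring.
have bx v j : iX C x (upd v j x) = 0 by apply: iX_contract.
have := costar_contract e (eps ord0) w bx (alt_ml (Ba x)).
rewrite dotp_basis star_costar // dE /K => H.
transitivity (dual_cst R k l * (k`!%:R * ((x ord0 ord0)^-1 *
    (k.+1%:R^-1 * (x ord0 ord0 * ((k.+1`! * l`!)%:R * iX C x w)))))).
  by rewrite H mulKf ?natS_neq0.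
by rewrite [(x ord0 ord0)^-1 * _]mulrCA mulKf // -!mulrA.
Qed.

Lemma sum_tangent_basis (v : E) p :
  (\sum_i (v - (\sum_j v ord0 j) *: eps p) ord0 i = 0).
Proof.
under eq_bigr do rewrite mxE [X in _ + X]mxE [X in _ - X]mxE.
rewrite big_split /= sumrN -mulr_sumr.
have -> : \sum_i eps p ord0 i = 1.
  rewrite (bigD1 p) //= basis_vecE eqxx big1 ?addr0 // => a ap.
  by rewrite basis_vecE eq_sym (negbTE ap).
by rewrite mulr1 subrr.
Qed.

(** A single list of exponents for all coefficients makes it possible to write the form as a sum of
    monomials times constant forms. *)
Lemma common_monomials (r : int) (B : dform R n l) : P_amb r B ->
  exists (s : seq mi) (c : ('I_l -> 'I_n.+1) -> mi -> R), [/\ uniq s, homog r s &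
    forall g x, points T x -> coef B g x = \sum_(m <- s) c g m * mon x m].
Proof.
move=> [_ Bs].
have ex (g : {ffun 'I_l -> 'I_n.+1}) : exists sc : seq mi * (mi -> R), [/\ uniq sc.1, homog r sc.1 &
    forall x, points T x -> coef B g x = \sum_(m <- sc.1) sc.2 m * mon x m].
  by have [s [c [us hs cE]]] := homogenize (Bs g); exists (s, c).
have [F FP] := choice ex.
pose s := undup (flatten [seq (F g).1 | g <- enum {ffun 'I_l -> 'I_n.+1}]).
have sg g : {subset (F g).1 <= s}.
  move=> m mg; rewrite mem_undup; apply/flattenP; exists (F g).1 => //.
  by apply: map_f; rewrite mem_enum.
exists s, (fun g m => if m \in (F (finfun g)).1 then (F (finfun g)).2 m else 0); split.
- exact: undup_uniq.
- move=> m; rewrite mem_undup => /flattenP[_ /mapP[g _ ->] mg].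
  by have [_ hg _] := FP g; apply: hg.
move=> g x xT; have [ug _ gE] := FP (finfun g).
have -> : coef B g x = coef B (finfun g) x.
  by congr (B x _); apply/funext => j; rewrite ffunE.
rewrite gE // [RHS](bigID (fun m => m \in (F (finfun g)).1)) /= [X in _ + X]big1 ?addr0; last first.
  by move=> m /negbTE ->; rewrite mul0r.
have pe : perm_eq [seq m <- s | m \in (F (finfun g)).1] (F (finfun g)).1.
  apply: uniq_perm; rewrite ?filter_uniq ?undup_uniq // => m.
  by rewrite mem_filter; case mg : (m \in _) => //=; rewrite (sg _ _ mg).
by rewrite -(perm_big _ pe) /= big_filter; apply: eq_bigr => m ->.
Qed.

Lemma dual_surj_full (r : int) (B : dform R n l) : ~ (k = 0%N /\ r = 0) ->
  P_amb (r + k%:Z) B -> zero_on_boundary (restr_form T B) ->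
  exists2 D, P_amb (r - 1) D & restr_form T (dualA e (iX D)) = restr_form T B.
Proof.
move=> kr PB zb; have [Ba _] := PB.
have [s [c [us hs cE]]] := common_monomials PB.
(* The chosen [c g m] are not known to be antisymmetric in [g]; the determinants make [b m]
   alternating, and the factorial compensates [alt_det]. *)
pose b (m : mi) (v : 'I_l -> E) : R := l`!%:R^-1 *
  \sum_(g : {ffun 'I_l -> 'I_n.+1}) c g m * \det (\matrix_(i, j) v i ord0 (g j)).
have ba m : alt (b m) by apply: alt_scale; apply: alt_sum => g; apply: det_alt.
have bE x v : points T x -> \sum_(m <- s) b m v * mon x m = B x v.
  move=> xT; apply: (mulfI (fact_neq0 R l)); rewrite -alt_det //.
  rewrite mulr_sumr; under eq_bigr => m _ do rewrite /b -mulrA mulVKf ?fact_neq0 // mulr_suml.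
  rewrite exchange_big /=; apply: eq_bigr => g _.
  rewrite -[B x (eps \o g)]/(coef B g x) cE // mulr_suml.
  by apply: eq_bigr => m _; rewrite mulrAC.
(* For fixed v tangent to the facet, sum_m b_m(v) x^m vanishes on it, so its coefficients at the
   monomials free of x_i are zero. *)
have bz (m : mi) i (v : 'I_l -> E) : m \in s -> m i = 0%N -> (forall j, \sum_a v j ord0 a = 0) ->
    (forall j, v j ord0 i = 0) -> b m v = 0.
  move=> ms mi0 tv vi; apply: (homog_face_eq0 hn us hs (c := fun m => b m v) (i := i)) => //.
  move=> x xT xi; rewrite bE //.
  by rewrite -(zb i x v xT xi (fun j => conj (tv j) (vi j))) restr_val.
(* [pr m] extends [b m] from tangent vectors to all of R^{n+1}; projecting along
   [eps (p m)] with [p m] in the support of [m] keeps it zero on the vectors with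
   [v_i = 0] for an [i] outside the support. *)
pose p (m : mi) : 'I_n.+1 := odflt ord0 [pick i | (0 < m i)%N].
have pP (m : mi) i : m (p m) = 0%N -> m i = 0%N.
  rewrite /p; case: pickP => [j /= jm mj|no _]; first by rewrite mj in jm.
  by have := no i; case: (m i).
pose pr m (v : E) : E := v - (\sum_j v ord0 j) *: eps (p m).
have pr_lin m a (y z : E) : pr m (a *: y + z) = a *: pr m y + pr m z.
  rewrite /pr; under eq_bigr do rewrite mxE [X in X + _]mxE.
  by rewrite big_split /= -mulr_sumr; apply/rowP => i; rewrite !mxE; ring.
pose bt m v := b m (pr m \o v).
have bta m : alt (bt m) by apply: alt_lin.
pose y m := costar e (bt m).
have ya m : alt (y m) by apply: costar_alt.
have y_off (m : mi) (J : 'I_k.+1 -> 'I_n.+1) a : m \in s -> m (J a) = 0%N -> J a != p m ->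
    y m (eps \o J) = 0.
  move=> ms mJ Jp; apply: (costar_eq0 (a := a)) => g gJ.
  apply: (bz m (J a)) => // j; first exact: sum_tangent_basis.
  rewrite /= /pr mxE [X in _ + X]mxE [X in _ - X]mxE !basis_vecE (negbTE (gJ j)).
  by rewrite eq_sym (negbTE Jp) mulr0 subr0.
(* [y_off] fails only if [J a] is [p m], which forces m = 0 and r + k = 0. Then k > 0 by the
   excluded case, and another entry of the injective [J] takes the place of [J a]. *)
have y0 (m : mi) (J : 'I_k.+1 -> 'I_n.+1) a : injective J -> m \in s -> m (J a) = 0%N ->
    y m (eps \o J) = 0.
  move=> Ji ms mJ; have [Jp|] := eqVneq (J a) (p m); last exact: (y_off m J a).
  have m0 i : m i = 0%N by apply: pP; rewrite -Jp.
  have k0 : (0 < k)%N.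
    rewrite lt0n; apply/eqP => k0; apply: kr; split=> //.
    have := hs m ms; rewrite k0 addr0 => <-.
    by rewrite /mdg big1.
  have [a' aa'] : exists a' : 'I_k.+1, a' != a.
    case: (altP (a =P ord0)) => [->|a0]; last by exists ord0; rewrite eq_sym.
    by exists (lift ord0 (Ordinal k0)); rewrite eq_sym neq_lift.
  by apply: (y_off m J a') => //; rewrite -Jp (inj_eq Ji).
have ex (J : 'I_k.+1 -> 'I_n.+1) : exists q : E -> R, is_poly (r - 1) q /\
    forall x : E, (\prod_a x ord0 (J a)) * q x = \sum_(m <- s) y m (eps \o J) * mon x m.
  have [Ji|Jn] := pselect (injective J); last first.
    exists (fun=> 0); split=> [|x]; first exact: is_poly0.
    by rewrite mulr0 big1 // => m _; rewrite alt_noninj ?mul0r.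
  pose pos (m : mi) := [forall a, (0 < m (J a))%N].
  exists (fun x => \sum_(m <- [seq m <- s | pos m]) y m (eps \o J) * mon x (subm J m)); split.
    apply: is_poly_seq => m; rewrite mem_filter => /andP[/forallP mp /hs].
    by rewrite (mdg_subm Ji mp); lia.
  move=> x; rewrite mulr_sumr big_filter [RHS](bigID pos) /=.
  rewrite [X in _ = _ + X]big_seq_cond [X in _ = _ + X]big1 ?addr0.
    by apply: eq_bigr => m /forallP mp; rewrite (mon_subm Ji x mp) mulrCA.
  move=> m /andP[ms]; rewrite negb_forall => /existsP[a]; rewrite -eqn0Ngt => /eqP ma.
  by rewrite (y0 m J a Ji ms ma) mul0r.
have [q qP] := choice ex.
have qr f : is_poly (r - 1) (q f) by case: (qP f).
pose K : R := dual_cst R k l / k.+1%:R * (k.+1`!%:R * (k.+1`! * l`!)%:R).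
have K0 : K != 0.
  by rewrite /K natrM !mulf_neq0 ?invr_eq0 ?fact_neq0 ?natS_neq0 ?dual_cst_neq0.
have PD := altc_P_amb qr.
exists (K^-1 *: altc q); first exact: P_amb_scale.
have -> : iX (K^-1 *: altc q) = K^-1 *: iX (altc q) by [].
rewrite dualA_scale; apply/restr_eqP => x w xT tw.
rewrite -[(K^-1 *: dualA _ _) _ _]/(K^-1 * dualA e (iX (altc q)) x w).
rewrite dualA_iX //; last by case: PD.
pose Y v := \sum_(m <- s) y m v * mon x m.
have Ya : alt Y.
  split=> [v j a z1 z2|v i j ij].
    rewrite mulr_sumr -big_split; apply: eq_bigr => m _ /=.
    by rewrite (alt_ml (ya m)) mulrDl mulrA.
  by rewrite /Y -sumrN; apply: eq_bigr => m _; rewrite (ya m).2 // mulNr.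
have -> : star e (fun J => (\prod_a x ord0 (J a)) * altc q x (eps \o J)) w =
    k.+1`!%:R * star e (fun J => Y (eps \o J)) w.
  rewrite -star_scale; congr (star e _ w); apply/funext => J.
  by rewrite (altc_coef J Ya) // => f; rewrite (qP f).2.
have -> : star e (fun J => Y (eps \o J)) w = (k.+1`! * l`!)%:R * B x w.
  rewrite -(bE x w xT) mulr_sumr /star.
  under eq_bigr => J _ do rewrite mulr_suml.
  rewrite exchange_big /=; apply: eq_bigr => m _.
  (* On tangent vectors the projection [pr m] is the identity. *)
  have -> : b m w = bt m w.
    congr (b m _); apply/funext => j; rewrite /= /pr; have := tw j; rewrite /= => ->.
    by rewrite scale0r subr0.
  rewrite mulrA -(star_costar e w (bta m)) /star mulr_suml.
  by apply: eq_bigr => J _; rewrite mulrAC.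
transitivity (K^-1 * (K * B x w)); last by rewrite mulKf.
by rewrite /K; ring.
Qed.

End Surjectivity.

(** * The four isomorphisms *)

Section Isomorphisms.
Local Open Scope classical_set_scope.
Variables (R : realType) (n : nat).
Notation T := (simplex R n).
Notation S := (sphere R n).

Lemma linear_isoI k l (V : set (dform R n k)) (W : set (dform R n l)) F :
  (forall c a b, V a -> V b -> F (c *: a + b) = c *: F a + F b) ->
  (forall a, V a -> W (F a)) -> (forall a b, V a -> V b -> F a = F b -> a = b) ->
  (forall b, W b -> exists2 a, V a & F a = b) -> linear_iso V W F.
Proof.
move=> lin hom inj surj; split=> //; split=> [|a b|] //.
by rewrite !inE; apply: inj.
Qed.

(** With [H] the duality map and [G] its first stage, which ends on the sphere, the remaining stage
    [F] is an isomorphism too. *)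
Lemma linear_iso_factor k l m (V : set (dform R n k)) (U : set (dform R n l))
    (W : set (dform R n m)) G H F :
  linear_iso V U G -> linear_iso V W H ->
  (forall c a b, V a -> V b -> V (c *: a + b)) -> (forall a, V a -> F (G a) = H a) ->
  linear_iso U W F.
Proof.
move=> [Gl [Gh Gi Gs]] [Hl [Hh Hi Hs]] Vl FG; apply: linear_isoI.
- move=> c _ _ /Gs[a Va <-] /Gs[b Vb <-].
  by rewrite -Gl // !FG ?Hl //; apply: Vl.
- by move=> _ /Gs[a Va <-]; rewrite FG //; apply: Hh.
- move=> _ _ /Gs[a Va <-] /Gs[b Vb <-]; rewrite !FG // => /Hi -> //; exact: mem_set.
- by move=> b /Hs[a Va <-]; exists (G a); [apply: Gh | rewrite FG].
Qed.

Variables (k : nat) (r : int).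
Hypotheses (hn : (1 <= n)%N) (hk : (k <= n)%N).
Let ek := addSn_subn hk.

Lemma dual_map_iso :
  linear_iso (P_ r k T) (P0minus (r + k%:Z + 1) (n - k)) (dual_map k).
Proof.
apply: linear_isoI.
- by move=> c a b /P_Lambda La /P_Lambda Lb; apply: dual_map_lin.
- move=> _ [A PA <-]; rewrite (dual_mapE hn hk (P_amb_Lambda PA)); split.
    by exists (dualA ek A) => //; apply: dualA_Pminus.
  exact: dualA_boundary.
- by move=> a b /P_Lambda La /P_Lambda Lb; apply: dual_map_inj.
move=> _ [[_ [C PC <-] <-] zb]; rewrite addrK in PC.
have [A PA Ab] := dual_surj_minus hn ek PC zb.
by exists (restr_form T A); [exists A | rewrite (dual_mapE hn hk (P_amb_Lambda PA))].
Qed.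

Lemma dual_map_iso_minus : ~ (k = 0%N /\ r = 0) ->
  linear_iso (Pminus r k T) (P0 (r + k%:Z) (n - k)) (dual_map k).
Proof.
move=> kr; have L (D : dform R n k.+1) : P_amb (r - 1) D -> Lambda_amb (iX D).
  by move=> PD; apply: (P_amb_Lambda (Pminus_amb_P (r := r) _)); exists D.
apply: linear_isoI.
- by move=> c a b /Pminus_Lambda La /Pminus_Lambda Lb; apply: dual_map_lin.
- move=> _ [_ [D PD <-] <-]; rewrite (dual_mapE hn hk (L _ PD)); split.
    exact: dualA_iX_P.
  exact: dualA_boundary.
- by move=> a b /Pminus_Lambda La /Pminus_Lambda Lb; apply: dual_map_inj.
move=> _ [[B PB <-] zb]; have [D PD Db] := dual_surj_full hn ek kr PB zb.
exists (restr_form T (iX D)); last by rewrite (dual_mapE hn hk (L _ PD)).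
by exists (iX D) => //; exists D.
Qed.

Lemma Phi_pull_iso :
  linear_iso (P_ r k T) (P_even (2 * r + k%:Z) k) (@Phi_pull R n k).
Proof.
apply: linear_isoI.
- move=> c _ _ [A _ <-] [B _ <-]; rewrite -restr_lin !Phi_pullE -restr_lin //.
- by move=> _ [A PA <-]; apply: Phi_pull_even.
- by move=> a b /P_Lambda La /P_Lambda Lb; apply: Phi_pull_injL.
exact: even_surj.
Qed.

Lemma hodge_Phi_iso :
  linear_iso (Pminus r k T) (P_odd (2 * r + k%:Z - 1) (n - k))
    (fun a => hodge (Phi_pull a)).
Proof.
have altX (D : dform R n k.+1) : P_amb (r - 1) D -> forall x, Defs.alternating (iX D x).
  by move=> PD; have [] : P_amb r (iX D) by apply: Pminus_amb_P; exists D.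
apply: linear_isoI.
- by move=> c a b /Pminus_Lambda La /Pminus_Lambda Lb; apply: hodge_Phi_lin.
- move=> _ [_ [D PD <-] <-]; rewrite (hodge_PhiE hn hk (altX _ PD)).
  exact: hodgeA_iX_odd.
- by move=> a b /Pminus_Lambda La /Pminus_Lambda Lb; apply: hodge_Phi_inj.
move=> b /(odd_surj ek)[D PD Db]; exists (restr_form T (iX D)).
  by exists (iX D) => //; exists D.
by rewrite (hodge_PhiE hn hk (altX _ PD)).
Qed.

End Isomorphisms.

Unset Implicit Arguments.
Set Strict Implicit.
Set Printing Implicit Defensive.

(** For k = r = 0 the second isomorphism fails: P_0^- Lambda^0 is zero, while the constant n-forms
    on the simplex all vanish on its boundary for reasons of dimension. The odd forms of degree -1
    are zero as well. *)
Theorem corollary3p3 (R : realType) (n k : nat) (r : int)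
    (hn : (1 <= n)%N) (hk : (k <= n)%N) :
  (forall a : dform R n k, Lambda (simplex R n) k a ->
     Lambda (simplex R n) (n - k) (dual_map k a) /\
     Phi_pull (dual_map k a) = uN_hodge (Phi_pull a)) /\
  pointwise_defined same_pt (Lambda (simplex R n) k) (dual_map k) /\
  linear_iso (P_ r k (simplex R n)) (P0minus (r + k%:Z + 1) (n - k))
    (dual_map k) /\
  (~ (k = 0%N /\ r = 0) ->
   linear_iso (Pminus r k (simplex R n)) (P0 (r + k%:Z) (n - k))
     (dual_map k)) /\
  pointwise_isomorphic simplex_to_sphere
    (P_ r k (simplex R n)) (P_even (2 * r + k%:Z) k) /\
  @pointwise_isomorphic R n sphere_to_simplex _ _
    (P_even (2 * r + k%:Z) k) (P0minus (r + k%:Z + 1) (n - k)) /\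
  pointwise_isomorphic simplex_to_sphere
    (Pminus r k (simplex R n)) (P_odd (2 * r + k%:Z - 1) (n - k)) /\
  (~ (k = 0%N /\ r = 0) ->
   @pointwise_isomorphic R n sphere_to_simplex _ _
     (P_odd (2 * r + k%:Z - 1) (n - k)) (P0 (r + k%:Z) (n - k))).
Proof.
have isoP := @Phi_pull_iso R n k r.
have isoM := @hodge_Phi_iso R n k r hn hk.
split; first exact: dual_map_Lambda.
split; first exact: dual_map_pointwise.
split; first exact: dual_map_iso.
split; first exact: dual_map_iso_minus.
split.
  exists (@Phi_pull R n k); split=> // a a' x u _ _ [uS ->]; exact: Phi_pull_at_eq.
split.
  exists (fun b => Phi_pull_inv (uN_hodge b)); split.
    have := linear_iso_factor (F := fun b => Phi_pull_inv (uN_hodge b)) isoP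
      (@dual_map_iso R n k r hn hk).
    by apply=> // c a b; apply: P_lin.
  move=> b b' u x Vb Vb' [uS ->].
  have [_ [_ _ surj]] := isoP.
  have [a /P_Lambda La <-] := surj b Vb; have [a' /P_Lambda La' <-] := surj b' Vb'.
  move=> H; apply: (dual_map_at hn hk La La' uS); exact: hodge_Phi_at.
split.
  exists (fun a => hodge (Phi_pull a)); split=> // a a' x u.
  move=> /Pminus_Lambda La /Pminus_Lambda La' [uS ->] H.
  by apply: hodge_Phi_at => //; apply: Phi_pull_at_eq.
(* The odd forms here are already Hodge stars of pulled-back forms, so only multiplication by u_N
   and the inverse pull-back remain. *)
move=> kr; exists (fun b => Phi_pull_inv (fun u => uN u *: b u)); split.
  have := linear_iso_factor (F := fun b => Phi_pull_inv (fun u => uN u *: b u)) isoM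
    (@dual_map_iso_minus R n k r hn hk kr).
  by apply=> // c a b; apply: Pminus_lin.
move=> b b' u x Vb Vb' [uS ->].
have [_ [_ _ surj]] := isoM.
have [a /Pminus_Lambda La <-] := surj b Vb; have [a' /Pminus_Lambda La' <-] := surj b' Vb'.
exact: (dual_map_at hn hk La La' uS).
Qed.
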